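(* For $i=1,\dots,n$ let $(\mathcal P^{(i)}_t)_{t\ge0}$ be a primitive QMS on $\mathcal B(\mathcal H_i)$ with generator $\mathcal L_i$ and invariant state $\sigma_i$, satisfying $\mathrm{LSI}_{q,\mathrm{CB}}(c_i,d_i)$. Then the QMS on $\mathcal B(\bigotimes_{i=1}^n\mathcal H_i)$ generated by $\mathcal L=\sum_{i=1}^n\bigotimes_{k<i}\mathrm{id}_{\mathcal H_k}\otimes\mathcal L_i\otimes\bigotimes_{k>i}\mathrm{id}_{\mathcal H_k}$, with invariant state $\bigotimes_i\sigma_i$, satisfies $\mathrm{LSI}_{q,\mathrm{CB}}(c,d)$ with $c=\max_ic_i$ and $d=\sum_id_i$.
   Context: All Hilbert spaces are finite-dimensional. A QMS $e^{t\mathcal L}$ (unital completely positive maps) on $\mathcal B(\mathcal K)$ is primitive if it has a unique invariant state $\sigma$, full rank, to which all states converge. For such a QMS and $k\ge1$ set, on $\mathcal B(\mathbb C^k\otimes\mathcal K)$: $\tau_k=\frac{\mathbb I_k}{k}\otimes\sigma$, $\mathcal L_k=\mathrm{id}_k\otimes\mathcal L$, $E_k[X]=\mathrm{Tr}_{\mathcal K}[(\mathbb I_k\otimes\sigma)X]\otimes\mathbb I_{\mathcal K}$, $\Gamma^s(X)=\tau_k^{s/2}X\tau_k^{s/2}$, $\|X\|_{p,\tau_k}=\|\Gamma^{1/p}(X)\|_p$ (Schatten norm), $\langle X,Y\rangle_{\tau_k}=\mathrm{Tr}[\tau_k^{1/2}X^*\tau_k^{1/2}Y]$, $I_{q,p}(X)=\Gamma^{-1/q}(|\Gamma^{1/p}(X)|^{p/q})$;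 Dirichlet form $\mathcal E_p(X)=-\frac{p}{2(p-1)}\langle I_{p',p}(X),\mathcal L_k(X)\rangle_{\tau_k}$ for $p>1$ ($p'$ conjugate), $\mathcal E_1(X)=-\frac12\mathrm{Tr}[\Gamma^1(\mathcal L_k X)(\ln\Gamma^1(X)-\ln\tau_k)]$; entropy for $X>0$, $Z=\Gamma^{1/p}(X)$: $\mathrm{Ent}_p(X)=\frac1p\mathrm{Tr}[Z^p(\ln Z^p-\ln\tau_k-\ln E_k[\tau_k^{-1/2}Z^p\tau_k^{-1/2}])]$. The QMS satisfies $\mathrm{LSI}_{q,\mathrm{CB}}(c,d)$ if for all $k\ge1$ and positive definite $X$, $\mathrm{Ent}_q(X)\le c\,\mathcal E_q(X)+\frac{2d}{q}\|X\|^q_{q,\tau_k}$. *)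

(* Defs.v *)
From HB Require Import structures.
From mathcomp Require Import all_boot all_order all_algebra.
From mathcomp Require Import complex.
From mathcomp Require Import all_classical all_reals all_analysis.
Import numFieldNormedType.Exports.

Set Implicit Arguments.
Unset Strict Implicit.
Unset Printing Implicit Defensive.

Import Order.TTheory GRing.Theory Num.Theory.
Local Open Scope ring_scope.
Local Open Scope complex_scope.
Local Open Scope sesquilinear_scope.
Local Open Scope classical_set_scope.

Section QMS.
Variable R : realType.
Local Notation C := (R[i]).

(* A finite-dimensional Hilbert space is C^T for a finite type T;
   B(C^T) is represented by square matrices of size #|T|, the entry at
   (x, y) : T * T being stored at (enum_rank x, enum_rank y). *)
Definition op (T : finType) := 'M[C]_#|T|.

Definition entry (T : finType) (X : op T) (x y : T) : C :=
  X (enum_rank x) (enum_rank y).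

Definition mkop (T : finType) (f : T -> T -> C) : op T :=
  \matrix_(i, j) f (enum_val i) (enum_val j).

Definition eunit (T : finType) (x y : T) : op T :=
  delta_mx (enum_rank x) (enum_rank y).

Definition psd (m : nat) (X : 'M[C]_m) : Prop :=
  X \is hermsymmx /\ forall v : 'cV[C]_m, 0 <= (v ^t* *m X *m v) 0 0.

Definition posdef (m : nat) (X : 'M[C]_m) : Prop :=
  X \is hermsymmx /\
  forall v : 'cV[C]_m, v != 0 -> 0 < (v ^t* *m X *m v) 0 0.

Definition is_state (m : nat) (rho : 'M[C]_m) : Prop :=
  psd rho /\ \tr rho = 1.

(* ---------- functional calculus for Hermitian matrices ----------
   A = P^-1 diag(lambda) P with P unitary (spectral theorem, spectral.v);
   f(A) := P^-1 diag(f(lambda)) P  (lambda real for Hermitian A). *)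
Definition mfun (m : nat) (f : R -> R) (A : 'M[C]_m) : 'M[C]_m :=
  invmx (spectralmx A) *m
  diag_mx (map_mx (fun z : C => (f (complex.Re z))%:C) (spectral_diag A)) *m
  spectralmx A.

Definition mpow (m : nat) (A : 'M[C]_m) (s : R) := mfun (fun x => x `^ s) A.
Definition mlog (m : nat) (A : 'M[C]_m) := mfun (@ln R) A.
Definition mabs (m : nat) (Y : 'M[C]_m) := mfun Num.sqrt (Y ^t* *m Y).

Definition schatten (m : nat) (p : R) (Y : 'M[C]_m) : R :=
  (complex.Re (\tr (mpow (mabs Y) p))) `^ p^-1.

(* ampliation id_k (x) Phi on B(C^k (x) C^T) *)
Definition amp (k : nat) (T : finType) (Phi : op T -> op T)
    (X : op ('I_k * T)%type) : op ('I_k * T)%type :=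
  mkop (fun ax by_ : ('I_k * T)%type =>
    \sum_(u : T) \sum_(v : T)
      entry X (ax.1, u) (by_.1, v) * entry (Phi (eunit u v)) ax.2 by_.2).

Definition completely_positive (T : finType) (Phi : op T -> op T) : Prop :=
  forall (k : nat) (X : op ('I_k * T)%type), psd X -> psd (amp Phi X).

Definition unital (T : finType) (Phi : op T -> op T) : Prop := Phi 1%:M = 1%:M.

Definition linear_superop (T : finType) (L : op T -> op T) : Prop :=
  forall (a : C) (X Y : op T), L (a *: X + Y) = a *: L X + L Y.

Definition expm (m : nat) (A : 'M[C]_m) : 'M[C]_m :=
  lim (series (fun j : nat => (j`!%:R)^-1 *: A ^+ j) @ \oo).

Definition qsg (T : finType) (L : op T -> op T) (t : R) (X : op T) : op T :=
  vec_mx (mxvec X *m expm (t%:C *: lin_mx L)).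

Definition is_QMS (T : finType) (L : op T -> op T) : Prop :=
  linear_superop L /\
  forall t : R, 0 <= t -> unital (qsg L t) /\ completely_positive (qsg L t).

(* sigma is an invariant state (Heisenberg picture: Tr[sigma P_t X] = Tr[sigma X]) *)
Definition invariant_state (T : finType) (L : op T -> op T) (sigma : op T) :=
  is_state sigma /\
  forall (t : R) (X : op T), 0 <= t -> \tr (sigma *m qsg L t X) = \tr (sigma *m X).

(* primitive QMS: unique invariant state sigma, full rank, and every state
   converges to sigma under the (predual) semigroup:
   Tr[rho P_t(X)] -> Tr[sigma X] as t -> +oo, for all observables X *)
Definition primitive_QMS (T : finType) (L : op T -> op T) (sigma : op T) :=
  is_QMS L /\ invariant_state L sigma /\ posdef sigma /\
  (forall sigma', invariant_state L sigma' -> sigma' = sigma) /\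
  (forall rho : op T, is_state rho -> forall X : op T,
     forall eps : R, 0 < eps -> exists t0 : R, forall t : R, t0 <= t ->
       `| \tr (rho *m qsg L t X) - \tr (sigma *m X) | < eps%:C).

Section LSI.
Variables (T : finType) (L : op T -> op T) (sigma : op T) (k : nat).
Local Notation K2 := ('I_k * T)%type.

Definition tauk : op K2 :=
  mkop (fun ax by_ : K2 => (ax.1 == by_.1)%:R / k%:R * entry sigma ax.2 by_.2).

Definition Lk : op K2 -> op K2 := amp L.

(* E_k[X] = Tr_K[(I_k (x) sigma) X] (x) I_K *)
Definition Ek (X : op K2) : op K2 :=
  mkop (fun ax by_ : K2 => (ax.2 == by_.2)%:R *
    \sum_(u : T) \sum_(v : T) entry sigma u v * entry X (ax.1, v) (by_.1, u)).

Definition Gam (s : R) (X : op K2) : op K2 :=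
  mpow tauk (s / 2) *m X *m mpow tauk (s / 2).

Definition normtau (p : R) (X : op K2) : R := schatten p (Gam p^-1 X).

Definition innertau (X Y : op K2) : C :=
  \tr (mpow tauk (1 / 2) *m X ^t* *m mpow tauk (1 / 2) *m Y).

Definition Iqp (q p : R) (X : op K2) : op K2 :=
  Gam (- q^-1) (mpow (mabs (Gam p^-1 X)) (p / q)).

(* Dirichlet form E_p (its value is real; we take the real part) *)
Definition dirichlet (p : R) (X : op K2) : R :=
  if p == 1 then
    - 2^-1 * complex.Re (\tr (Gam 1 (Lk X) *m (mlog (Gam 1 X) - mlog tauk)))
  else
    - (p / (2 * (p - 1))) * complex.Re (innertau (Iqp (p / (p - 1)) p X) (Lk X)).

Definition entp (p : R) (X : op K2) : R :=
  let Zp := mpow (Gam p^-1 X) p in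
  p^-1 * complex.Re (\tr (Zp *m
     (mlog Zp - mlog tauk
      - mlog (Ek (mpow tauk (- 2^-1) *m Zp *m mpow tauk (- 2^-1)))))).

End LSI.

Definition LSI_CB (T : finType) (L : op T -> op T) (sigma : op T)
    (q c d : R) : Prop :=
  forall (k : nat) (X : op ('I_k * T)%type), (0 < k)%N -> posdef X ->
    entp sigma q X <=
      c * dirichlet L sigma q X + (2 * d / q) * (normtau sigma q X) `^ q.

Section Tensor.
Variables (n : nat) (T : 'I_n -> finType).
Definition TensT := {dffun forall i : 'I_n, T i}.

(* id (x) ... (x) Phi_i (x) ... (x) id, acting on the i-th factor *)
Definition embed (i : 'I_n) (Phi : op (T i) -> op (T i)) (X : op TensT) : op TensT :=
  mkop (fun u v : TensT =>
    \sum_(x : TensT) \sum_(y : TensT)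
      (if [forall j, (j != i) ==> ((x j == u j) && (y j == v j))]
       then entry X x y * entry (Phi (eunit (x i) (y i))) (u i) (v i)
       else 0)).

Definition sum_gen (L : forall i, op (T i) -> op (T i)) (X : op TensT) : op TensT :=
  \sum_(i < n) embed (L i) X.

Definition tens_state (sigma : forall i, op (T i)) : op TensT :=
  mkop (fun u v : TensT => \prod_(i < n) entry (sigma i) (u i) (v i)).
End Tensor.

End QMS.

(* Main.v *)
(* Write rho for the q-th power of the matrix Gamma^{1/q}(X). Then q Ent_q(X) is the
   relative entropy D(rho || rho_0 (x) sigma), where rho_0 is the marginal of rho on the
   auxiliary space C^k. For a tensor product, strong subadditivity bounds it by the sum of
   the D(rho || rho_{others} (x) sigma_i). Regarding everything except the i-th factor as
   auxiliary space, the i-th term is the entropy of an observable X_i with the same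
   Gamma^{1/q}(X_i), hence with the same q-norm, and its Dirichlet form is the one of
   the i-th summand of the generator (for q = 1 because Tr[sigma_i L_i Y] = 0). So the
   inequalities for the factors add up; replacing c_i by c only needs that Dirichlet forms
   are nonnegative.

   Strong subadditivity and the nonnegativity of the Dirichlet forms both come from one
   interpolation inequality. For positive dual maps P and Q with P unital and
   sigma' = Q(sigma), the function
     F(z) = Tr[rho^{1-z} sigma^{z/2} P(sigma'^{-z/2} rho'^z sigma'^{-z/2}) sigma^{z/2}]
   is bounded by Tr rho = Tr rho' on the lines Re z = 0 and Re z = 1, because a positive
   unital map contracts unitaries; hence it is bounded by the same constant at every
   z = s in [0, 1]. The bound at s = 1/q gives E_q >= 0, the derivative at s = 1 gives
   E_1 >= 0, and the derivative at s = 0, for P = Q a partial trace, gives the data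
   processing inequality behind strong subadditivity. The three lines theorem is only
   needed for exponential polynomials, where it is elementary: the mean square of F on a
   vertical line is the sum of |a|^2 e^{2 l s}, which is convex in s, and the powers F^m
   have only polynomially many exponents. *)

Require Import Defs.
From HB Require Import structures.
From mathcomp Require Import all_boot all_order all_algebra.
From mathcomp Require Import complex.
From mathcomp Require Import all_classical all_reals all_analysis.
From mathcomp Require Import ring lra.
(* [all_analysis] exports another [mfun]; the one of [Defs] must win. *)
Require Import Defs.
Import numFieldNormedType.Exports.
Import Order.TTheory GRing.Theory Num.Theory.
Local Open Scope ring_scope.

Set Implicit Arguments.
Unset Strict Implicit.
Unset Printing Implicit Defensive.
Local Open Scope complex_scope.
Local Open Scope sesquilinear_scope.

(** * Three lines theorem for exponential polynomials *)

(** No holomorphic function theory occurs: every matrix that is raised to a complex power is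
    diagonalised, so F is an explicit exponential polynomial, and its derivative is a formal one
    carried beside it. Likewise the generator enters only through the estimate exp(tA) = 1 + tA +
    O(t^2).

    The obstacle in passing to one factor is that the hypotheses concern a reference state which is
    maximally mixed on the auxiliary space, while the other factors carry their own sigma_j. The two
    reference states are linked by a ratio of their powers; it acts trivially on the i-th factor,
    hence moves through the ampliated generator.

    Partial traces are replaced by normalised conditional expectations inside one fixed matrix
    algebra, so that they compose and commute without changes of type; only the comparison with a
    single factor relabels the basis. The price is constants ln dim, which match because the
    dimension of the tensor product is the product of the dimensions. *)

Section ThreeLines.
Variable R : realType.
Local Notation C := R[i].

Definition cis (x : R) : C := cos x +i* sin x.

Lemma cisD (x y : R) : cis (x + y) = cis x * cis y.
Proof. by rewrite /cis cosD sinD; simpc; rewrite [X in _ +i* X]addrC. Qed.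

Lemma cis0 : cis 0 = 1.
Proof. by rewrite /cis cos0 sin0. Qed.

Lemma conj_cis (x : R) : (cis x)^* = cis (- x).
Proof. by rewrite /cis cosN sinN. Qed.

Lemma norm_cis (x : R) : `|cis x| = 1.
Proof. by rewrite normc_def /= cos2Dsin2 sqrtr1. Qed.

Lemma cisMn (x : R) (k : nat) : cis (x * k%:R) = cis x ^+ k.
Proof.
elim: k => [|k IH]; first by rewrite mulr0 cis0 expr0.
by rewrite -addn1 natrD mulrDr mulr1 cisD IH addn1 exprSr.
Qed.

Lemma cis_neq1 (x : R) : 0 < `|x| <= 1 -> cis x != 1.
Proof.
move=> /andP[x0 x1]; apply/eqP => -[_ sx0].
have pi1 : 1 < pi :> R by rewrite (lt_le_trans _ (@pi_ge2 R))// ltr1n.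
have : 0 < sin `|x| by apply: sin_gt0_pi; rewrite x0 (le_lt_trans x1).
by case: (ger0P x) => _; rewrite ?sinN sx0 ?oppr0 ltxx.
Qed.

(* [cexp l s t] is $e^{l (s + i t)}$. *)
Definition cexp (l s t : R) : C := (expR (l * s))%:C * cis (l * t).

Lemma cexpD (l m s t : R) : cexp (l + m) s t = cexp l s t * cexp m s t.
Proof. by rewrite /cexp !mulrDl expRD cisD rmorphM /= mulrACA. Qed.

Lemma cexp0 (s t : R) : cexp 0 s t = 1.
Proof. by rewrite /cexp !mul0r expR0 cis0 mulr1. Qed.

Lemma cexp_real (l s : R) : cexp l s 0 = (expR (l * s))%:C.
Proof. by rewrite /cexp mulr0 cis0 mulr1. Qed.

Definition exppol (r : seq (C * R)) (s t : R) : C :=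
  \sum_(p <- r) p.1 * cexp p.2 s t.

Definition dexppol (r : seq (C * R)) (s t : R) : C :=
  \sum_(p <- r) p.1 * (p.2)%:C * cexp p.2 s t.

(** Here each exponent of [S] has one coefficient; for duplicate-free [S] these are Fourier
    coefficients, which the mean-square bound needs. *)
Definition expsum (S : seq R) (a : R -> C) (s t : R) : C :=
  \sum_(l <- S) a l * cexp l s t.

Lemma geometric_sum_bound (w : C) (N : nat) : `|w| = 1 -> w != 1 ->
  `|\sum_(k < N) w ^+ k| <= 2 / `|1 - w|.
Proof.
move=> w1 wn1; have w0 : 0 < `|1 - w| by rewrite normr_gt0 subr_eq0 eq_sym.
rewrite ler_pdivlMr// mulrC -normrM -opprB mulNr normrN -subrX1.
by rewrite (le_trans (ler_normB _ _))// normrX w1 expr1n normr1.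
Qed.

Lemma le1_of_natmul (s K : R) : (forall N : nat, N%:R * s <= N%:R + K) -> s <= 1.
Proof.
move=> h; rewrite leNgt; apply/negP => s1.
have s10 : 0 < s - 1 by rewrite subr_gt0.
have := archi_boundP (normr_ge0 (K / (s - 1))).
set N := Num.bound _ => hN; have := h N.
rewrite leNgt => /negP; apply.
rewrite -ltrBrDl -[X in _ - X]mulr1 -mulrBr -ltr_pdivrMr//.
by apply: le_lt_trans hN; exact: ler_norm.
Qed.

Lemma sqr_norm_expsum (S : seq R) (a : R -> C) (t : R) :
  `|expsum S a 0 t| ^+ 2 =
  \sum_(l <- S) \sum_(m <- S) a l * (a m)^* * cis ((l - m) * t).
Proof.
rewrite sqr_normc /expsum rmorph_sum /= mulr_suml; apply: eq_bigr => l _.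
rewrite mulr_sumr; apply: eq_bigr => m _.
have c0 x : cexp x 0 t = cis (x * t) by rewrite /cexp mulr0 expR0 mul1r.
rewrite !c0 rmorphM /= -/(cis _) -[X in _ = X]mulrA mulrBl cisD -conj_cis.
by rewrite mulrACA -mulrA.
Qed.

Lemma Re_le (x y : C) : x <= y -> complex.Re x <= complex.Re y.
Proof. by rewrite lecE => /andP[]. Qed.

Lemma ge0_complexE (x : C) : 0 <= x -> x = (complex.Re x)%:C.
Proof. by move=> x0; rewrite RRe_real// ger0_real. Qed.

(** Average |F|^2 over the points k / B with k < N instead of integrating over the line: the
    diagonal terms contribute N times the sum of squares, the others are geometric sums bounded
    independently of N, and N is arbitrary. *)
Lemma mean_square_le1 (S : seq R) (a : R -> C) : uniq S ->
  (forall t, `|expsum S a 0 t| <= 1) -> \sum_(l <- S) `|a l| ^+ 2 <= 1.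
Proof.
move=> uS bnd.
(* [B] is so large that every difference of two exponents, divided by [B], lies in [-1, 1]; then
   distinct exponents give a ratio [w l m] other than 1. *)
pose B : R := 1 + 2 * \sum_(l <- S) `|l|.
have B0 : 0 < B by rewrite ltr_pwDl// mulr_ge0// sumr_ge0.
have leB l : l \in S -> `|l| <= \sum_(l <- S) `|l|.
  by move=> lS; rewrite (bigD1_seq l)//= lerDl sumr_ge0.
pose w l m := cis ((l - m) * B^-1).
have wn1 l m : l \in S -> m \in S -> m != l -> w l m != 1.
  move=> lS mS ml; apply: cis_neq1; rewrite normrM normfV (gtr0_norm B0).
  rewrite divr_gt0 ?normr_gt0 ?subr_eq0 1?eq_sym//= ler_pdivrMr// mul1r.
  rewrite (le_trans (ler_normB _ _))// /B mulr_natl mulr2n.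
  by have := leB _ lS; have := leB _ mS; lra.
pose K : C := \sum_(l <- S) \sum_(m <- S | m != l)
   `|a l| * `|a m| * (2 / `|1 - w l m|).
have key (N : nat) : N%:R * \sum_(l <- S) `|a l| ^+ 2 <= N%:R + K.
  have h1 : \sum_(k < N) `|expsum S a 0 (k%:R / B)| ^+ 2 <= N%:R.
    have -> : N%:R = \sum_(k < N) 1 :> C by rewrite sumr_const card_ord.
    by apply: ler_sum => k _; rewrite expr_le1.
  have h2 : \sum_(k < N) `|expsum S a 0 (k%:R / B)| ^+ 2 =
      \sum_(l <- S) \sum_(m <- S) a l * (a m)^* * \sum_(k < N) w l m ^+ k.
    under eq_bigr do rewrite sqr_norm_expsum.
    rewrite exchange_big /=; apply: eq_bigr => l _.
    rewrite exchange_big /=; apply: eq_bigr => m _.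
    rewrite mulr_sumr; apply: eq_bigr => k _.
    by rewrite /w -cisMn mulrCA [_ * k%:R]mulrC.
  have h3 : \sum_(l <- S) \sum_(m <- S) a l * (a m)^* * \sum_(k < N) w l m ^+ k
     = N%:R * \sum_(l <- S) `|a l| ^+ 2 +
       \sum_(l <- S) \sum_(m <- S | m != l)
          a l * (a m)^* * \sum_(k < N) w l m ^+ k.
    rewrite mulr_sumr -big_split /= big_seq [RHS]big_seq.
    apply: eq_bigr => l lS; rewrite (bigD1_seq l)//=; congr (_ + _).
    rewrite /w subrr mul0r cis0; under eq_bigr do rewrite expr1n.
    by rewrite sumr_const card_ord sqr_normc mulrC.
  rewrite -lerBlDr; apply: le_trans h1.
  rewrite h2 h3 lerBlDr -addrA lerDl.
  set Y := \sum_(l <- S) \sum_(m <- S | m != l) _.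
  have YK : `|Y| <= K.
    rewrite /Y /K (le_trans (ler_norm_sum _ _ _))// big_seq [leRHS]big_seq.
    apply: ler_sum => l lS; rewrite (le_trans (ler_norm_sum _ _ _))//.
    rewrite big_seq_cond [leRHS]big_seq_cond.
    apply: ler_sum => m /andP[mS ml].
    rewrite !normrM normcJ ler_wpM2l// geometric_sum_bound ?norm_cis//.
    exact: wn1.
  (* The order of [C] only compares numbers with real difference, so a lower bound for [Y] requires
     [Y] real. *)
  have Yr : Y \is Num.real.
    have -> : Y = \sum_(k < N) `|expsum S a 0 (k%:R / B)| ^+ 2
                 - N%:R * \sum_(l <- S) `|a l| ^+ 2 by rewrite h2 h3 addrC addKr.
    rewrite rpredB ?rpredM ?realn ?rpred_sum// => *; rewrite rpredX// normr_real//.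
  by rewrite -lerBlDr sub0r lerNl (le_trans _ YK)// -normrN real_ler_norm// rpredN.
have S0 : 0 <= \sum_(l <- S) `|a l| ^+ 2 :> C by apply: sumr_ge0 => *; rewrite exprn_ge0.
rewrite (ge0_complexE S0) -[1]/(1%:C) lecR.
apply: (@le1_of_natmul _ (complex.Re K)) => N.
by have := Re_le (key N); rewrite raddfD /= (ge0_complexE S0) -(rmorph_nat (real_complex R)) -rmorphM.
Qed.

Lemma expR_convex01 (l s : R) : 0 <= s <= 1 -> expR (l * s) <= 1 - s + s * expR l.
Proof.
(* both values lie above the tangent of exp at [l * s] *)
move=> /andP[s0 s1].
have h1 : 1 - l * s <= expR (- (l * s)) := expR_ge1Dx _.
have h2 : 1 + (l - l * s) <= expR (l - l * s) := expR_ge1Dx _.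
have e0 := expR_gt0 (l * s).
have E1 : expR (l * s) * expR (- (l * s)) = 1 by rewrite -expRD subrr expR0.
have E2 : expR (l * s) * expR (l - l * s) = expR l by rewrite -expRD subrKC.
set E := expR (l * s) in e0 E1 E2 *.
have k1 : E * (1 - l * s) <= 1 by rewrite -[leRHS]E1 ler_wpM2l// ltW.
have k2 : E * (1 + (l - l * s)) <= expR l by rewrite -E2 ler_wpM2l// ltW.
have k3 : (1 - s) * (E * (1 - l * s)) <= 1 - s by rewrite ler_piMr// subr_ge0.
have k4 : s * (E * (1 + (l - l * s))) <= s * expR l by rewrite ler_wpM2l.
apply: le_trans (lerD k3 k4); rewrite le_eqVlt; apply/orP; left; apply/eqP; ring.
Qed.

(** Convexity interpolates the two mean-square bounds to [s]; Cauchy-Schwarz then bounds the value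
    itself at the cost of the factor [size S], which taking powers removes later. *)
Lemma expsum_bound (S : seq R) (a : R -> C) (s : R) : uniq S -> 0 <= s <= 1 ->
  (forall t, `|expsum S a 0 t| <= 1) -> (forall t, `|expsum S a 1 t| <= 1) ->
  `|expsum S a s 0| ^+ 2 <= (size S)%:R.
Proof.
move=> uS s01 b0 b1.
have h0 := mean_square_le1 uS b0.
have h1 : \sum_(l <- S) `|a l * (expR l)%:C| ^+ 2 <= 1.
  apply: mean_square_le1 => // t; rewrite (le_trans _ (b1 t))//.
  rewrite le_eqVlt; apply/orP; left; apply/eqP; congr `|_|.
  by apply: eq_bigr => l _; rewrite /cexp mulr0 expR0 mulr1 mul1r mulrA.
have /andP[s0 s1] := s01.
have hs : \sum_(l <- S) `|a l * cexp l s 0| ^+ 2 <= 1.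
  have : (1 - s)%:C * \sum_(l <- S) `|a l| ^+ 2 +
         s%:C * \sum_(l <- S) `|a l * (expR l)%:C| ^+ 2 <= 1.
    have -> : 1 = (1 - s)%:C * 1 + s%:C * 1 :> C.
      by rewrite !mulr1 -rmorphD /= subrK.
    by rewrite lerD// ler_wpM2l// ler0c// subr_ge0.
  apply: le_trans; rewrite !mulr_sumr -big_split /=; apply: ler_sum => l _.
  rewrite cexp_real !normrM !exprMn ![`|_%:C|]ger0_norm ?ler0c ?expR_ge0//.
  rewrite [X in _ <= X + _]mulrC [X in _ <= _ + X]mulrCA -mulrDr.
  rewrite ler_wpM2l ?exprn_ge0// -!rmorphXn -rmorphM -rmorphD lecR.
  have -> : expR (l * s) ^+ 2 = expR ((2 * l) * s).
    by rewrite -mulrA expRM_natl.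
  by rewrite -expRM_natl expR_convex01.
have CS (T : seq R) (f : R -> C) :
    `|\sum_(l <- T) f l| ^+ 2 <= (size T)%:R * \sum_(l <- T) `|f l| ^+ 2.
  apply: (@le_trans _ _ ((\sum_(l <- T) `|f l|) ^+ 2)).
    by rewrite lerXn2r ?nnegrE ?sumr_ge0// ler_norm_sum.
  apply: (@le_trans _ _ (\sum_(l <- T) \sum_(m <- T)
      2^-1 * (`|f l| ^+ 2 + `|f m| ^+ 2))).
    rewrite expr2 mulr_suml; apply: ler_sum => l _.
    rewrite mulr_sumr; apply: ler_sum => m _.
    rewrite ler_pdivlMl// -subr_ge0.
    have -> : `|f l| ^+ 2 + `|f m| ^+ 2 - 2 * (`|f l| * `|f m|) =
       (`|f l| - `|f m|) ^+ 2 by ring.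
    by rewrite real_exprn_even_ge0// rpredB// normr_real.
  have sc (x : C) : \sum_(i <- T) x = (size T)%:R * x.
    by rewrite big_const_seq count_predT iter_addr_0 mulr_natl.
  rewrite le_eqVlt; apply/orP; left; apply/eqP.
  under eq_bigr do rewrite -mulr_sumr big_split /= sc.
  rewrite -mulr_sumr big_split /= sc -mulr_sumr -mulr2n -[X in _ * X]mulr_natl.
  by rewrite mulrA mulVf ?mul1r ?pnatr_eq0.
apply: le_trans (CS _ _) _; rewrite -[leRHS]mulr1 ler_wpM2l//.
Qed.

(** Terms with the same exponent are merged. [S] may contain further exponents, whose coefficient is
    an empty sum. *)
Lemma expsum_collect (I : eqType) (r : seq I) (c : I -> C) (mu : I -> R) (S : seq R) :
  uniq S -> {in r, forall i, mu i \in S} ->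
  exists a : R -> C, forall s t,
    \sum_(i <- r) c i * cexp (mu i) s t = expsum S a s t.
Proof.
move=> uS muS; exists (fun l => \sum_(i <- r | mu i == l) c i) => s t.
rewrite /expsum; under [RHS]eq_bigr do rewrite mulr_suml.
rewrite (exchange_big_dep predT)//= big_seq [RHS]big_seq.
apply: eq_bigr => i ir; rewrite big_mkcond /= (bigD1_seq (mu i)) ?muS//= eqxx.
by rewrite big1 ?addr0// => l; rewrite eq_sym => /negbTE ->.
Qed.

(* The exponents of the [m]-th power of an exponential polynomial with
   exponents [ls]. *)
Fixpoint power_exponents (m : nat) (ls : seq R) : seq R :=
  if ls is l :: ls' then
    [seq j%:R * l + x | j <- iota 0 m.+1, x <- power_exponents m ls']
  else [:: 0].

Lemma power_exponents_cons m l ls : power_exponents m (l :: ls) =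
  [seq j%:R * l + x | j <- iota 0 m.+1, x <- power_exponents m ls].
Proof. by []. Qed.

(** Each multiplicity ranges over 0, ..., m without the constraint that they add up to m; the
    overcount makes the size a plain power, polynomial in m for a fixed number of exponents. *)
Lemma size_power_exponents m ls : size (power_exponents m ls) = (m.+1 ^ size ls)%N.
Proof.
elim: ls => // l ls IH.
by rewrite power_exponents_cons size_allpairs size_iota IH expnS.
Qed.

Lemma power_exponentsS m ls x :
  x \in power_exponents m ls -> x \in power_exponents m.+1 ls.
Proof.
elim: ls x => // l ls IH x; rewrite !power_exponents_cons.
move=> /allpairsP[[j y] [jm ym ->]].
apply/allpairsP; exists (j, y); split => //; last exact: IH.
by move: jm; rewrite !mem_iota /= => /leq_trans; apply.
Qed.

Lemma power_exponentsD m ls l x : l \in ls ->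
  x \in power_exponents m ls -> l + x \in power_exponents m.+1 ls.
Proof.
elim: ls x => // l' ls IH x; rewrite in_cons !power_exponents_cons => /orP[/eqP ->|lls];
  move=> /allpairsP[[j y] [jm ym ->]]; apply/allpairsP.
  exists (j.+1, y); split; first by move: jm; rewrite !mem_iota /= !add0n ltnS.
    exact: power_exponentsS.
  by rewrite /= -natr1 mulrDl mul1r addrA [l' + _]addrC.
exists (j, l + y); split; last by rewrite /= addrCA.
  by move: jm; rewrite !mem_iota /= => /leq_trans; apply.
exact: IH.
Qed.

Lemma exppol_power (r : seq (C * R)) (m : nat) : exists a : R -> C, forall s t,
  exppol r s t ^+ m = expsum (undup (power_exponents m (map snd r))) a s t.
Proof.
elim: m => [|m [a IH]].
  have [||a ha] := @expsum_collect unit [:: tt] (fun=> 1) (fun=> 0)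
     (undup (power_exponents 0 (map snd r))).
  - exact: undup_uniq.
  - move=> x _; rewrite mem_undup; elim: (map _ _) => [|l ls IH]; first by rewrite inE.
    rewrite power_exponents_cons; apply/allpairsP.
    by exists (0%N, 0); rewrite mul0r addr0 inE.
  - by exists a => s t; rewrite -ha big_seq1 cexp0 expr0 mulr1.
have [||a' ha'] := @expsum_collect _
   [seq (p.1 * a l, p.2 + l) | p <- r, l <- undup (power_exponents m (map snd r))]
   fst snd (undup (power_exponents m.+1 (map snd r))).
- exact: undup_uniq.
- move=> _ /allpairsP[[p l] /= [pr lS ->]] /=; move: lS; rewrite !mem_undup.
  by apply: power_exponentsD; apply: map_f.
exists a' => s t; rewrite -ha' big_allpairs_dep exprS IH /exppol mulr_suml.
apply: eq_bigr => p _; rewrite /expsum mulr_sumr; apply: eq_bigr => l _ /=.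
by rewrite cexpD mulrACA.
Qed.

Lemma power_poly_bound (x : R) (J : nat) :
  (forall m : nat, x ^+ m <= m.+1%:R ^+ J) -> x <= 1.
Proof.
move=> h; rewrite leNgt; apply/negP => x1.
have lnx : 0 < ln x by rewrite ln_gt0.
(* From x^m = e^(m ln x) >= (e^(b m))^(J+1) >= (1 + b m)^(J+1), the bound b <= 1 gives at least (b
   (m+1))^(J+1): one degree more than the assumed bound allows. *)
pose b : R := Num.min 1 (ln x / J.+1%:R).
have b0 : 0 < b by rewrite lt_min ltr01 divr_gt0.
have b1 : b <= 1 by rewrite ge_min lexx.
have hb m : (b * m.+1%:R) ^+ J.+1 <= m.+1%:R ^+ J.
  apply: le_trans (h m).
  have -> : x ^+ m = expR (m%:R * ln x).
    by rewrite expRM_natl lnK// posrE (lt_trans ltr01).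
  apply: (@le_trans _ _ (expR (b * m%:R) ^+ J.+1)).
    rewrite lerXn2r ?nnegrE ?mulr_ge0 ?expR_ge0 ?(ltW b0)//.
    apply: le_trans (expR_ge1Dx _).
    by rewrite -natr1 mulrDr mulr1 addrC lerD2r.
  rewrite -expRM_natl ler_expR mulrA [leRHS]mulrC ler_wpM2r// mulrC.
  by rewrite -ler_pdivlMr// ge_min lexx orbT.
have B0 : 0 < b ^+ J.+1 by rewrite exprn_gt0.
have := archi_boundP (ltW (divr_gt0 ltr01 B0)).
set N := Num.bound _; rewrite ltr_pdivrMr// => hN.
have := hb N; rewrite exprMn [m in _ * m]exprS mulrA.
rewrite ger_pMl ?exprn_gt0// leNgt => /negP; apply.
by apply: lt_le_trans hN _; rewrite mulrC ler_wpM2l ?ler_nat ?(ltW B0).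
Qed.

(** The power trick: after division by [M], each power F^m obeys |F^m|^2 <= (m+1)^J with J the
    number of terms of [r], and only |F| <= 1 is compatible with all m. *)
Lemma three_lines (r : seq (C * R)) (M s : R) : 0 <= s <= 1 -> 0 < M ->
  (forall t, `|exppol r 0 t| <= M%:C) -> (forall t, `|exppol r 1 t| <= M%:C) ->
  `|exppol r s 0| <= M%:C.
Proof.
move=> s01 M0 b0 b1.
pose r' := [seq (p.1 / M%:C, p.2) | p <- r].
have MC0 : 0 < M%:C by rewrite ltcR.
have r'E u t : exppol r' u t = exppol r u t / M%:C.
  by rewrite /exppol big_map mulr_suml; apply: eq_bigr => p _; rewrite mulrAC.
have nrm u t : `|exppol r' u t| = `|exppol r u t| / M%:C.
  by rewrite r'E normf_div (gtr0_norm MC0).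
suff : `|exppol r' s 0| <= 1 by rewrite nrm ler_pdivrMr// mul1r.
have c0 t : `|exppol r' 0 t| <= 1 by rewrite nrm ler_pdivrMr// mul1r.
have c1 t : `|exppol r' 1 t| <= 1 by rewrite nrm ler_pdivrMr// mul1r.
set z := exppol r' s 0.
rewrite -(@expr_le1 _ 2)//.
have zz : 0 <= `|z| ^+ 2 by rewrite exprn_ge0.
move: (ge0_complexE zz); set u := complex.Re _ => zu.
rewrite zu -[1]/(1%:C) lecR.
apply: (@power_poly_bound _ (size (map snd r'))) => m.
have [a ha] := exppol_power r' m.
have := @expsum_bound _ a s (undup_uniq (power_exponents m (map snd r'))) s01.
have e1 v t : `|exppol r' v t| <= 1 ->
    `|expsum (undup (power_exponents m (map snd r'))) a v t| <= 1.
  by move=> h; rewrite -ha normrX exprn_ile1.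
move=> /(_ (fun t => e1 _ _ (c0 t)) (fun t => e1 _ _ (c1 t))).
rewrite -ha normrX -exprM mulnC exprM => /le_trans.
move=> /(_ ((m.+1%:R ^+ size (map snd r'))%:C)).
rewrite zu -(rmorphXn (real_complex R)) lecR; apply.
rewrite -natrX rmorph_nat ler_nat -size_power_exponents size_undup//.
Qed.

(** A single list [r] for both functions ties [f'] to [f] as its formal derivative in [s]; such
    pairs are stable under sums and products by the Leibniz rule, and no limit is taken. *)
Definition exppol_with_derivative (f f' : R -> R -> C) :=
  exists r, (forall s t, f s t = exppol r s t) /\
            (forall s t, f' s t = dexppol r s t).
Local Notation epd := exppol_with_derivative.

Lemma epd_eq f f' g g' : (forall s t, f s t = g s t) ->
  (forall s t, f' s t = g' s t) -> epd f f' -> epd g g'.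
Proof. by move=> h h' [r [e e']]; exists r; split=> s t; rewrite -?h -?h'. Qed.

Lemma epd_cst (c : C) : epd (fun _ _ => c) (fun _ _ => 0).
Proof.
exists [:: (c, 0)]; split => s t; rewrite /exppol /dexppol big_seq1 /= cexp0 ?mulr1//.
by rewrite mulr0.
Qed.

Lemma epd_cexp (l : R) : epd (cexp l) (fun s t => l%:C * cexp l s t).
Proof. by exists [:: (1, l)]; split => s t; rewrite /exppol /dexppol big_seq1 /= mul1r. Qed.

Lemma epdD f f' g g' : epd f f' -> epd g g' ->
  epd (fun s t => f s t + g s t) (fun s t => f' s t + g' s t).
Proof.
move=> [r [e e']] [p [d d']]; exists (r ++ p).
by split=> s t; rewrite /exppol /dexppol big_cat /= ?e ?e' ?d ?d'.
Qed.

Lemma epdM f f' g g' : epd f f' -> epd g g' ->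
  epd (fun s t => f s t * g s t) (fun s t => f' s t * g s t + f s t * g' s t).
Proof.
move=> [r [e e']] [p [d d']].
exists [seq (x.1 * y.1, x.2 + y.2) | x <- r, y <- p].
split=> s t; rewrite /exppol /dexppol big_allpairs_dep /= ?e ?e' ?d ?d'.
  rewrite mulr_suml; apply: eq_bigr => x _; rewrite mulr_sumr.
  by apply: eq_bigr => y _; rewrite cexpD mulrACA.
rewrite !mulr_suml -big_split /=; apply: eq_bigr => x _; rewrite !mulr_sumr.
rewrite -big_split /=; apply: eq_bigr => y _; rewrite cexpD rmorphD /=; ring.
Qed.

Lemma epd_sum (I : Type) (r : seq I) (f f' : I -> R -> R -> C) :
  (forall i, epd (f i) (f' i)) ->
  epd (fun s t => \sum_(i <- r) f i s t) (fun s t => \sum_(i <- r) f' i s t).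
Proof.
move=> h; elim: r => [|i r IH].
  by apply: epd_eq (epd_cst 0) => s t; rewrite big_nil.
by apply: epd_eq (epdD (h i) IH) => s t; rewrite big_cons.
Qed.

Lemma epdZ (c : C) f f' : epd f f' ->
  epd (fun s t => c * f s t) (fun s t => c * f' s t).
Proof.
by move=> h; apply: epd_eq (epdM (epd_cst c) h) => s t //; rewrite mul0r add0r.
Qed.

Lemma epd_three_lines f f' (M s : R) : epd f f' -> 0 <= s <= 1 -> 0 < M ->
  (forall t, `|f 0 t| <= M%:C) -> (forall t, `|f 1 t| <= M%:C) ->
  complex.Re (f s 0) <= M.
Proof.
move=> [r [e _]] s01 M0 h0 h1.
have : `|exppol r s 0| <= M%:C.
  by apply: three_lines => // t; rewrite -e.
rewrite -e -lecR; apply: le_trans.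
by apply: le_trans (normc_ge_Re _); rewrite lecR ler_norm.
Qed.

(** From e^x (1 - x) <= 1: multiplied by 1 - x >= 1/2, the left side becomes at most x^2. *)
Lemma expR_quadratic (x : R) : `|x| <= 2^-1 -> `|expR x - 1 - x| <= 2 * x ^+ 2.
Proof.
move=> xh; have h1 := expR_ge1Dx x; have h2 : 1 - x <= expR (- x) := expR_ge1Dx _.
have h0 : expR x - 1 - x >= 0 by lra.
rewrite ger0_norm//.
have /andP[x1 x2] : - 2^-1 <= x <= 2^-1 by rewrite -ler_norml.
have e1 : expR x * (1 - x) <= 1.
  by rewrite -[leRHS](expRxMexpNx_1 x) ler_wpM2l// expR_ge0.
have x3 : 0 < 1 - x by lra.
rewrite -(ler_pM2r x3).
have -> : (expR x - 1 - x) * (1 - x) = expR x * (1 - x) - (1 - x ^+ 2) by ring.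
have x20 : 0 <= x ^+ 2 by rewrite sqr_ge0.
have : x ^+ 2 * 1 <= x ^+ 2 * (2 * (1 - x)) by rewrite ler_wpM2l//; lra.
lra.
Qed.

(** Division by [h] and h -> 0. All derivatives below, of exponential polynomials and of the
    semigroup, are extracted through this lemma. *)
Lemma linear_le_quadratic (a K d : R) : 0 < d ->
  (forall h, 0 < h -> h <= d -> h * a <= h ^+ 2 * K) -> a <= 0.
Proof.
move=> d0 h; rewrite leNgt; apply/negP => a0.
pose e := Num.min d (a / (2 * (`|K| + 1))).
have K0 : 0 < `|K| + 1 by rewrite ltr_wpDl.
have e0 : 0 < e by rewrite lt_min d0 divr_gt0// mulr_gt0.
have := h e e0; rewrite ge_min lexx => /(_ isT).
rewrite expr2 -mulrA ler_pM2l// leNgt => /negP; apply.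
apply: (@le_lt_trans _ _ (e * (`|K| + 1))).
  by rewrite ler_wpM2l ?(ltW e0)//; have := ler_norm K; lra.
rewrite -ltr_pdivlMr// gt_min; apply/orP; right.
by rewrite invfM mulrA [X in X / _ < _]mulrC ltr_pM2r ?invr_gt0//; lra.
Qed.

Lemma Re_exppol_real (r : seq (C * R)) (s : R) :
  complex.Re (exppol r s 0) = \sum_(p <- r) complex.Re p.1 * expR (p.2 * s).
Proof.
rewrite /exppol raddf_sum /=; apply: eq_bigr => -[[a b] l] _.
by rewrite cexp_real /=; simpc.
Qed.

Lemma Re_dexppol_real (r : seq (C * R)) (s : R) :
  complex.Re (dexppol r s 0) =
  \sum_(p <- r) complex.Re p.1 * p.2 * expR (p.2 * s).
Proof.
rewrite /dexppol raddf_sum /=; apply: eq_bigr => -[[a b] l] _.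
by rewrite cexp_real /=; simpc.
Qed.

Lemma exp_sum_derivative_le0 (r : seq (R * R)) :
  (forall h, 0 < h -> h <= 1 ->
     \sum_(p <- r) p.1 * expR (p.2 * h) <= \sum_(p <- r) p.1) ->
  \sum_(p <- r) p.1 * p.2 <= 0.
Proof.
move=> hr; pose B := \sum_(p <- r) `|p.2|.
have B0 : 0 <= B by rewrite sumr_ge0.
(* [d] forces |p.2 h| <= 1/2 for every exponent, the range of the quadratic estimate. *)
pose d := (2 * (B + 1))^-1.
have d0 : 0 < d by rewrite invr_gt0; lra.
have d1 : d <= 1 by rewrite invf_le1; lra.
apply: (@linear_le_quadratic _ (\sum_(p <- r) 2 * `|p.1| * p.2 ^+ 2) d) => // h h0 hd.
have H : \sum_(p <- r) (p.1 * expR (p.2 * h) - p.1) <= 0.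
  by rewrite sumrB subr_le0 hr// (le_trans hd).
suff : h * (\sum_(p <- r) p.1 * p.2) - \sum_(p <- r) (p.1 * expR (p.2 * h) - p.1)
   <= h ^+ 2 * \sum_(p <- r) 2 * `|p.1| * p.2 ^+ 2 by lra.
rewrite !mulr_sumr -sumrB big_seq [leRHS]big_seq; apply: ler_sum => p pr.
have pB : `|p.2| <= B by rewrite /B (big_rem p)//= lerDl sumr_ge0.
have small : `|p.2 * h| <= 2^-1.
  rewrite normrM (gtr0_norm h0) (@le_trans _ _ (B * d))// ?ler_pM// ?(ltW h0)//.
  by rewrite /d ler_pdivrMr; lra.
have := expR_quadratic small; set E := expR _ => hE.
have -> : h * (p.1 * p.2) - (p.1 * E - p.1) = - (p.1 * (E - 1 - p.2 * h)) by ring.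
apply: le_trans (ler_norm _) _; rewrite normrN normrM.
apply: le_trans (ler_wpM2l (normr_ge0 _) hE) _.
by rewrite le_eqVlt; apply/orP; left; apply/eqP; ring.
Qed.

(** [f] starts at its maximal value: by the three lines theorem its real part on [0, 1] never
    exceeds [M], so the one-sided derivative at 0 cannot be positive. *)
Lemma epd_derivative_at0 f f' (M : R) : epd f f' -> 0 < M ->
  (forall t, `|f 0 t| <= M%:C) -> (forall t, `|f 1 t| <= M%:C) ->
  complex.Re (f 0 0) = M -> complex.Re (f' 0 0) <= 0.
Proof.
move=> fP M0 h0 h1 f00; have [r [e e']] := fP.
rewrite e' Re_dexppol_real.
pose r' := [seq (complex.Re p.1, p.2) | p <- r].
have -> : \sum_(p <- r) complex.Re p.1 * p.2 * expR (p.2 * 0) =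
    \sum_(p <- r') p.1 * p.2.
  by rewrite big_map; apply: eq_bigr => p _; rewrite mulr0 expR0 mulr1.
apply: exp_sum_derivative_le0 => h hp hd; rewrite !big_map /= -Re_exppol_real -e.
have -> : \sum_(j <- r) complex.Re j.1 = M.
  rewrite -f00 e Re_exppol_real.
  by under [RHS]eq_bigr => p _ do rewrite mulr0 expR0 mulr1.
by apply: (epd_three_lines fP) => //; rewrite (ltW hp).
Qed.

Lemma epd_derivative_at1 f f' (M : R) : epd f f' -> 0 < M ->
  (forall t, `|f 0 t| <= M%:C) -> (forall t, `|f 1 t| <= M%:C) ->
  complex.Re (f 1 0) = M -> 0 <= complex.Re (f' 1 0).
Proof.
move=> fP M0 h0 h1 f10; have [r [e e']] := fP.
rewrite e' Re_dexppol_real -oppr_le0 -sumrN.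
(* Reflection s -> 1 - s: the coefficient absorbs e^l and the exponent changes sign, which reduces
   the claim to a derivative at 0. *)
pose r' := [seq (complex.Re p.1 * expR p.2, - p.2) | p <- r].
have -> : \sum_(p <- r) - (complex.Re p.1 * p.2 * expR (p.2 * 1)) =
    \sum_(p <- r') p.1 * p.2.
  by rewrite big_map; apply: eq_bigr => p _; rewrite mulr1 mulrN mulrAC.
apply: exp_sum_derivative_le0 => h hp hd; rewrite !big_map /=.
have -> : \sum_(j <- r) complex.Re j.1 * expR j.2 = M.
  rewrite -f10 e Re_exppol_real.
  by under [RHS]eq_bigr => p _ do rewrite mulr1.
have -> : \sum_(p <- r) complex.Re p.1 * expR p.2 * expR (- p.2 * h)
     = complex.Re (f (1 - h) 0).
  rewrite e Re_exppol_real; apply: eq_bigr => p _.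
  by rewrite -mulrA -expRD mulrBr mulr1 mulNr.
by apply: (epd_three_lines fP) => //; lra.
Qed.

End ThreeLines.

(** * Functional calculus *)

(* Locked: it unfolds to a product, which [rewrite mulmxA] would reassociate. *)
HB.lock Definition mfunC (R : realType) (m : nat) (g : R -> R[i])
    (A : 'M[R[i]]_m) : 'M[R[i]]_m :=
  invmx (spectralmx A) *m
  diag_mx (map_mx (fun z : R[i] => g (complex.Re z)) (spectral_diag A)) *m
  spectralmx A.

Section FunctionalCalculus.
Variable R : realType.
Local Notation C := R[i].

Lemma conjCE (x : C) : x^*%R = conjc x. Proof. by []. Qed.

Lemma trmxC_mul m n p (A : 'M[C]_(m, n)) (B : 'M[C]_(n, p)) :
  (A *m B)^t* = B^t* *m A^t*.
Proof. by rewrite trmx_mul map_mxM. Qed.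

Lemma trmxC1 m : (1%:M : 'M[C]_m)^t* = 1%:M.
Proof. by rewrite trmx1 map_mx1. Qed.

Lemma trmxCZ m n (a : C) (A : 'M[C]_(m, n)) : (a *: A)^t* = a^*%R *: A^t*.
Proof. by rewrite linearZ /= map_mxZ. Qed.

Lemma trmxCE m n (A : 'M[C]_(m, n)) i j : A^t* i j = (A j i)^*%R.
Proof. by rewrite !mxE. Qed.

Lemma unitaryVmx m (U : 'M[C]_m) : U \is unitarymx -> U^t* *m U = 1%:M.
Proof. by move=> /unitarymxP h; apply: mulmx1C. Qed.

Lemma unitaryP m (U : 'M[C]_m) : U^t* *m U = 1%:M -> U \is unitarymx.
Proof. by move=> h; apply/unitarymxP; apply: mulmx1C. Qed.

Lemma hermP m {A : 'M[C]_m} : reflect (A^t* = A) (A \is hermsymmx).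
Proof.
by apply: (iffP eqP); rewrite expr0 scale1r.
Qed.

Lemma mfunE m (f : R -> R) (A : 'M[C]_m) : mfun f A = mfunC (fun x => (f x)%:C) A.
Proof. by rewrite mfunC.unlock. Qed.

(** The numbers [d j] are real parts of the spectral data, so the formula for [mfunC] holds for
    every matrix and the product and sum laws of the calculus follow in general; recovering [A]
    itself asks for a Hermitian matrix. *)
Lemma mfunC_spectral m (A : 'M[C]_m) : exists (U : 'M[C]_m) (d : 'I_m -> R),
  [/\ U \is unitarymx,
      forall g, mfunC g A = U^t* *m diag_mx (\row_j g (d j)) *m U &
      A \is hermsymmx -> A = U^t* *m diag_mx (\row_j (d j)%:C) *m U].
Proof.
have uU := spectral_unitarymx A.
exists (spectralmx A), (fun j => complex.Re (spectral_diag A 0 j)); split; first exact: uU.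
  move=> g; rewrite mfunC.unlock (invmx_unitary uU); move: (spectralmx A) (spectral_diag A) => U d.
  by have -> : map_mx (fun z : C => g (complex.Re z)) d =
    \row_j g (complex.Re (d 0 j)) by apply/rowP => j; rewrite !mxE.
move=> hA; have /mxOverP hr := hermitian_spectral_diag_real hA.
have /orthomx_spectralP := hermitian_normalmx hA.
rewrite (invmx_unitary uU); move: (spectralmx A) (spectral_diag A) hr => U d hr ->.
by have -> : \row_j (complex.Re (d 0 j))%:C = d by apply/rowP => j; rewrite !mxE RRe_real.
Qed.

Lemma diag_mxM m (a b : 'I_m -> C) :
  diag_mx (\row_j a j) *m diag_mx (\row_j b j) = diag_mx (\row_j (a j * b j)).
Proof. by apply/matrixP => i j; rewrite mul_diag_mx !mxE mulrnAr. Qed.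

Lemma diag_mxD m (a b : 'I_m -> C) :
  diag_mx (\row_j a j) + diag_mx (\row_j b j) = diag_mx (\row_j (a j + b j)).
Proof. by apply/matrixP => i j; rewrite !mxE mulrnDl. Qed.

Lemma diag_mxZ m (c : C) (a : 'I_m -> C) :
  c *: diag_mx (\row_j a j) = diag_mx (\row_j (c * a j)).
Proof. by apply/matrixP => i j; rewrite !mxE mulrnAr. Qed.

Lemma diag_mx_cst m (c : C) : diag_mx (\row_(j < m) c) = c%:M.
Proof. by apply/matrixP => i j; rewrite !mxE. Qed.

Lemma trmxC_diag m (a : 'I_m -> C) :
  (diag_mx (\row_j a j))^t* = diag_mx (\row_j (a j)^*%R).
Proof.
apply/matrixP => i j; rewrite !mxE eq_sym rmorphMn.
by case: eqP => [->|]; rewrite ?mulr0n.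
Qed.

Lemma unitary_conjM m (U A B : 'M[C]_m) : U \is unitarymx ->
  (U^t* *m A *m U) *m (U^t* *m B *m U) = U^t* *m (A *m B) *m U.
Proof. by move=> uU; rewrite !mulmxA mulmxtVK. Qed.

Lemma mfunCM m g h (A : 'M[C]_m) :
  mfunC g A *m mfunC h A = mfunC (fun x => g x * h x) A.
Proof.
by have [U [d [uU E _]]] := mfunC_spectral A; rewrite !E (unitary_conjM _ _ uU) diag_mxM.
Qed.

Lemma mfunCD m g h (A : 'M[C]_m) :
  mfunC g A + mfunC h A = mfunC (fun x => g x + h x) A.
Proof.
by have [U [d [_ E _]]] := mfunC_spectral A; rewrite !E -mulmxDl -mulmxDr diag_mxD.
Qed.

Lemma mfunCZ m (a : C) g (A : 'M[C]_m) : a *: mfunC g A = mfunC (fun x => a * g x) A.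
Proof.
by have [U [d [_ E _]]] := mfunC_spectral A; rewrite !E scalemxAl scalemxAr diag_mxZ.
Qed.

Lemma mfunC_cst m (a : C) (A : 'M[C]_m) : mfunC (fun=> a) A = a%:M.
Proof.
have [U [d [uU E _]]] := mfunC_spectral A; rewrite E diag_mx_cst.
by rewrite mul_mx_scalar -scalemxAl (unitaryVmx uU) scalemx1.
Qed.

Lemma trmxC_mfunC m g (A : 'M[C]_m) : (mfunC g A)^t* = mfunC (fun x => (g x)^*%R) A.
Proof.
have [U [d [uU E _]]] := mfunC_spectral A.
by rewrite !E !trmxC_mul trmxCK mulmxA trmxC_diag.
Qed.

Lemma conjc_rc (x : R) : (x%:C)^*%R = x%:C.
Proof. by rewrite conjCE conjc_real. Qed.

Lemma mfunC_id m (A : 'M[C]_m) : A \is hermsymmx -> mfunC (fun x => x%:C) A = A.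
Proof. by have [U [d [uU E EA]]] := mfunC_spectral A => /EA {2}->; rewrite E. Qed.

(* An intertwiner only links equal eigenvalues, hence it intertwines every
   function of the two matrices. *)
Lemma mfunC_intertwine m n g (A : 'M[C]_m) (B : 'M[C]_n) (W : 'M[C]_(m, n)) :
  A \is hermsymmx -> B \is hermsymmx ->
  A *m W = W *m B -> mfunC g A *m W = W *m mfunC g B.
Proof.
have [U [a [uU -> EA]]] := mfunC_spectral A.
have [V [b [uV -> EB]]] := mfunC_spectral B.
move=> /EA -> /EB -> h; pose W' := U *m W *m V^t*.
have {}h : diag_mx (\row_j (a j)%:C) *m W' = W' *m diag_mx (\row_j (b j)%:C).
  have -> : diag_mx (\row_j (a j)%:C) *m W' =
      U *m (U^t* *m diag_mx (\row_j (a j)%:C) *m U *m W) *m V^t*.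
    by rewrite /W' !mulmxA (unitarymxP uU) mul1mx.
  by rewrite h /W' -!mulmxA (unitarymxP uV) mulmx1.
have k : diag_mx (\row_j g (a j)) *m W' = W' *m diag_mx (\row_j g (b j)).
  move: W' h => {}W h; apply/matrixP => i j; move: h => /matrixP/(_ i j).
  rewrite !mul_diag_mx !mul_mx_diag !mxE; move: (W i j) => w.
  have [->|w0] := eqVneq w 0; first by rewrite !mulr0 !mul0r.
  by rewrite [RHS]mulrC => /(mulIf w0) [->]; apply: mulrC.
have -> : U^t* *m diag_mx (\row_j g (a j)) *m U *m W =
    U^t* *m (diag_mx (\row_j g (a j)) *m W') *m V.
  by rewrite /W' !mulmxA -[_ *m V]mulmxA (unitaryVmx uV) mulmx1.
by rewrite k /W' !mulmxA (unitaryVmx uU) mul1mx.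
Qed.

Lemma mfunC_scalar m g (c : R) : mfunC g (c%:C%:M : 'M[C]_m) = (g c)%:M.
Proof.
have hS : (c%:C%:M : 'M[C]_m) \is hermsymmx.
  by apply/hermP; rewrite tr_scalar_mx map_scalar_mx /= conjc_rc.
have [U [d [uU -> /(_ hS) e]]] := mfunC_spectral (c%:C%:M : 'M[C]_m).
have dE j : d j = c.
  have : U *m c%:C%:M *m U^t* = diag_mx (\row_j (d j)%:C).
    by rewrite e !mulmxA (unitarymxP uU) mul1mx -mulmxA (unitarymxP uU) mulmx1.
  rewrite mul_mx_scalar -scalemxAl (unitarymxP uU) scalemx1.
  by move=> /matrixP/(_ j j); rewrite !mxE eqxx !mulr1n => -[->].
have -> : \row_j g (d j) = \row_j g c by apply/rowP => j; rewrite !mxE dE.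
by rewrite diag_mx_cst mul_mx_scalar -scalemxAl (unitaryVmx uU) scalemx1.
Qed.

Lemma herm_diag m (e : 'I_m -> R) : (diag_mx (\row_j (e j)%:C) : 'M[C]_m) \is hermsymmx.
Proof.
apply/hermP; rewrite trmxC_diag; congr diag_mx.
by apply/rowP => j; rewrite !mxE conjc_rc.
Qed.

Lemma mfunC_diag m g (e : 'I_m -> R) :
  mfunC g (diag_mx (\row_j (e j)%:C)) = diag_mx (\row_j g (e j)).
Proof.
apply/matrixP => i j.
have hS : ((e j)%:C%:M : 'M[C]_1) \is hermsymmx.
  by apply/hermP; rewrite tr_scalar_mx map_scalar_mx /= conjc_rc.
(* The j-th basis vector, as an intertwiner between the diagonal matrix and a 1 x 1 scalar matrix,
   isolates column [j]. *)
have hW : diag_mx (\row_j (e j)%:C) *m delta_mx j 0 =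
    delta_mx j 0 *m ((e j)%:C%:M : 'M[C]_1).
  apply/matrixP => a b; rewrite mul_diag_mx mul_mx_scalar !mxE.
  by case: eqP => [->|_]; rewrite ?mulr0.
have := mfunC_intertwine g (herm_diag e) hS hW.
rewrite mfunC_scalar -colE mul_mx_scalar => /matrixP /(_ i 0); rewrite !mxE => ->.
by case: eqP => [->|_]; rewrite ?mulr0 ?mulr1.
Qed.

(** Independence of the chosen diagonalisation: [V] intertwines [A] with its diagonal form, where
    [mfunC] is known. *)
Lemma mfunC_unique m g (A V : 'M[C]_m) (e : 'I_m -> R) : V \is unitarymx ->
  A = V^t* *m diag_mx (\row_j (e j)%:C) *m V ->
  mfunC g A = V^t* *m diag_mx (\row_j g (e j)) *m V.
Proof.
move=> uV AE; set D := diag_mx _ in AE.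
have hA : A \is hermsymmx.
  by apply/hermP; rewrite AE !trmxC_mul trmxCK (hermP (herm_diag e)) mulmxA.
have := @mfunC_intertwine _ _ g D A V (herm_diag e) hA.
rewrite {1}AE !mulmxA (unitarymxP uV) mul1mx => /(_ erefl).
by rewrite mfunC_diag => h; rewrite -mulmxA h mulmxA (unitaryVmx uV) mul1mx.
Qed.

Lemma mfunC_comp m g f (A : 'M[C]_m) : mfunC g (mfun f A) = mfunC (g \o f) A.
Proof.
have [U [d [uU E _]]] := mfunC_spectral A.
by rewrite mfunE (@mfunC_unique _ g _ U (f \o d))// E.
Qed.

Lemma quad_posdef m (X : 'M[C]_m) (v : 'cV[C]_m) : posdef X ->
  v != 0 -> 0 < (v^t* *m X *m v) 0 0.
Proof. by case=> _; apply. Qed.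

Lemma posdef_psd m (X : 'M[C]_m) : posdef X -> psd X.
Proof.
move=> [hX pX]; split=> // v; have [->|/pX/ltW//] := eqVneq v 0.
by rewrite mulmx0 mxE.
Qed.

Lemma dotE m (v : 'cV[C]_m) : (v^t* *m v) 0 0 = \sum_i `|v i 0| ^+ 2.
Proof.
rewrite mxE; apply: eq_bigr => i _.
by rewrite !mxE sqr_normc -conjCE mulrC.
Qed.

Lemma quad_diag m (e : 'I_m -> C) (v : 'cV[C]_m) :
  (v^t* *m diag_mx (\row_j e j) *m v) 0 0 = \sum_i e i * `|v i 0| ^+ 2.
Proof.
rewrite mul_mx_diag mxE; apply: eq_bigr => i _.
by rewrite !mxE sqr_normc -conjCE mulrC mulrA mulrC.
Qed.

Lemma posdef_diag_conj m (U : 'M[C]_m) (e : 'I_m -> R) : U \in unitmx ->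
  (forall j, 0 < e j) -> posdef (U^t* *m diag_mx (\row_j (e j)%:C) *m U).
Proof.
move=> uU e0; split.
  by apply/hermP; rewrite !trmxC_mul trmxCK mulmxA (hermP (herm_diag e)).
move=> v v0; set w := U *m v.
have w0 : w != 0 by apply: contraNneq v0 => h; rewrite -[v](mulKmx uU) -/w h mulmx0.
have -> : v^t* *m (U^t* *m diag_mx (\row_j (e j)%:C) *m U) *m v =
   w^t* *m diag_mx (\row_j (e j)%:C) *m w by rewrite /w trmxC_mul !mulmxA.
rewrite quad_diag; have [i wi] : exists i, w i 0 != 0.
  apply/existsP; rewrite -negb_forall; apply: contra w0 => /forallP h.
  by apply/eqP/colP => i; rewrite [RHS]mxE; apply/eqP/h.
rewrite (bigD1 i)//= ltr_pwDl//.
  by rewrite mulr_gt0 ?ltcR// exprn_gt0// normr_gt0.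
by rewrite sumr_ge0// => j _; rewrite mulr_ge0 ?exprn_ge0// ltW// ltcR.
Qed.

Lemma posdef_spectral m (A : 'M[C]_m) : posdef A ->
  exists (U : 'M[C]_m) (d : 'I_m -> R),
  [/\ U \is unitarymx, forall j, 0 < d j,
      forall g, mfunC g A = U^t* *m diag_mx (\row_j g (d j)) *m U &
      A = U^t* *m diag_mx (\row_j (d j)%:C) *m U].
Proof.
move=> pA; have [hA _] := pA.
have [U [d [uU E /(_ hA) EA]]] := mfunC_spectral A.
exists U, d; split => // j.
pose w : 'cV[C]_m := delta_mx j 0.
have := quad_posdef (v := U^t* *m w) pA.
have -> : (U^t* *m w)^t* *m A *m (U^t* *m w)
   = w^t* *m diag_mx (\row_j (d j)%:C) *m w.
  have <- : U *m A *m U^t* = diag_mx (\row_j (d j)%:C).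
    by rewrite EA !mulmxA (unitarymxP uU) mul1mx -mulmxA (unitarymxP uU) mulmx1.
  by rewrite trmxC_mul trmxCK !mulmxA.
rewrite quad_diag (bigD1 j)//= big1 => [|i /negbTE ij]; last first.
  by rewrite mxE ij normr0 expr0n mulr0.
rewrite mxE !eqxx normr1 expr1n mulr1 addr0 ltcR; apply.
apply/eqP => /(congr1 (mulmx U)); rewrite mulmxA (unitarymxP uU) mul1mx mulmx0.
by move=> /matrixP/(_ j 0); rewrite !mxE !eqxx => /eqP; rewrite oner_eq0.
Qed.

Lemma eq_mfunC m g h (A : 'M[C]_m) : posdef A ->
  (forall x, 0 < x -> g x = h x) -> mfunC g A = mfunC h A.
Proof.
move=> pA gh; have [U [d [uU d0 E _]]] := posdef_spectral pA.
rewrite !E; suff -> : \row_j g (d j) = \row_j h (d j) by [].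
by apply/rowP => j; rewrite !mxE gh.
Qed.

Lemma posdef_mfun m f (A : 'M[C]_m) : posdef A ->
  (forall x, 0 < x -> 0 < f x) -> posdef (mfun f A).
Proof.
move=> pA f0; have [U [d [uU d0 E _]]] := posdef_spectral pA.
rewrite mfunE E; apply: (@posdef_diag_conj _ U (f \o d)); first exact: unitarymx_unit.
by move=> j; apply: f0.
Qed.

Lemma posdef_conj m (A B : 'M[C]_m) : posdef A -> B \in unitmx ->
  posdef (B^t* *m A *m B).
Proof.
move=> pA uB; have [U [d [uU d0 _ ->]]] := posdef_spectral pA.
have -> : B^t* *m (U^t* *m diag_mx (\row_j (d j)%:C) *m U) *m B =
  (U *m B)^t* *m diag_mx (\row_j (d j)%:C) *m (U *m B) by rewrite trmxC_mul !mulmxA.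
by apply: posdef_diag_conj; rewrite // unitmx_mul unitarymx_unit.
Qed.

Lemma psd_conj m n (A : 'M[C]_m) (B : 'M[C]_(m, n)) : psd A -> psd (B^t* *m A *m B).
Proof.
move=> [/hermP hA pA]; split.
  by apply/hermP; rewrite !trmxC_mul trmxCK hA mulmxA.
move=> v; have -> : v^t* *m (B^t* *m A *m B) *m v = (B *m v)^t* *m A *m (B *m v).
  by rewrite trmxC_mul !mulmxA.
exact: pA.
Qed.

Lemma psd1 m : psd (1%:M : 'M[C]_m).
Proof.
split; first by apply/hermP; rewrite trmxC1.
by move=> v; rewrite mulmx1 dotE sumr_ge0// => i _; rewrite exprn_ge0.
Qed.

Lemma tr_posdef_gt0 m (A : 'M[C]_m) : (0 < m)%N -> posdef A -> 0 < \tr A.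
Proof.
move=> m0 pA; have [U [d [uU d0 _ ->]]] := posdef_spectral pA.
rewrite mxtrace_mulC mulmxA (unitarymxP uU) mul1mx mxtrace_diag.
rewrite (bigD1 (Ordinal m0))//= ltr_pwDl// ?mxE ?ltcR//.
by rewrite sumr_ge0// => j _; rewrite mxE ler0c ltW.
Qed.

End FunctionalCalculus.

(** * Positive maps *)

HB.lock Definition sform (R : realType) m (E : 'M[R[i]]_m) (x y : 'cV[R[i]]_m) : R[i] :=
  (x^t* *m E *m y) 0 0.

Section PositiveMaps.
Variable R : realType.
Local Notation C := R[i].

Definition positive_map m n (P : 'M[C]_m -> 'M[C]_n) := forall X, psd X -> psd (P X).

Lemma linear_sumZ m n p q (P : 'M[C]_(m, n) -> 'M[C]_(p, q)) (I : Type) (r : seq I)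
    (c : I -> C) (X : I -> 'M[C]_(m, n)) : linear P ->
  P (\sum_(i <- r) c i *: X i) = \sum_(i <- r) c i *: P (X i).
Proof.
move=> lP; elim: r => [|i r IH]; last by rewrite !big_cons lP IH.
by rewrite !big_nil; have := lP (-1) 0 0; rewrite scaler0 addr0 scaleN1r addNr.
Qed.

Lemma linear_delta m n p q (P : 'M[C]_(m, n) -> 'M[C]_(p, q)) X : linear P ->
  P X = \sum_i \sum_j X i j *: P (delta_mx i j).
Proof.
move=> lP; rewrite {1}[X]matrix_sum_delta !pair_bigA /=.
exact: (@linear_sumZ _ _ _ _ _ _ _ (fun p => X p.1 p.2) (fun p => delta_mx p.1 p.2)).
Qed.

Lemma sformDr m (E : 'M[C]_m) (x y z : 'cV[C]_m) (c : C) :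
  sform E x (y + c *: z) = sform E x y + c * sform E x z.
Proof. by rewrite sform.unlock mulmxDr -scalemxAr mxE; congr (_ + _); rewrite mxE. Qed.

Lemma sform_conj m (E : 'M[C]_m) (x y : 'cV[C]_m) : E^t* = E ->
  (sform E x y)^*%R = sform E y x.
Proof. by move=> hE; rewrite sform.unlock -trmxCE !trmxC_mul trmxCK hE mulmxA. Qed.

Lemma sform_sum m (I : finType) (c : I -> C) (E : I -> 'M[C]_m) (x y : 'cV[C]_m) :
  sform (\sum_j c j *: E j) x y = \sum_j c j * sform (E j) x y.
Proof.
rewrite sform.unlock mulmx_sumr mulmx_suml summxE; apply: eq_bigr => j _.
by rewrite -scalemxAr -scalemxAl mxE.
Qed.

Lemma psd_sform_ge0 m (E : 'M[C]_m) (x : 'cV[C]_m) : psd E -> 0 <= sform E x x.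
Proof. by rewrite sform.unlock; case. Qed.

(** Weaker than Cauchy-Schwarz but additive in [E], so it can be summed over a resolution of the
    identity. It is the positivity of the form at x - w y, with the phase [w] that turns [z] into
    its modulus. *)
Lemma psd_amgm m (E : 'M[C]_m) (x y : 'cV[C]_m) : psd E ->
  `|sform E x y| <= 2^-1 * (sform E x x + sform E y y).
Proof.
move=> pE; have [/hermP hE _] := pE; set z := sform E x y.
have zc : sform E y x = z^*%R by rewrite sform_conj.
have [->|z0] := eqVneq z 0.
  by rewrite normr0 mulr_ge0 ?invr_ge0 ?addr_ge0 ?psd_sform_ge0.
pose w := z^*%R / `|z|.
have nz : `|z| != 0 by rewrite normr_eq0.
have ww : w^*%R * w = 1.
  by rewrite -normCKC /w normf_div norm_conjC normr_id divff// expr1n.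
have wz : w * z = `|z|.
  by rewrite /w mulrAC -normCKC expr2 mulfK.
have wzc : w^*%R * z^*%R = `|z|.
  by rewrite -rmorphM wz /= conj_normC.
have wN : (- w)^*%R = - w^*%R by rewrite rmorphN.
have := psd_sform_ge0 (x + (- w) *: y) pE.
rewrite sformDr -!(sform_conj _ (x + _) hE) !sformDr !rmorphD /= !rmorphM /=.
rewrite wN !(sform_conj _ _ hE) zc -/z.
move: (sform E x x) (sform E y y) => a b h.
rewrite ler_pdivlMl// -subr_ge0.
suff <- : a + - w^*%R * z^*%R + - w * (z + - w^*%R * b) = a + b - 2 * `|z| by [].
transitivity (a - w^*%R * z^*%R - w * z + w^*%R * w * b); first by ring.
by rewrite ww wz wzc; ring.
Qed.

Lemma trmxC_col m (U : 'M[C]_m) i : (row i U)^t* = U^t* *m delta_mx i 0.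
Proof. by rewrite -colE; apply/matrixP => a b; rewrite !mxE. Qed.

Lemma unitary_conj_diag m (U : 'M[C]_m) (e : 'I_m -> C) :
  U^t* *m diag_mx (\row_j e j) *m U = \sum_j e j *: ((row j U)^t* *m row j U).
Proof.
apply/matrixP => a b; rewrite mul_mx_diag !mxE summxE.
by apply: eq_bigr => j _; rewrite !mxE big_ord1 !mxE mulrAC mulrC mulrA.
Qed.

Lemma psd_rank1 m (v : 'rV[C]_m) : psd (v^t* *m v).
Proof. by have := psd_conj v (psd1 R 1); rewrite mulmx1. Qed.

Lemma unitary_spectral m (v : 'M[C]_m) : v \is unitarymx ->
  exists (V : 'M[C]_m) (c : 'I_m -> C),
    [/\ V \is unitarymx, forall j, `|c j| = 1 &
        v = V^t* *m diag_mx (\row_j c j) *m V].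
Proof.
move=> uv; have nv : v \is normalmx.
  by apply/normalmxP; rewrite (unitarymxP uv) (unitaryVmx uv).
have /orthomx_spectralP := nv; have uV := spectral_unitarymx v.
rewrite (invmx_unitary uV); move: (spectralmx v) (spectral_diag v) uV => V d uV vE.
have dE : d = \row_j d 0 j by apply/rowP => j; rewrite mxE.
exists V, (fun j => d 0 j); split; [by []| |by rewrite -dE].
move=> j; have := unitarymxP uv.
rewrite vE !trmxC_mul trmxCK [V^t* *m (_ *m V)]mulmxA.
rewrite (unitary_conjM _ _ uV) => /(congr1 (fun X => V *m X *m V^t*)).
rewrite !mulmxA (unitarymxP uV) mul1mx mulmx1 -mulmxA (unitarymxP uV) mulmx1.
rewrite {1 2}dE trmxC_diag diag_mxM => /matrixP/(_ j j).
rewrite !mxE eqxx !mulr1n -normCK => /eqP; rewrite sqrp_eq1//.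
by move=> /eqP.
Qed.

(** A Russo-Dye bound. The spectral projections of [v] go to positive matrices that sum to 1,
    weighted by phases; [psd_amgm] is applied to each and summed. *)
Lemma norm_quad_contraction m n (P : 'M[C]_m -> 'M[C]_n) (v : 'M[C]_m)
    (x y : 'cV[C]_n) : linear P -> positive_map P -> P 1%:M = 1%:M ->
  v \is unitarymx ->
  `|sform (P v) x y| <= 2^-1 * (sform 1%:M x x + sform 1%:M y y).
Proof.
move=> lP pP P1 /unitary_spectral[V [c [uV c1 ->]]].
pose E j := (row j V)^t* *m row j V.
have PE j : psd (P (E j)) by apply/pP/psd_rank1.
have sumE : \sum_j 1 *: P (E j) = 1%:M.
  rewrite -P1 -(linear_sumZ _ _ _ lP) -(unitary_conj_diag V (fun=> 1)) diag_mx_cst.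
  by rewrite mulmx1 (unitaryVmx uV).
rewrite unitary_conj_diag (linear_sumZ _ _ _ lP) -sumE !sform_sum.
rewrite -big_split mulr_sumr /=.
apply: le_trans (ler_norm_sum _ _ _) _; apply: ler_sum => j _.
by rewrite normrM c1 !mul1r; apply: psd_amgm (PE j).
Qed.

(** In an eigenbasis of [rho] the trace is a sum, weighted by the eigenvalues, of matrix elements of
    [P v] between unit vectors. The unitaries [u] and [w] make room for the imaginary powers that
    arise on vertical lines. *)
Lemma tr_contraction m n (P : 'M[C]_m -> 'M[C]_n) (v : 'M[C]_m) (rho u w : 'M[C]_n) :
  linear P -> positive_map P -> P 1%:M = 1%:M -> posdef rho ->
  u \is unitarymx -> v \is unitarymx -> w \is unitarymx ->
  `|\tr (rho *m u *m P v *m w)| <= \tr rho.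
Proof.
move=> lP pP P1 /posdef_spectral[U [d [uU d0 _ ->]]] uu uv uw.
set A := P v.
pose x i := u^t* *m (row i U)^t*; pose y i := w *m (row i U)^t*.
have -> : \tr (U^t* *m diag_mx (\row_j (d j)%:C) *m U *m u *m A *m w) =
    \sum_i (d i)%:C * sform A (x i) (y i).
  rewrite unitary_conj_diag !mulmx_suml raddf_sum /=; apply: eq_bigr => i _.
  rewrite -!scalemxAl mxtraceZ -!mulmxA mxtrace_mulC sform.unlock /x /y.
  by rewrite trmxC_mul !trmxCK !mulmxA /mxtrace big_ord1.
have -> : \tr (U^t* *m diag_mx (\row_j (d j)%:C) *m U) = \sum_i (d i)%:C.
  rewrite mxtrace_mulC mulmxA (unitarymxP uU) mul1mx mxtrace_diag.
  by apply: eq_bigr => i _; rewrite mxE.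
have r1 i : row i U *m (row i U)^t* = 1%:M.
  apply/matrixP => a b; rewrite !ord1.
  have := unitarymxP uU => /matrixP/(_ i i); rewrite !mxE eqxx /= => <-.
  by apply: eq_bigr => j _; rewrite !mxE.
have x1 i : sform 1%:M (x i) (x i) = 1.
  rewrite sform.unlock mulmx1 /x trmxC_mul !trmxCK mulmxA.
  by rewrite -[_ *m u *m _]mulmxA (unitarymxP uu) mulmx1 r1 mxE.
have y1 i : sform 1%:M (y i) (y i) = 1.
  rewrite sform.unlock mulmx1 /y trmxC_mul !trmxCK mulmxA.
  by rewrite -[_ *m _ *m w]mulmxA (unitaryVmx uw) mulmx1 r1 mxE.
apply: le_trans (ler_norm_sum _ _ _) _; apply: ler_sum => i _.
have di : 0 <= (d i)%:C by rewrite ler0c ltW.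
rewrite normrM (ger0_norm di) -[leRHS]mulr1 ler_wpM2l//.
apply: le_trans (norm_quad_contraction (x i) (y i) lP pP P1 uv) _.
by rewrite x1 y1 -mulr2n -[X in _ * X]mulr_natl mulr1 mulVf// pnatr_eq0.
Qed.

End PositiveMaps.

(** * Interpolation *)

Section Powers.
Variable R : realType.
Local Notation C := R[i].

(** Written with exp and ln because [ln] is total: exponents add and cancel for every matrix. On
    positive definite matrices this is [mpow]. *)
Definition epow m (A : 'M[C]_m) (p : R) := mfunC (fun x => (expR (p * ln x))%:C) A.
Definition elog m (A : 'M[C]_m) := mfunC (fun x => (ln x)%:C) A.

Lemma mpowE m (A : 'M[C]_m) p : posdef A -> mpow A p = epow A p.
Proof.
move=> pA; rewrite /mpow mfunE; apply: (eq_mfunC pA) => x x0.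
by rewrite /powR (gt_eqF x0).
Qed.

Lemma mlogE m (A : 'M[C]_m) : mlog A = elog A.
Proof. exact: mfunE. Qed.

Lemma epowD m (A : 'M[C]_m) p q : epow A p *m epow A q = epow A (p + q).
Proof.
rewrite /epow mfunCM; congr mfunC.
by apply/funext => x; rewrite mulrDl expRD rmorphM.
Qed.

Lemma epow0 m (A : 'M[C]_m) : epow A 0 = 1%:M.
Proof.
rewrite -(mfunC_cst 1 A); congr mfunC.
by apply/funext => x; rewrite mul0r expR0.
Qed.

Lemma epow1 m (A : 'M[C]_m) : posdef A -> epow A 1 = A.
Proof.
move=> pA; rewrite -[RHS](mfunC_id (proj1 pA)); apply: (eq_mfunC pA) => x x0.
by rewrite mul1r lnK.
Qed.

Lemma epowN m (A : 'M[C]_m) p : epow A p *m epow A (- p) = 1%:M.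
Proof. by rewrite epowD subrr epow0. Qed.

Lemma epowNl m (A : 'M[C]_m) p : epow A (- p) *m epow A p = 1%:M.
Proof. by rewrite epowD addNr epow0. Qed.

Lemma trmxC_epow m (A : 'M[C]_m) p : (epow A p)^t* = epow A p.
Proof.
by rewrite /epow trmxC_mfunC; congr mfunC; apply/funext => x; rewrite conjc_rc.
Qed.

Lemma posdef_epow m (A : 'M[C]_m) p : posdef A -> posdef (epow A p).
Proof.
by move=> pA; rewrite /epow -mfunE; apply: posdef_mfun => // x _; apply: expR_gt0.
Qed.

Lemma epow_unit m (A : 'M[C]_m) p : epow A p \in unitmx.
Proof. exact: (mulmx1_unit (epowN A p)).1. Qed.

Lemma epow_epow m (A : 'M[C]_m) p q : epow (epow A p) q = epow A (p * q).
Proof.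
rewrite {2}/epow -mfunE /epow mfunC_comp; congr mfunC.
by apply/funext => x /=; rewrite expRK mulrA [q * p]mulrC.
Qed.

Lemma elog_comm m (A : 'M[C]_m) p : elog A *m epow A p = epow A p *m elog A.
Proof. by rewrite !mfunCM; congr mfunC; apply/funext => x; rewrite mulrC. Qed.

Lemma unitary_cis m (A : 'M[C]_m) (h : R -> R) : mfunC (fun x => cis (h x)) A \is unitarymx.
Proof.
apply/unitarymxP; rewrite trmxC_mfunC mfunCM -(mfunC_cst 1 A); congr mfunC.
by apply/funext => x; rewrite conjCE conj_cis -cisD subrr cis0.
Qed.

Definition mepd m n (A A' : R -> R -> 'M[C]_(m, n)) :=
  forall i j, exppol_with_derivative (fun s t => A s t i j) (fun s t => A' s t i j).

Lemma mepd_mul m n p (A A' : R -> R -> 'M[C]_(m, n)) (B B' : R -> R -> 'M[C]_(n, p)) :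
  mepd A A' -> mepd B B' ->
  mepd (fun s t => A s t *m B s t) (fun s t => A' s t *m B s t + A s t *m B' s t).
Proof.
move=> hA hB i j.
apply: epd_eq (epd_sum (index_enum 'I_n) (fun k => epdM (hA i k) (hB k j))) => s t.
  by rewrite mxE.
by rewrite !mxE -big_split.
Qed.

Lemma mepd_lin m n p q (P : 'M[C]_(m, n) -> 'M[C]_(p, q)) A A' : linear P ->
  mepd A A' -> mepd (fun s t => P (A s t)) (fun s t => P (A' s t)).
Proof.
move=> lP hA i j.
apply: epd_eq (epd_sum (index_enum 'I_m) (fun a => epd_sum (index_enum 'I_n)
  (fun b => epdZ (P (delta_mx a b) i j) (hA a b)))) => s t.
  rewrite (linear_delta _ lP) summxE; apply: eq_bigr => a _.
  by rewrite summxE; apply: eq_bigr => b _; rewrite mxE mulrC.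
rewrite (linear_delta _ lP) summxE; apply: eq_bigr => a _.
by rewrite summxE; apply: eq_bigr => b _; rewrite mxE mulrC.
Qed.

Lemma epd_tr m (A A' : R -> R -> 'M[C]_m) : mepd A A' ->
  exppol_with_derivative (fun s t => \tr (A s t)) (fun s t => \tr (A' s t)).
Proof. by move=> hA; apply: epd_eq (epd_sum (index_enum 'I_m) (fun k => hA k k)). Qed.

Lemma mepd_mfunC m (A : 'M[C]_m) (g g' : R -> R -> R -> C) :
  (forall x, exppol_with_derivative (g x) (g' x)) ->
  mepd (fun s t => mfunC (fun x => g x s t) A) (fun s t => mfunC (fun x => g' x s t) A).
Proof.
move=> hg i j; have [U [d [_ E _]]] := mfunC_spectral A.
apply: epd_eq (epd_sum (index_enum 'I_m)
   (fun k => epdZ (U^t* i k * U k j) (hg (d k)))) => s t.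
  rewrite E mul_mx_diag mxE; apply: eq_bigr => k _.
  by rewrite !mxE mulrAC.
rewrite E mul_mx_diag mxE; apply: eq_bigr => k _.
by rewrite !mxE mulrAC.
Qed.

(* [mcpow a b A s t] is $A^{a + b (s + i t)}$. *)
Definition mcpow a b m (A : 'M[C]_m) (s t : R) : 'M[C]_m :=
  mfunC (fun x => (expR (a * ln x))%:C * cexp (b * ln x) s t) A.

Definition mphase b m (A : 'M[C]_m) (t : R) : 'M[C]_m :=
  mfunC (fun x => cis (b * ln x * t)) A.

Lemma mphase_unitary b m (A : 'M[C]_m) t : mphase b A t \is unitarymx.
Proof. exact: unitary_cis. Qed.

Lemma mcpowE a b m (A : 'M[C]_m) s t :
  mcpow a b A s t = epow A (a + b * s) *m mphase b A t.
Proof.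
rewrite mfunCM /mcpow; congr mfunC; apply/funext => x.
rewrite /cexp mulrA -rmorphM -expRD /=; congr ((expR _)%:C * _); ring.
Qed.

Lemma mcpowEl a b m (A : 'M[C]_m) s t :
  mcpow a b A s t = mphase b A t *m epow A (a + b * s).
Proof. by rewrite mcpowE !mfunCM; congr mfunC; apply/funext => x; rewrite mulrC. Qed.

Lemma mcpow_real a b m (A : 'M[C]_m) s : mcpow a b A s 0 = epow A (a + b * s).
Proof.
rewrite mcpowE /mphase -[RHS]mulmx1 -(mfunC_cst 1 A); congr (_ *m mfunC _ A).
by apply/funext => x; rewrite mulr0 cis0.
Qed.

Lemma mepd_mcpow a b m (A : 'M[C]_m) :
  mepd (mcpow a b A) (fun s t => b%:C *: (elog A *m mcpow a b A s t)).
Proof.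
have h x := epdZ (expR (a * ln x))%:C (@epd_cexp R (b * ln x)).
move=> i j; apply: epd_eq (mepd_mfunC A h i j) => // s t.
rewrite /elog /mcpow mfunCM mfunCZ; congr ((mfunC _ A) i j).
apply/funext => x; rewrite rmorphM /=; ring.
Qed.

End Powers.

(** * The interpolating function and its two boundary lines *)

Section Interpolation.
Variables (R : realType) (m n : nat).
Local Notation C := R[i].
Variables (P : 'M[C]_m -> 'M[C]_n) (Q : 'M[C]_n -> 'M[C]_m).
Hypotheses (lP : linear P) (lQ : linear Q).
Hypotheses (pP : positive_map P) (pQ : positive_map Q) (P1 : P 1%:M = 1%:M).
Hypothesis dualPQ : forall A B, \tr (A *m P B) = \tr (Q A *m B).
Variables (rho sigma : 'M[C]_n) (rho' sigma' : 'M[C]_m) (M : R).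
Hypotheses (prho : posdef rho) (psigma : posdef sigma).
Hypotheses (prho' : posdef rho') (psigma' : posdef sigma').
Hypotheses (Qsigma : Q sigma = sigma') (M0 : 0 < M).
Hypotheses (trrho : \tr rho = M%:C) (trrho' : \tr rho' = M%:C).

Let h : R := 2^-1.
Let r := mcpow 1 (-1) rho.
Let s1 := mcpow 0 h sigma.
Let r' := mcpow 0 1 rho'.
Let s2 := mcpow 0 (- h) sigma'.

Definition interp (s t : R) : C :=
  \tr (r s t *m s1 s t *m P (s2 s t *m r' s t *m s2 s t) *m s1 s t).

Let D m (A : 'M[C]_m) a b s t := b%:C *: (elog A *m mcpow a b A s t).

(** Nested exactly as the Leibniz rule [mepd_mul] produces it, so that [exppol_interp] needs no
    rearrangement. *)
Definition dinterp (s t : R) : C :=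
  \tr (((D rho 1 (-1) s t *m s1 s t + r s t *m D sigma 0 h s t) *m
        P (s2 s t *m r' s t *m s2 s t) +
        r s t *m s1 s t *m
        P ((D sigma' 0 (- h) s t *m r' s t + s2 s t *m D rho' 0 1 s t) *m s2 s t +
           s2 s t *m r' s t *m D sigma' 0 (- h) s t)) *m s1 s t +
       r s t *m s1 s t *m P (s2 s t *m r' s t *m s2 s t) *m D sigma 0 h s t).

Lemma exppol_interp : exppol_with_derivative interp dinterp.
Proof.
apply: epd_tr; apply: mepd_mul; last exact: mepd_mcpow.
apply: mepd_mul; first by apply: mepd_mul; apply: mepd_mcpow.
apply: (mepd_lin lP); apply: mepd_mul; last exact: mepd_mcpow.
by apply: mepd_mul; apply: mepd_mcpow.
Qed.

(** On Re z = 0 every power is unitary except rho^(1-z), which is [rho] times a unitary; hence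
    [tr_contraction] applies. *)
Lemma interp_bound0 t : `|interp 0 t| <= M%:C.
Proof.
rewrite /interp /r /s1 /r' /s2 !mcpowE !mulr0 !addr0 (epow1 prho) !epow0 !mul1mx.
rewrite -trrho -[rho *m _ *m _]mulmxA.
by apply: tr_contraction => //; rewrite ?mul_unitarymx ?mphase_unitary.
Qed.

(** The Petz recovery map of [Q] at [sigma], in the Heisenberg picture; it is unital because
    Q(sigma) = sigma'. *)
Let Psi (X : 'M[C]_n) := epow sigma' (- h) *m Q (epow sigma h *m X *m epow sigma h)
   *m epow sigma' (- h).

Let half_half (q : R) : h + h = 1.
Proof. by rewrite /h -mulr2n -[_ *+ 2]mulr_natl mulfV ?pnatr_eq0. Qed.

Lemma epow_half k (A : 'M[C]_k) : posdef A -> epow A h *m epow A h = A.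
Proof. by move=> pA; rewrite epowD half_half// epow1. Qed.

(** On Re z = 1 the roles swap: rho^(1-z) is unitary and rho'^z is rho' times a unitary. Moving [P]
    across the trace turns the map into [Psi], and the contraction bound applies to [Psi] and
    rho'. *)
Lemma interp_bound1 t : `|interp 1 t| <= M%:C.
Proof.
have lPsi : linear Psi.
  move=> a X Y; rewrite /Psi mulmxDr mulmxDl -scalemxAr -scalemxAl lQ mulmxDr mulmxDl.
  by rewrite -scalemxAr -scalemxAl.
have pPsi : positive_map Psi.
  move=> X pX; rewrite /Psi -{1}(trmxC_epow sigma' (- h)); apply: psd_conj.
  by apply: pQ; rewrite -{1}(trmxC_epow sigma h); apply: psd_conj.
have Psi1 : Psi 1%:M = 1%:M.
  rewrite /Psi mulmx1 (epow_half psigma) Qsigma.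
  by rewrite -{2}(epow_half psigma') mulmxA epowNl mul1mx epowN.
have rE : r 1 t = mphase (-1) rho t.
  by rewrite /r mcpowE mulr1 subrr epow0 mul1mx.
have sE : s1 1 t = epow sigma h *m mphase h sigma t.
  by rewrite /s1 mcpowE mulr1 add0r.
have sEl : s1 1 t = mphase h sigma t *m epow sigma h.
  by rewrite /s1 mcpowEl mulr1 add0r.
have r'E : r' 1 t = rho' *m mphase 1 rho' t.
  by rewrite /r' mcpowE mulr1 add0r (epow1 prho').
have s2E : s2 1 t = epow sigma' (- h) *m mphase (- h) sigma' t.
  by rewrite /s2 mcpowE mulr1 add0r.
have s2El : s2 1 t = mphase (- h) sigma' t *m epow sigma' (- h).
  by rewrite /s2 mcpowEl mulr1 add0r.
pose U := mphase h sigma t *m mphase (-1) rho t *m mphase h sigma t.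
have -> : interp 1 t = \tr (rho' *m (mphase 1 rho' t *m mphase (- h) sigma' t)
     *m Psi U *m mphase (- h) sigma' t).
  (* Every complex power of [sigma] and [sigma'] is split with its positive part next to [P], or at
     the outer end of its argument, and its phase on the other side. *)
  rewrite /interp rE {2}sE {1}sEl {2}s2El {1}s2E r'E.
  set u := mphase _ rho t; set us := mphase h sigma t.
  set u' := mphase _ rho' t; set us' := mphase _ sigma' t.
  set a := epow sigma h; set b := epow sigma' (- h).
  set Y := b *m us' *m (rho' *m u') *m (us' *m b).
  transitivity (\tr ((u *m us *m a *m P Y) *m (a *m us))); first by rewrite !mulmxA.
  rewrite mxtrace_mulC.
  transitivity (\tr ((a *m U *m a) *m P Y)); first by rewrite /U !mulmxA.
  rewrite dualPQ.
  transitivity (\tr ((Q (a *m U *m a) *m b *m us') *m (rho' *m u' *m us' *m b))).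
    by rewrite /Y !mulmxA.
  by rewrite mxtrace_mulC /Psi !mulmxA.
rewrite -trrho'.
by apply: tr_contraction => //; rewrite ?mul_unitarymx ?mphase_unitary.
Qed.

Lemma interp_real s : interp s 0 = \tr (epow rho (1 - s) *m epow sigma (s / 2) *m
  P (epow sigma' (- (s / 2)) *m epow rho' s *m epow sigma' (- (s / 2)))
  *m epow sigma (s / 2)).
Proof.
rewrite /interp /r /s1 /r' /s2 !mcpow_real !add0r mul1r mulN1r mulNr.
by rewrite [h * s]mulrC.
Qed.

Lemma interpolation_le s : 0 <= s <= 1 ->
  complex.Re (\tr (epow rho (1 - s) *m epow sigma (s / 2) *m
    P (epow sigma' (- (s / 2)) *m epow rho' s *m epow sigma' (- (s / 2)))
    *m epow sigma (s / 2))) <= M.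
Proof.
move=> s01; rewrite -interp_real.
exact: (epd_three_lines exppol_interp s01 M0 interp_bound0 interp_bound1).
Qed.

(** At z = 0 all powers except that of [rho] are the identity and P(1) = 1, so the Leibniz terms
    collapse; the two factors sigma^(z/2) contribute half a logarithm each. *)
Lemma interpolation_derivative0 :
  complex.Re (\tr (rho *m (elog sigma - elog rho + P (elog rho' - elog sigma')))) <= 0.
Proof.
have e00 : complex.Re (interp 0 0) = M.
  rewrite interp_real subr0 (epow1 prho) mul0r oppr0 !epow0 !mulmx1 P1 mulmx1.
  by rewrite trrho.
have := epd_derivative_at0 exppol_interp M0 interp_bound0 interp_bound1 e00.
suff -> : dinterp 0 0 =
  \tr (rho *m (elog sigma - elog rho + P (elog rho' - elog sigma'))) by [].
rewrite /dinterp /D /r /s1 /r' /s2 !mcpow_real !mulr0 !addr0 (epow1 prho) !epow0.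
rewrite !mulmx1 !mul1mx P1 !mulmx1.
have hC : h%:C + h%:C = 1 :> C by rewrite -rmorphD half_half.
have -> : (- h)%:C *: elog sigma' + 1%:C *: elog rho' + (- h)%:C *: elog sigma' =
    elog rho' - elog sigma'.
  by rewrite addrAC -scalerDl !rmorphN -opprD hC scaleN1r scale1r addrC.
rewrite -scalemxAr !mxtraceD !mxtraceZ mulmxDr mulmxBr mxtraceD raddfB /=.
rewrite [X in _ * X + _ + _ + _]mxtrace_mulC.
move: (\tr _) (\tr _) (\tr _) => a b c.
have -> : (-1)%:C = -1 :> C by rewrite rmorphN.
transitivity ((h%:C + h%:C) * b - c + a); first by ring.
by rewrite hC mul1r.
Qed.

End Interpolation.

Lemma tr_expand3 (K : comNzRingType) n (x y : K) (A B Y a : 'M[K]_n) :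
  \tr ((x *: A *m a + y *: (B *m a)) *m Y *m a) =
  x * \tr (A *m (a *m Y *m a)) + y * \tr (B *m (a *m Y *m a)).
Proof. by rewrite !mulmxDl mxtraceD -!scalemxAl !mxtraceZ !mulmxA. Qed.

Lemma tr_expand4 (K : comNzRingType) n (x y : K) (S L b r l : 'M[K]_n) :
  \tr (S *m ((x *: (L *m b) *m r + b *m (y *: (l *m r))) *m b
    + b *m r *m (x *: (L *m b)))) =
  x * \tr (S *m (L *m b *m r *m b)) + y * \tr (S *m (b *m (l *m r) *m b)) +
  x * \tr (S *m (b *m r *m (L *m b))).
Proof.
by rewrite !(mulmxDl, mulmxDr) !mxtraceD -?(scalemxAl, scalemxAr) !mxtraceZ.
Qed.

(** * The derivative at the right endpoint *)

Section InterpolationEndpoint.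
Variables (R : realType) (n : nat).
Local Notation C := R[i].
Variables (P Q : 'M[C]_n -> 'M[C]_n).
Hypotheses (lP : linear P) (lQ : linear Q).
Hypotheses (pP : positive_map P) (pQ : positive_map Q) (P1 : P 1%:M = 1%:M).
Hypothesis dualPQ : forall A B, \tr (A *m P B) = \tr (Q A *m B).
Variables (rho sigma : 'M[C]_n) (M : R).
Hypotheses (prho : posdef rho) (psigma : posdef sigma) (Qsigma : Q sigma = sigma).
Hypotheses (M0 : 0 < M) (trrho : \tr rho = M%:C).

Let h : R := 2^-1.
Let X := epow sigma (- h) *m rho *m epow sigma (- h).

(** The endpoint z = 1 for rho' = rho and sigma' = sigma. There F equals Tr[sigma X] = Tr rho = M
    because [Q] fixes [sigma], so its real part is maximal and the derivative at the right end is
    nonnegative. *)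
Lemma interpolation_derivative1 :
  0 <= complex.Re (\tr ((rho - epow sigma h *m P X *m epow sigma h) *m
    (elog rho - elog sigma))).
Proof.
have trS A : \tr (epow sigma h *m P A *m epow sigma h) = \tr (sigma *m A).
  by rewrite mxtrace_mulC mulmxA (epow_half psigma) dualPQ Qsigma.
have hC : h%:C + h%:C = 1 :> C by rewrite -rmorphD /h -mulr2n -[_ *+ 2]mulr_natl mulfV ?pnatr_eq0.
have sb : epow sigma (- h) *m sigma *m epow sigma (- h) = 1%:M.
  by rewrite -[X in _ *m X *m _](epow_half psigma) mulmxA epowNl mul1mx epowN.
have trX : \tr (sigma *m X) = \tr rho.
  rewrite /X mulmxA mxtrace_mulC.
  have -> : epow sigma (- h) *m (sigma *m (epow sigma (- h) *m rho)) =
     (epow sigma (- h) *m sigma *m epow sigma (- h)) *m rho by rewrite !mulmxA.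
  by rewrite sb mul1mx.
have e10 : complex.Re (interp P rho sigma rho sigma 1 0) = M.
  rewrite interp_real subrr epow0 !mul1mx (epow1 prho) div1r -/h trS.
  by rewrite trX trrho.
have := epd_derivative_at1 (exppol_interp lP rho sigma rho sigma) M0
  (interp_bound0 lP pP P1 sigma rho sigma prho trrho)
  (interp_bound1 lQ pQ dualPQ rho psigma prho psigma Qsigma trrho) e10.
suff -> : dinterp P rho sigma rho sigma 1 0 =
  \tr ((rho - epow sigma h *m P X *m epow sigma h) *m (elog rho - elog sigma)) by [].
rewrite /dinterp !mcpow_real !mulr1 subrr !add0r (epow1 prho) !epow0 -/h !mul1mx !mulmx1.
rewrite -/X; set L := elog sigma; set l := elog rho.
rewrite mulmxDl mxtraceD mxtraceD trS.
set a := epow sigma h; set b := epow sigma (- h); set W := a *m P X *m a.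
have tl : \tr (((-1)%:C *: l *m a + h%:C *: (L *m a)) *m P X *m a) =
   - \tr (l *m W) + h%:C * \tr (L *m W).
  by rewrite tr_expand3 rmorphN mulN1r.
have tr' : \tr (a *m P X *m (h%:C *: (L *m a))) = h%:C * \tr (L *m W).
  rewrite -scalemxAr mxtraceZ /L /a elog_comm -/L -/a.
  have -> : a *m P X *m (a *m L) = W *m L by rewrite mulmxA.
  by rewrite mxtrace_mulC.
have tm : \tr (sigma *m (((- h)%:C *: (L *m b) *m rho + b *m (1%:C *: (l *m rho))) *m b
   + b *m rho *m ((- h)%:C *: (L *m b)))) = - \tr (L *m rho) + \tr (l *m rho).
  rewrite tr_expand4.
  have t1 : \tr (sigma *m (L *m b *m rho *m b)) = \tr (L *m rho).
    rewrite {1}/L {1}/b elog_comm -/L -/b.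
    transitivity (\tr ((sigma *m b *m L *m rho) *m b)); first by rewrite !mulmxA.
    rewrite mxtrace_mulC.
    transitivity (\tr ((b *m sigma *m b) *m (L *m rho))); first by rewrite !mulmxA.
    by rewrite sb mul1mx.
  have t2 : \tr (sigma *m (b *m (l *m rho) *m b)) = \tr (l *m rho).
    rewrite mulmxA mxtrace_mulC.
    have -> : b *m (sigma *m (b *m (l *m rho))) = (b *m sigma *m b) *m (l *m rho).
      by rewrite !mulmxA.
    by rewrite sb mul1mx.
  have t3 : \tr (sigma *m (b *m rho *m (L *m b))) = \tr (L *m rho).
    transitivity (\tr ((sigma *m b *m rho) *m (L *m b))); first by rewrite !mulmxA.
    rewrite mxtrace_mulC.
    transitivity (\tr (L *m (b *m sigma *m b) *m rho)); first by rewrite !mulmxA.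
    by rewrite sb mulmx1.
  rewrite t1 t2 t3 rmorphN; move: (\tr (L *m rho)) (\tr (l *m rho)) => u v.
  transitivity (- ((h%:C + h%:C) * u) + v); first by rewrite mul1r; ring.
  by rewrite hC mul1r.
rewrite tl tr' tm mulmxBl !mulmxBr !raddfB /=.
rewrite [\tr (rho *m l)]mxtrace_mulC [\tr (rho *m L)]mxtrace_mulC.
rewrite [\tr (W *m l)]mxtrace_mulC [\tr (W *m L)]mxtrace_mulC.
move: (\tr (l *m W)) (\tr (L *m W)) (\tr (l *m rho)) (\tr (L *m rho)) => u v x y.
transitivity (- u + (h%:C + h%:C) * v - y + x); first by ring.
by rewrite hC; ring.
Qed.

End InterpolationEndpoint.

(** * Matrix exponential *)

Lemma mx_lim_entries (K : numFieldType) m n (u : nat -> 'M[K]_(m, n)) (L : 'M[K]_(m, n)) :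
  (forall e : K, 0 < e -> exists N, forall k, (N <= k)%N ->
     forall i j, `|L i j - u k i j| < e) -> lim (u @ \oo)%classic = L.
Proof.
move=> h; apply: (cvg_lim (@norm_hausdorff _ _)); apply/cvg_ballP => e e0.
have [N hN] := h _ e0; exists N => // k /= Nk; split => // i j; exact: hN.
Qed.

Section MatrixExponential.
Variable R : realType.
Local Notation C := R[i].
Local Open Scope classical_set_scope.

Lemma norm_ReIm (z : C) : `|z| <= (`|complex.Re z| + `|complex.Im z|)%:C.
Proof.
case: z => a b; rewrite normc_def lecR /=.
have s0 : 0 <= `|a| + `|b| by rewrite addr_ge0.
rewrite -[leRHS](ger0_norm s0) -sqrtr_sqr ler_wsqrtr// sqrrD !real_normK ?num_real//.
by rewrite lerD2r lerDl mulrn_wge0// mulr_ge0.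
Qed.

Lemma Re_norm_le (z : C) (x : R) : `|z| <= x%:C -> `|complex.Re z| <= x.
Proof. by move=> h; rewrite -lecR; apply: le_trans (normc_ge_Re _) h. Qed.

Lemma Im_norm_le (z : C) (x : R) : `|z| <= x%:C -> `|complex.Im z| <= x.
Proof.
move=> h; have -> : `|complex.Im z| = `|complex.Re (z * 'i%C)|.
  by rewrite ReiNIm normrN.
apply: Re_norm_le; rewrite normrM [X in _ * X]normc_def /= expr0n /= expr1n add0r sqrtr1.
by rewrite mulr1.
Qed.

Lemma Re_norm_ge0 (z : C) : 0 <= complex.Re `|z|.
Proof. exact: (Re_le (normr_ge0 z)). Qed.

(** Every lower bound x n - (b - e n) lies below every upper bound x k + (b - e k); the supremum of
    the lower bounds is the limit, with an explicit error in place of a Cauchy argument. *)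
Lemma dominated_real (x e : nat -> R) (b : R) :
  (forall n k, (n <= k)%N -> `|x k - x n| <= e k - e n) -> (forall n, e n <= b) ->
  exists l, forall n, `|l - x n| <= b - e n.
Proof.
move=> h eb.
have key n k : x n - (b - e n) <= x k + (b - e k).
  have := eb n; have := eb k.
  by have [nk|/ltnW kn] := leqP n k; [have := h _ _ nk|have := h _ _ kn];
    rewrite ler_norml => /andP[]; lra.
exists (sup [set x n - (b - e n) | n in setT]) => n.
have ub : ubound [set x n - (b - e n) | n in setT] (x n + (b - e n)).
  by move=> _ [k _ <-].
have hs : has_sup [set x n - (b - e n) | n in setT].
  by split; [exists (x n - (b - e n)), n|exists (x n + (b - e n))].
rewrite ler_norml; apply/andP; split.
  rewrite lerBrDr addrC; apply: (ub_le_sup hs.2); by exists n.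
by rewrite lerBlDr addrC; apply: (ge_sup hs.1).
Qed.

Lemma dominated_complex (x : nat -> C) (e : nat -> R) (b : R) :
  (forall n k, (n <= k)%N -> `|x k - x n| <= (e k - e n)%:C) -> (forall n, e n <= b) ->
  exists l, forall n, `|l - x n| <= (2 * (b - e n))%:C.
Proof.
move=> h eb.
have [n k nk|l hl] := @dominated_real (fun n => complex.Re (x n)) e b _ eb.
  by have := Re_norm_le (h _ _ nk); rewrite raddfB.
have [n k nk|l' hl'] := @dominated_real (fun n => complex.Im (x n)) e b _ eb.
  by have := Im_norm_le (h _ _ nk); rewrite raddfB.
exists (l +i* l') => n; apply: le_trans (norm_ReIm _) _; rewrite lecR.
rewrite !raddfB /= mulr_natl mulr2n; exact: lerD.
Qed.

Variables (N : nat) (A : 'M[C]_N).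
Let B : R := \sum_i \sum_j complex.Re `|A i j|.

Lemma entry_norm_sum_ge0 : 0 <= B.
Proof. by rewrite !sumr_ge0// => *; rewrite sumr_ge0// => *; exact: Re_norm_ge0. Qed.

Lemma norm_entry_pow (t : R) (j : nat) i k : 0 <= t ->
  `|((t%:C *: A) ^+ j) i k| <= ((t * B) ^+ j)%:C.
Proof.
move=> t0; have B0 : 0 <= t * B by rewrite mulr_ge0// entry_norm_sum_ge0.
elim: j i k => [|j IH] i k.
  by rewrite !expr0 mxE; case: (_ == _); rewrite ?normr1 ?normr0 ?lexx ?ler01.
rewrite !exprS mxE; apply: le_trans (ler_norm_sum _ _ _) _.
apply: (@le_trans _ _ (\sum_l `|(t%:C *: A) i l| * ((t * B) ^+ j)%:C)).
  by apply: ler_sum => l _; rewrite normrM ler_wpM2l.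
rewrite -mulr_suml rmorphM /= ler_wpM2r ?ler0c ?exprn_ge0//.
under eq_bigr => l _ do rewrite mxE normrM (@ger0_norm _ t%:C) ?ler0c// (ge0_complexE (normr_ge0 (A i l))).
rewrite -mulr_sumr rmorphM /= ler_wpM2l ?ler0c// -rmorph_sum lecR /B.
rewrite [leRHS](bigD1 i)//= lerDl sumr_ge0// => *.
by rewrite sumr_ge0// => *; exact: Re_norm_ge0.
Qed.

Let eB n : R := series (exp_coeff B) n.

Lemma exp_coeff_sum_le n : eB n <= expR B.
Proof.
apply: nondecreasing_cvgn_le; last exact: is_cvg_series_exp_coeff.
by apply: nondecreasing_series => k _ _; rewrite divr_ge0// exprn_ge0// entry_norm_sum_ge0.
Qed.

(** The tail of the series from degree 2: for t <= 1 each t^l with l >= 2 is at most t^2, and the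
    remaining sum is dominated by the exponential series of [B]. *)
Lemma expm_quadratic (t : R) : 0 <= t <= 1 -> forall i j,
  `|expm (t%:C *: A) i j - (1%:M + t%:C *: A) i j| <= (t ^+ 2 * expR B)%:C.
Proof.
move=> /andP[t0 t1] i j.
have B0 := entry_norm_sum_ge0.
pose a l : 'M[C]_N := (l`!%:R)^-1 *: (t%:C *: A) ^+ l.
pose u : nat -> 'M[C]_N := series a.
have dE l : exp_coeff B l = B ^+ l / l`!%:R by [].
have aE (p : nat) l i' k' : (p <= l)%N -> `|a l i' k'| <= (t ^+ p * exp_coeff B l)%:C.
  move=> pl; rewrite /a mxE normrM normfV normr_nat dE.
  have -> : (t ^+ p * (B ^+ l / l`!%:R))%:C = l`!%:R^-1 * (t ^+ p * B ^+ l)%:C.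
    by rewrite mulrA rmorphM /= fmorphV rmorph_nat mulrC.
  rewrite ler_wpM2l ?invr_ge0//; apply: le_trans (norm_entry_pow _ _ _ t0) _.
  rewrite lecR exprMn ler_wpM2r ?exprn_ge0//.
  by rewrite -(subnKC pl) exprD ler_piMr ?exprn_ge0// exprn_ile1.
have us n k i' j' : (n <= k)%N -> `|u k i' j' - u n i' j'| <= (eB k - eB n)%:C.
  move=> nk.
  have -> : eB k - eB n = \sum_(n <= l < k) exp_coeff B l.
    by rewrite /eB /series /= (big_cat_nat (leq0n n) nk) /= addrAC subrr add0r.
  have -> : u k i' j' - u n i' j' = \sum_(n <= l < k) a l i' j'.
    rewrite /u /series /= (big_cat_nat (leq0n n) nk) /= mxE addrAC subrr add0r.
    by rewrite summxE.
  rewrite rmorph_sum; apply: le_trans (ler_norm_sum _ _ _) _.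
  by apply: ler_sum => l _; have := aE 0%N l i' j' (leq0n _); rewrite mul1r.
(* [expm] is a [lim], so its value is usable only after a limit [L] with entrywise convergence has
   been produced and identified with it. *)
have [L [limE hL]] : exists L, expm (t%:C *: A) = L /\
    forall e : R, 0 < e -> exists N, forall k, (N <= k)%N ->
      forall i j, `|L i j - u k i j| < e%:C.
  have cl i' j' := dominated_complex (fun n k => @us n k i' j') exp_coeff_sum_le.
  pose L := \matrix_(i', j') projT1 (cid (cl i' j')).
  have hL (e : R) : 0 < e -> exists N, forall k, (N <= k)%N ->
      forall i j, `|L i j - u k i j| < e%:C.
    move=> e0; have e00 : 0 < e / 2 by rewrite divr_gt0.
    have /cvgrPdist_lt /(_ _ e00) [n0 _ hn0] : eB @ \oo --> expR B :=
      is_cvg_series_exp_coeff B.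
    exists n0 => k n0k i' j'; rewrite mxE.
    apply: le_lt_trans (projT2 (cid (cl i' j')) k) _.
    rewrite ltcR -ltr_pdivlMl// mulrC.
    by apply: le_lt_trans (ler_norm _) _; apply: hn0.
  exists L; split=> //.
  apply: (@mx_lim_entries R[i] N N u L) => e e0.
  have e00 : 0 < complex.Re e by move: e0; rewrite ltcE => /andP[].
  by rewrite (ge0_complexE (ltW e0)); apply: hL.
rewrite limE.
have u2 n : (2 <= n)%N -> `|u n i j - (1%:M + t%:C *: A) i j| <= (t ^+ 2 * expR B)%:C.
  move=> n2.
  have -> : u n i j - (1%:M + t%:C *: A) i j = \sum_(2 <= l < n) a l i j.
    rewrite /u /series /= (big_cat_nat (leq0n 2) n2) /= mxE addrAC.
    have -> : \sum_(0 <= l < 2) a l = 1%:M + t%:C *: A.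
      by rewrite big_nat_recl// big_nat1 /a !fact0 expr0 expr1 invr1 !scale1r.
    by rewrite subrr add0r summxE.
  apply: le_trans (ler_norm_sum _ _ _) _.
  apply: (@le_trans _ _ (\sum_(2 <= l < n) (t ^+ 2 * exp_coeff B l)%:C)).
    by rewrite !big_nat; apply: ler_sum => l /andP[l2 _]; exact: aE.
  rewrite -rmorph_sum lecR -mulr_sumr ler_wpM2l ?exprn_ge0//.
  apply: le_trans (exp_coeff_sum_le n); rewrite /eB /series /= [leRHS](big_cat_nat (leq0n 2) n2) /=.
  by rewrite lerDr sumr_ge0// => l _; rewrite divr_ge0// exprn_ge0.
set z := (1%:M + _) i j in u2 *; set b := t ^+ 2 * expR B in u2 *.
have h (e : R) : 0 < e -> `|L i j - z| <= (b + e)%:C.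
  move=> e0; have eC : 0 < e%:C by rewrite ltcR.
  have [n [n2 un]] : exists n, (2 <= n)%N /\ `|L i j - u n i j| < e%:C.
    have [n hn] := hL _ e0; exists (maxn 2 n); split; first exact: leq_maxl.
    exact: hn (leq_maxr _ _) _ _.
  rewrite -(subrKA (u n i j)) addrC rmorphD /=.
  apply: le_trans (ler_normD _ _) _; apply: lerD; first exact: u2.
  exact: ltW.
rewrite (ge0_complexE (normr_ge0 _)) lecR; apply/ler_addgt0Pr => e e0.
by rewrite -lecR -ge0_complexE// h.
Qed.

End MatrixExponential.

(** * Operators and dual maps *)

Section Operators.
Variable R : realType.
Local Notation C := R[i].
Implicit Types T : finType.

Lemma linear_scale m n p q (P : 'M[C]_(m, n) -> 'M[C]_(p, q)) a X : linear P ->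
  P (a *: X) = a *: P X.
Proof.
by move=> lP; have := linear_sumZ [:: tt] (fun=> a) (fun=> X) lP; rewrite !big_seq1.
Qed.

Lemma entry_mkop T (f : T -> T -> C) x y : entry (mkop f) x y = f x y.
Proof. by rewrite /entry mxE !enum_rankK. Qed.

Lemma op_ext T (X Y : op R T) : (forall x y, entry X x y = entry Y x y) -> X = Y.
Proof.
by move=> h; apply/matrixP => i j; rewrite -(enum_valK i) -(enum_valK j); apply: h.
Qed.

Lemma sum_op T (F : 'I_#|T| -> C) : \sum_i F i = \sum_(x : T) F (enum_rank x).
Proof. by rewrite (reindex (@enum_rank T)) //; apply: onW_bij; apply: enum_rank_bij. Qed.

Lemma entryM T (X Y : op R T) x y :
  entry (X *m Y) x y = \sum_z entry X x z * entry Y z y.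
Proof. by rewrite /entry mxE sum_op. Qed.

Lemma entryD T (X Y : op R T) x y : entry (X + Y) x y = entry X x y + entry Y x y.
Proof. by rewrite /entry mxE. Qed.

Lemma entryB T (X Y : op R T) x y : entry (X - Y) x y = entry X x y - entry Y x y.
Proof. by rewrite /entry !mxE. Qed.

Lemma entryZ T c (X : op R T) x y : entry (c *: X) x y = c * entry X x y.
Proof. by rewrite /entry mxE. Qed.

Lemma entry_sum T (I : Type) (r : seq I) (X : I -> op R T) x y :
  entry (\sum_(i <- r) X i) x y = \sum_(i <- r) entry (X i) x y.
Proof. by rewrite /entry summxE. Qed.

Lemma entry1 T x y : entry (1%:M : op R T) x y = (x == y)%:R.
Proof. by rewrite /entry mxE (inj_eq enum_rank_inj). Qed.

Lemma entry_trmxC T (X : op R T) x y : entry (X^t* : op R T) x y = (entry X y x)^*%R.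
Proof. by rewrite /entry !mxE. Qed.

Lemma entry_eunit T (u v x y : T) :
  entry (eunit R u v) x y = ((x == u) && (y == v))%:R.
Proof. by rewrite /entry /eunit mxE !(inj_eq enum_rank_inj). Qed.

Lemma tr_entry T (X : op R T) : \tr X = \sum_x entry X x x.
Proof. by rewrite /mxtrace sum_op. Qed.

Lemma op_expand T (X : op R T) : X = \sum_u \sum_v entry X u v *: eunit R u v.
Proof.
apply: op_ext => x y; rewrite pair_bigA /= entry_sum (bigD1 (x, y))//= big1.
  by rewrite addr0 entryZ entry_eunit !eqxx mulr1.
move=> [u v] /= uv; rewrite entryZ entry_eunit.
case: andP => [[/eqP ux /eqP vy]|_]; last by rewrite mulr0.
by move: uv; rewrite ux vy eqxx.
Qed.

Lemma linear_op T n p (L : op R T -> 'M[C]_(n, p)) X : linear L ->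
  L X = \sum_u \sum_v entry X u v *: L (eunit R u v).
Proof.
move=> lL; rewrite {1}[X]op_expand !pair_bigA /=.
exact: (linear_sumZ _ (fun p => entry X p.1 p.2) (fun p => eunit R p.1 p.2) lL).
Qed.

(* A unital homomorphism maps spectral projections to spectral projections. *)
Lemma mfunC_morph m n (phi : 'M[C]_m -> 'M[C]_n) (A : 'M[C]_m) g : linear phi ->
  (forall X Y, phi (X *m Y) = phi X *m phi Y) -> phi 1%:M = 1%:M ->
  A \is hermsymmx -> phi A \is hermsymmx ->
  phi (mfunC g A) = mfunC g (phi A).
Proof.
move=> lphi phiM phi1 hA hphiA.
have [U [d [uU -> /(_ hA) AE]]] := mfunC_spectral A.
pose E j := (row j U)^t* *m row j U.
have AEj j : A *m E j = E j *m (d j)%:C%:M.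
  have AU : A *m U^t* = U^t* *m diag_mx (\row_j (d j)%:C).
    by rewrite AE (mulmxtVK _ uU).
  have De : diag_mx (\row_j (d j)%:C) *m delta_mx j (0 : 'I_1) = (d j)%:C *: delta_mx j 0.
    apply/matrixP => a b; rewrite mul_diag_mx !mxE.
    by case: eqP => [->|_]; rewrite ?mulr0.
  rewrite /E trmxC_col 2!mulmxA AU -[U^t* *m _ *m delta_mx _ _]mulmxA De.
  by rewrite mul_mx_scalar -scalemxAr -scalemxAl.
have sumE : \sum_j 1 *: phi (E j) = 1%:M.
  rewrite -(linear_sumZ _ _ _ lphi) -(unitary_conj_diag U (fun=> 1)) diag_mx_cst.
  by rewrite mulmx1 (unitaryVmx uU) phi1.
have key j : mfunC g (phi A) *m phi (E j) = g (d j) *: phi (E j).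
  have hS : ((d j)%:C%:M : 'M[C]_n) \is hermsymmx.
    by apply/hermP; rewrite tr_scalar_mx map_scalar_mx /= conjc_rc.
  have e : phi A *m phi (E j) = phi (E j) *m (d j)%:C%:M.
    rewrite -phiM AEj !mul_mx_scalar.
    exact: linear_scale.
  by rewrite (mfunC_intertwine g hphiA hS e) mfunC_scalar mul_mx_scalar.
rewrite unitary_conj_diag (linear_sumZ _ _ _ lphi).
rewrite -[RHS]mulmx1 -sumE mulmx_sumr; apply: eq_bigr => j _.
by rewrite -scalemxAr scale1r -/(E j) key.
Qed.

Lemma sform_delta m (N : 'M[C]_m) i j : sform N (delta_mx i 0) (delta_mx j 0) = N i j.
Proof.
rewrite sform.unlock -mulmxA -colE mxE (bigD1 i)//= big1 ?addr0 => [|k ki].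
  by rewrite !mxE !eqxx conjC1 mul1r.
by rewrite !mxE (negbTE ki) /= conjC0 mul0r.
Qed.

(** The form of [N], the adjoint of [A] minus [A], vanishes since the form of [A] is real;
    polarisation with the coefficients 1 and i then kills every entry of [N]. *)
Lemma quad_ge0_herm m (A : 'M[C]_m) :
  (forall v : 'cV[C]_m, 0 <= (v^t* *m A *m v) 0 0) -> psd A.
Proof.
move=> h; split=> //; apply/hermP.
pose N : 'M[C]_m := A^t* - A.
have q0 (v : 'cV[C]_m) : sform N v v = 0.
  have Ar : sform A v v \is Num.real by rewrite sform.unlock ger0_real.
  have : sform (A^t* : 'M[C]_m) v v = sform A v v.
    transitivity ((sform A v v)^*%R); last exact/CrealP.
    by rewrite sform.unlock -trmxCE !trmxC_mul trmxCK mulmxA.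
  by rewrite sform.unlock /N mulmxBr mulmxBl !mxE => ->; rewrite subrr.
have qe i j : sform N (delta_mx i 0) (delta_mx j 0) = N i j := sform_delta N i j.
have qc i j c : c * N i j + c^*%R * N j i = 0.
  have hN : N^t* = - N.
    by apply/matrixP => a b; rewrite !mxE rmorphB /= conjCK opprB.
  have cN x y : (sform N x y)^*%R = - sform N y x.
    by rewrite sform.unlock -trmxCE !trmxC_mul trmxCK hN mulmxA mulmxN mulNmx mxE.
  have := q0 (delta_mx i 0 + c *: delta_mx j 0); rewrite sformDr.
  rewrite -[sform N (_ + _) (delta_mx i 0)]opprK -cN -[sform N (_ + _) (delta_mx j 0)]opprK -cN.
  rewrite !sformDr !rmorphD /= !rmorphM /= !cN !q0 !qe !oppr0 add0r mulr0 addr0.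
  by rewrite !mulrN !opprK addrC.
apply/eqP; rewrite -subr_eq0; apply/eqP/matrixP => i j; rewrite -/N [RHS]mxE.
have h1 := qc i j 1; have hi := qc i j 'i%R.
move: h1 hi; rewrite conjC1 !mul1r conjCi => /eqP; rewrite addr_eq0 => /eqP ->.
rewrite mulrN mulNr -opprD -mulr2n => /eqP; rewrite oppr_eq0 mulrn_eq0 mulf_eq0 /=.
by rewrite (negbTE (neq0Ci _)) /= => /eqP ->; rewrite oppr0.
Qed.

Lemma psd_spectral m (A : 'M[C]_m) : psd A -> exists (U : 'M[C]_m) (d : 'I_m -> R),
  [/\ U \is unitarymx, forall j, 0 <= d j &
      A = U^t* *m diag_mx (\row_j (d j)%:C) *m U].
Proof.
move=> [hA pA]; have [U [d [uU _ /(_ hA) AE]]] := mfunC_spectral A.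
exists U, d; split => // j; have := pA ((row j U)^t*).
rewrite trmxCK.
have UA : U *m A *m U^t* = diag_mx (\row_j (d j)%:C).
  by rewrite AE !mulmxA (unitarymxP uU) mul1mx -mulmxA (unitarymxP uU) mulmx1.
have -> : (row j U *m A *m (row j U)^t*) 0 0 = (U *m A *m U^t*) j j.
  rewrite -row_mul !mxE; apply: eq_bigr => k _.
  by congr (_ * _); rewrite !mxE.
by rewrite UA !mxE eqxx mulr1n ler0c.
Qed.

Lemma tr_psd_mul_ge0 m (A B : 'M[C]_m) : psd A -> psd B -> 0 <= \tr (A *m B).
Proof.
move=> /psd_spectral[U [d [uU d0 ->]]] [_ pB].
rewrite unitary_conj_diag mulmx_suml raddf_sum /= sumr_ge0// => j _.
rewrite -scalemxAl mxtraceZ mulr_ge0 ?ler0c// -mulmxA mxtrace_mulC.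
have := pB ((row j U)^t*); rewrite trmxCK.
by rewrite /mxtrace big_ord1.
Qed.

(** The index swap comes from Tr[M delta_mx j i] = M i j; with it this is the dual for the trace
    pairing. *)
Definition dual_map m n (P : 'M[C]_m -> 'M[C]_n) (A : 'M[C]_n) : 'M[C]_m :=
  \matrix_(i, j) \tr (A *m P (delta_mx j i)).

Lemma dual_mapE m n (P : 'M[C]_m -> 'M[C]_n) A B : linear P ->
  \tr (A *m P B) = \tr (dual_map P A *m B).
Proof.
move=> lP; rewrite (linear_delta _ lP) mulmx_sumr raddf_sum /=.
under eq_bigr => i _ do rewrite mulmx_sumr raddf_sum /=.
rewrite exchange_big /=; apply: eq_bigr => j _; rewrite mxE.
by apply: eq_bigr => i _; rewrite -scalemxAr mxtraceZ [dual_map _ _ _ _]mxE mulrC.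
Qed.

Lemma linear_dual_map m n (P : 'M[C]_m -> 'M[C]_n) : linear (dual_map P).
Proof.
move=> a X Y; apply/matrixP => i j.
rewrite [LHS]mxE mulmxDl mxtraceD -scalemxAl mxtraceZ.
by rewrite [RHS]mxE [in X in _ = X + _]mxE ![dual_map _ _ _ _]mxE.
Qed.

Lemma positive_dual_map m n (P : 'M[C]_m -> 'M[C]_n) : linear P ->
  positive_map P -> positive_map (dual_map P).
Proof.
move=> lP pP A pA; apply: quad_ge0_herm => v.
have -> : (v^t* *m dual_map P A *m v) 0 0 = \tr (A *m P (v *m v^t*)).
  by rewrite (dual_mapE _ _ lP) mulmxA mxtrace_mulC mulmxA /mxtrace big_ord1.
apply: (tr_psd_mul_ge0 pA); apply: pP.
by have := psd_rank1 (v^t*); rewrite trmxCK.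
Qed.

End Operators.

(** * Semigroups and their generators *)

Section Semigroup.
Variable R : realType.
Local Notation C := R[i].
Variables (T : finType) (L : op R T -> op R T).
Hypothesis lL : linear L.

Lemma linear_qsg t : linear (qsg L t).
Proof. by move=> a X Y; rewrite /qsg linearP /= mulmxDl -scalemxAl linearP. Qed.

Lemma qsg_quadratic (X : op R T) : exists2 K : R, 0 <= K & forall t, 0 <= t <= 1 ->
  forall i j, `|(qsg L t X - X - t%:C *: L X) i j| <= (t ^+ 2 * K)%:C.
Proof.
pose A := lin_mx L; have AE : L X = vec_mx (mxvec X *m A).
  pose Lf : {linear op R T -> op R T} := HB.pack L (GRing.isLinear.Build _ _ _ _ L lL).
  by rewrite /A -[L]/(Lf : _ -> _) mul_vec_lin mxvecK.
exists ((\sum_k complex.Re `|mxvec X 0 k|) *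
   expR (\sum_i \sum_j complex.Re `|A i j|)) => [|t t01 i j].
  by rewrite mulr_ge0 ?expR_ge0// sumr_ge0// => *; apply: Re_norm_ge0.
pose E := expm (t%:C *: A) - (1%:M + t%:C *: A).
have -> : qsg L t X - X - t%:C *: L X = vec_mx (mxvec X *m E).
  have -> : mxvec X *m E =
      mxvec X *m expm (t%:C *: A) - mxvec X - t%:C *: (mxvec X *m A).
    by rewrite /E mulmxBr mulmxDr mulmx1 -scalemxAr opprD addrA.
  by rewrite AE !raddfB /= mxvecK [in RHS]linearZ.
rewrite [vec_mx _ _ _]mxE mxE; apply: le_trans (ler_norm_sum _ _ _) _.
rewrite mulrCA rmorphM /= rmorph_sum /= mulr_suml; apply: ler_sum => k _.
rewrite normrM -[(Normc.normc _)%:C]/(`|mxvec X 0 k|) ler_wpM2l//.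
have := expm_quadratic A t01 k (mxvec_index i j).
have subE n (P Q : 'M[C]_n) a b : (P - Q) a b = P a b - Q a b by rewrite !mxE.
by rewrite /E subE.
Qed.

Lemma tr_bound n (W D : 'M[C]_n) (b : R) : (forall i j, `|D i j| <= b%:C) ->
  `|\tr (W *m D)| <= ((\sum_i \sum_j complex.Re `|W i j|) * b)%:C.
Proof.
move=> h; rewrite /mxtrace mulr_suml rmorph_sum /=.
apply: le_trans (ler_norm_sum _ _ _) _; apply: ler_sum => i _.
rewrite mxE mulr_suml rmorph_sum /=.
apply: le_trans (ler_norm_sum _ _ _) _; apply: ler_sum => j _.
by rewrite rmorphM /= -[(Normc.normc _)%:C]/(`|W i j|) normrM ler_wpM2l.
Qed.

(** With invariance, Tr[sigma (P_t X - X - t L X)] equals -t Tr[sigma L X] exactly, and it is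
    O(t^2). *)
Lemma invariant_generator (sigma : op R T) X :
  (forall t, 0 <= t -> \tr (sigma *m qsg L t X) = \tr (sigma *m X)) ->
  \tr (sigma *m L X) = 0.
Proof.
move=> inv; have [K K0 hK] := qsg_quadratic X.
apply/eqP; rewrite -normr_eq0; set z := \tr _.
rewrite (ge0_complexE (normr_ge0 z)) -[0]/(0%:C) (inj_eq (@complexI R)).
rewrite eq_le Re_norm_ge0 andbT.
apply: (@linear_le_quadratic _ _ ((\sum_i \sum_j complex.Re `|sigma i j|) * K) 1) => // t t0 t1.
have := tr_bound sigma (hK t _); rewrite (ltW t0) t1 => /(_ isT).
have -> : \tr (sigma *m (qsg L t X - X - t%:C *: L X)) = - (t%:C * z).
  by rewrite !mulmxBr !raddfB /= inv ?(ltW t0)// subrr sub0r -scalemxAr mxtraceZ.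
rewrite normrN normrM ger0_norm ?ler0c ?(ltW t0)//.
rewrite (ge0_complexE (normr_ge0 z)) -rmorphM lecR => /le_trans; apply.
by rewrite mulrCA.
Qed.

Variable k : nat.
Local Notation K2 := ('I_k * T)%type.

Lemma linear_amp (Phi : op R T -> op R T) : linear (@amp R k T Phi).
Proof.
move=> a X Y; apply: op_ext => x y; rewrite entryD entryZ !entry_mkop.
rewrite mulr_sumr -big_split; apply: eq_bigr => u _.
rewrite mulr_sumr -big_split; apply: eq_bigr => v _.
by rewrite entryD entryZ mulrDl mulrA.
Qed.

Definition block (X : op R K2) (a b : 'I_k) : op R T :=
  mkop (fun u v => entry X (a, u) (b, v)).

Lemma entry_amp (Phi : op R T -> op R T) X (x y : K2) : linear Phi ->
  entry (amp Phi X) x y = entry (Phi (block X x.1 y.1)) x.2 y.2.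
Proof.
move=> lPhi; rewrite entry_mkop (linear_op _ lPhi) entry_sum; apply: eq_bigr => u _.
by rewrite entry_sum; apply: eq_bigr => v _; rewrite entryZ entry_mkop.
Qed.

Lemma amp1 (Phi : op R T -> op R T) : linear Phi -> Phi 1%:M = 1%:M ->
  @amp R k T Phi 1%:M = 1%:M.
Proof.
move=> lPhi P1; apply: op_ext => -[a x] [b y]; rewrite (entry_amp _ _ _ lPhi) /=.
have -> : block 1%:M a b = (a == b)%:R *: 1%:M.
  by apply: op_ext => u v; rewrite entry_mkop entryZ !entry1 xpair_eqE -mulnb natrM.
by rewrite (linear_scale _ _ lPhi) P1 entryZ !entry1 xpair_eqE -mulnb natrM.
Qed.

Lemma amp_quadratic (X : op R K2) : exists2 K : R, 0 <= K & forall t, 0 <= t <= 1 ->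
  forall i j, `|(amp (qsg L t) X - X - t%:C *: amp L X) i j| <= (t ^+ 2 * K)%:C.
Proof.
pose K a b := s2val (cid2 (qsg_quadratic (block X a b))).
have K0 a b : 0 <= K a b := s2valP (cid2 (qsg_quadratic (block X a b))).
have hK a b : forall t, 0 <= t <= 1 -> forall i j,
  `|(qsg L t (block X a b) - block X a b - t%:C *: L (block X a b)) i j| <=
  (t ^+ 2 * K a b)%:C := s2valP' (cid2 (qsg_quadratic (block X a b))).
exists (\sum_a \sum_b K a b) => [|t t01 i j].
  by rewrite sumr_ge0// => *; rewrite sumr_ge0.
rewrite -(enum_valK i) -(enum_valK j); move: (enum_val i) (enum_val j) => x y.
rewrite -/(entry _ x y) !entryB entryZ (entry_amp _ _ _ (linear_qsg t)) (entry_amp _ _ _ lL).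
have -> : entry X x y = entry (block X x.1 y.1) x.2 y.2.
  by rewrite entry_mkop -!surjective_pairing.
rewrite -entryZ -!entryB; apply: le_trans (hK _ _ _ t01 _ _) _.
rewrite lecR ler_wpM2l ?sqr_ge0// (bigD1 x.1)//= (bigD1 y.1)//= -addrA lerDl.
by rewrite addr_ge0// !sumr_ge0// => *; rewrite sumr_ge0.
Qed.

Lemma amp_generator_le0 (W X : op R K2) :
  (forall t, 0 <= t ->
    complex.Re (\tr (W *m amp (qsg L t) X)) <= complex.Re (\tr (W *m X))) ->
  complex.Re (\tr (W *m amp L X)) <= 0.
Proof.
move=> h; have [K K0 hK] := amp_quadratic X.
apply: (@linear_le_quadratic _ _ ((\sum_i \sum_j complex.Re `|W i j|) * K) 1) => // t t0 t1.
have := tr_bound W (hK t _); rewrite (ltW t0) t1 => /(_ isT) /Re_norm_le.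
rewrite !mulmxBr !raddfB /= -scalemxAr mxtraceZ.
have -> : complex.Re (t%:C * \tr (W *m amp L X)) = t * complex.Re (\tr (W *m amp L X)).
  by case: (\tr _) => a b /=; rewrite mul0r subr0.
have := h t (ltW t0); rewrite mulrCA.
by rewrite ler_norml => h1 /andP[h2 _]; lra.
Qed.

End Semigroup.

(** * The reference state and the Dirichlet form *)

Section ScaledPowers.
Variable R : realType.
Local Notation C := R[i].

Lemma tr_mul_delta m n (A : 'M[C]_(m, n)) i j : \tr (A *m delta_mx j i) = A i j.
Proof.
rewrite /mxtrace (bigD1 i)//= big1 ?addr0 => [|l li].
  rewrite mxE (bigD1 j)//= big1 ?addr0 => [|l lj]; first by rewrite mxE !eqxx mulr1.
  by rewrite mxE (negbTE lj) mulr0.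
by rewrite mxE big1// => l' _; rewrite mxE (negbTE li) andbF mulr0.
Qed.

Lemma posdefZ m (c : R) (A : 'M[C]_m) : 0 < c -> posdef A -> posdef (c%:C *: A).
Proof.
move=> c0 [/hermP hA pA]; split; first by apply/hermP; rewrite trmxCZ conjc_rc hA.
move=> v v0; rewrite -scalemxAr -scalemxAl mxE mulr_gt0 ?ltcR//.
exact: pA.
Qed.

Lemma mfunC_scale m g (c : R) (A : 'M[C]_m) : A \is hermsymmx ->
  mfunC g (c%:C *: A) = mfunC (fun x => g (c * x)) A.
Proof.
move=> hA; have -> : c%:C *: A = mfun (fun x => c * x) A.
  rewrite mfunE -{1}(mfunC_id hA) mfunCZ; congr mfunC.
  by apply/funext => x; rewrite rmorphM.
by rewrite mfunC_comp.
Qed.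

Lemma epow_scale m (c : R) (A : 'M[C]_m) p : 0 < c -> posdef A ->
  epow (c%:C *: A) p = (expR (p * ln c))%:C *: epow A p.
Proof.
move=> c0 pA; rewrite /epow (mfunC_scale _ _ (proj1 pA)) mfunCZ.
by apply: (eq_mfunC pA) => x x0; rewrite lnM// mulrDr expRD rmorphM.
Qed.

Lemma elog_scale m (c : R) (A : 'M[C]_m) : 0 < c -> posdef A ->
  elog (c%:C *: A) = (ln c)%:C%:M + elog A.
Proof.
move=> c0 pA; rewrite /elog (mfunC_scale _ _ (proj1 pA)) -(mfunC_cst _ A) mfunCD.
by apply: (eq_mfunC pA) => x x0; rewrite lnM// rmorphD.
Qed.

Lemma posdef1 m : posdef (1%:M : 'M[C]_m).
Proof.
have := @posdef_diag_conj R m 1%:M (fun=> 1) (unitmx1 _ _) (fun=> ltr01).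
by rewrite trmxC1 mul1mx mulmx1 diag_mx_cst.
Qed.

Lemma mabs_posdef m (Z : 'M[C]_m) : posdef Z -> mabs Z = Z.
Proof.
move=> pZ; have /hermP hZ := proj1 pZ; rewrite /mabs hZ mfunE.
have -> : Z *m Z = mfun (fun x => x * x) Z.
  rewrite mfunE -{1 2}(mfunC_id (proj1 pZ)) mfunCM; congr mfunC.
  by apply/funext => x; rewrite rmorphM.
rewrite mfunC_comp -[RHS](mfunC_id (proj1 pZ)); apply: (eq_mfunC pZ) => x x0 /=.
by rewrite -expr2 sqrtr_sqr gtr0_norm.
Qed.

Lemma posdef_morph m n (phi : 'M[C]_m -> 'M[C]_n) (A : 'M[C]_m) :
  (forall X Y, phi (X *m Y) = phi X *m phi Y) -> phi 1%:M = 1%:M ->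
  (forall X, phi (X^t*) = (phi X)^t*) -> posdef A -> posdef (phi A).
Proof.
move=> phiM phi1 phiT pA.
have -> : A = (epow A 2^-1)^t* *m 1%:M *m epow A 2^-1.
  by rewrite trmxC_epow mulmx1 (epow_half pA).
rewrite !phiM phiT phi1; apply: (posdef_conj (posdef1 n)).
by have := epowN A 2^-1 => /(congr1 phi); rewrite phiM phi1 => /mulmx1_unit[].
Qed.

End ScaledPowers.

(** * The ampliated reference state and the sign of the Dirichlet forms *)

Section Ampliation.
Variables (R : realType) (T : finType) (sigma : op R T) (k : nat).
Local Notation C := R[i].
Local Notation K2 := ('I_k * T)%type.
Hypotheses (psigma : posdef sigma) (k0 : (0 < k)%N).

Definition ampl (B : op R T) : op R K2 :=
  mkop (fun a b : K2 => (a.1 == b.1)%:R * entry B a.2 b.2).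

Lemma linear_ampl : linear ampl.
Proof.
move=> c X Y; apply: op_ext => a b; rewrite entryD entryZ !entry_mkop entryD entryZ.
by rewrite mulrDr mulrCA.
Qed.

Lemma block_ampl B a b : block (ampl B) a b = (a == b)%:R *: B.
Proof. by apply: op_ext => u v; rewrite entryZ !entry_mkop. Qed.

Lemma block_mul (X Y : op R K2) a b :
  block (X *m Y) a b = \sum_c block X a c *m block Y c b.
Proof.
apply: op_ext => u v; rewrite entry_mkop entryM entry_sum.
under [RHS]eq_bigr => c _ do rewrite entryM.
by rewrite pair_bigA /=; apply: eq_bigr => -[c w] _; rewrite !entry_mkop.
Qed.

Lemma block_inj (X Y : op R K2) : (forall a b, block X a b = block Y a b) -> X = Y.
Proof.
move=> h; apply: op_ext => -[a u] [b v].
by have := h a b => /(congr1 (fun Z => entry Z u v)); rewrite !entry_mkop.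
Qed.

Lemma block_ampl_mull B (X : op R K2) a b : block (ampl B *m X) a b = B *m block X a b.
Proof.
rewrite block_mul (bigD1 a)//= block_ampl eqxx scale1r big1 ?addr0// => c ca.
by rewrite block_ampl eq_sym (negbTE ca) scale0r mul0mx.
Qed.

Lemma block_ampl_mulr B (X : op R K2) a b : block (X *m ampl B) a b = block X a b *m B.
Proof.
rewrite block_mul (bigD1 b)//= block_ampl eqxx scale1r big1 ?addr0// => c cb.
by rewrite block_ampl (negbTE cb) scale0r mulmx0.
Qed.

Lemma amplM B D : ampl (B *m D) = ampl B *m ampl D.
Proof.
by apply: block_inj => a b; rewrite block_ampl_mull !block_ampl scalemxAr.
Qed.

Lemma ampl1 : ampl 1%:M = 1%:M.
Proof.
by apply: op_ext => -[a u] [b v]; rewrite entry_mkop !entry1 xpair_eqE -mulnb natrM.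
Qed.

Lemma amplT (B : op R T) : ampl (B^t* : op R T) = (ampl B)^t*.
Proof.
apply: op_ext => a b; rewrite entry_trmxC !entry_mkop entry_trmxC rmorphM rmorph_nat.
by rewrite eq_sym.
Qed.

Lemma posdef_ampl B : posdef B -> posdef (ampl B).
Proof. by move=> pB; apply: posdef_morph pB; [exact: amplM|exact: ampl1|exact: amplT]. Qed.

Lemma mfunC_ampl g B : posdef B -> mfunC g (ampl B) = ampl (mfunC g B).
Proof.
move=> pB; apply/esym/mfunC_morph; first exact: linear_ampl; first exact: amplM.
- exact: ampl1.
- exact: (proj1 pB).
exact: (proj1 (posdef_ampl pB)).
Qed.

Local Notation tau := (tauk sigma k).

Lemma taukE : tau = (k%:R^-1)%:C *: ampl sigma.
Proof.
apply: op_ext => a b; rewrite entryZ !entry_mkop fmorphV rmorph_nat.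
by rewrite mulrAC mulrC.
Qed.

Let kV : (0 : R) < k%:R^-1. Proof. by rewrite invr_gt0 ltr0n. Qed.

Lemma posdef_tauk : posdef tau.
Proof. by rewrite taukE; apply: posdefZ (posdef_ampl psigma). Qed.

Lemma epow_tauk p : epow tau p = (expR (p * ln k%:R^-1))%:C *: ampl (epow sigma p).
Proof. by rewrite taukE (epow_scale _ kV (posdef_ampl psigma)) -mfunC_ampl. Qed.

Lemma elog_tauk : elog tau = (ln k%:R^-1)%:C%:M + ampl (elog sigma).
Proof. by rewrite taukE (elog_scale kV (posdef_ampl psigma)) -mfunC_ampl. Qed.

Definition gamma_map (s : R) (X : op R K2) : op R K2 := epow tau (s / 2) *m X *m epow tau (s / 2).

Lemma Gam_gamma_map s X : Gam sigma s X = gamma_map s X.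
Proof. by rewrite /Gam (mpowE _ posdef_tauk). Qed.

Lemma posdef_gam s X : posdef X -> posdef (gamma_map s X).
Proof.
move=> pX; rewrite /gamma_map -{1}(trmxC_epow tau (s / 2)).
exact: posdef_conj pX (epow_unit _ _).
Qed.

Definition ptrace (X : op R K2) : op R K2 :=
  mkop (fun a b : K2 => (a.2 == b.2)%:R * \sum_u entry X (a.1, u) (b.1, u)).

(** The powers tau^(-1/2) cancel the weight [sigma] under the trace, and the factor 1/k in tau
    leaves k. The last logarithm in the entropy is thus that of the marginal of [rho], up to ln
    k. *)
Lemma Ek_ptrace rho : Ek sigma (mpow tau (- 2^-1) *m rho *m mpow tau (- 2^-1)) =
  k%:R *: ptrace rho.
Proof.
apply: op_ext => -[a x] [b y]; rewrite entryZ !entry_mkop /= mulrCA; congr (_ * _).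
set Y := _ *m _ *m _.
have -> : \sum_u \sum_v entry sigma u v * entry Y (a, v) (b, u) = \tr (sigma *m block Y a b).
  rewrite tr_entry; apply: eq_bigr => u _; rewrite entryM; apply: eq_bigr => v _.
  by rewrite entry_mkop.
have -> : \sum_u entry rho (a, u) (b, u) = \tr (block rho a b).
  by rewrite tr_entry; apply: eq_bigr => u _; rewrite entry_mkop.
rewrite /Y (mpowE _ posdef_tauk) epow_tauk; set c := (expR _)%:C; set s := epow sigma _.
have cc : c * c = k%:R.
  rewrite /c -rmorphM -expRD -mulrDl -opprD -mulr2n -[2^-1 *+ 2]mulr_natl mulfV ?pnatr_eq0//.
  by rewrite mulN1r -lnV ?posrE// invrK lnK ?posrE ?ltr0n// rmorph_nat.
have -> : block (c *: ampl s *m rho *m (c *: ampl s)) a b = (c * c) *: (s *m block rho a b *m s).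
  rewrite -!scalemxAl -scalemxAr scalerA.
  have -> (d : C) (Z : op R K2) : block (d *: Z) a b = d *: block Z a b.
    by apply: op_ext => u v; rewrite entryZ !entry_mkop entryZ.
  by rewrite block_ampl_mulr block_ampl_mull.
rewrite cc -scalemxAr mxtraceZ; congr (_ * _).
rewrite mulmxA mxtrace_mulC.
transitivity (\tr ((s *m sigma *m s) *m block rho a b)); first by rewrite !mulmxA.
rewrite -[X in s *m X *m s](epow_half psigma) mulmxA epowNl mul1mx epowN.
by rewrite mul1mx.
Qed.

Lemma entpE q X : posdef X ->
  let rho := epow (gamma_map q^-1 X) q in
  entp sigma q X = q^-1 * complex.Re (\tr (rho *m
    (elog rho - elog tau - elog (k%:R *: ptrace rho)))).
Proof.
move=> pX rho; rewrite /entp !mlogE Gam_gamma_map (mpowE _ (posdef_gam _ pX)) -/rho.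
by rewrite Ek_ptrace.
Qed.

Lemma dirichletE1 L X : dirichlet L sigma 1 X =
  - 2^-1 * complex.Re (\tr (gamma_map 1 (amp L X) *m (elog (gamma_map 1 X) - elog tau))).
Proof. by rewrite /dirichlet eqxx !mlogE !Gam_gamma_map. Qed.

(** In this form [X] enters only through Gamma^(1/q)(X) and Gamma^(1/q)(L X), the two quantities
    later shared with the observable of a single factor. *)
Lemma dirichletE L q X : 1 < q -> posdef X -> dirichlet L sigma q X =
  - (q / (2 * (q - 1))) *
  complex.Re (\tr (epow (gamma_map q^-1 X) (q - 1) *m gamma_map q^-1 (amp L X))).
Proof.
move=> q1 pX; rewrite /dirichlet (gt_eqF q1); congr (_ * complex.Re _).
have q0 : q != 0 by rewrite gt_eqF// (lt_trans ltr01).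
have q10 : q - 1 != 0 by rewrite subr_eq0 gt_eqF.
have pZ := posdef_gam q^-1 pX; set Z := gamma_map q^-1 X in pZ *.
rewrite /innertau /Iqp !Gam_gamma_map -/Z (mabs_posdef pZ) (mpowE _ pZ) (mpowE _ posdef_tauk).
have -> : q / (q / (q - 1)) = q - 1.
  by rewrite invfM invrK mulrA mulfV// mul1r.
set W := epow Z (q - 1).
rewrite /gamma_map !trmxC_mul !trmxC_epow; set b := epow tau (- _ / 2).
set a := epow tau (1 / 2); set c := epow tau (q^-1 / 2).
(* 1/2 - 1/(2q') = 1/(2q) for the conjugate exponent q' = q / (q - 1). *)
have ab : a *m b = c.
  rewrite epowD /c; congr epow; rewrite invfM invrK.
  by field.
have ba : b *m a = c by rewrite -ab /a /b !epowD addrC.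
transitivity (\tr ((a *m b) *m W *m (b *m a) *m amp L X)); first by rewrite !mulmxA.
rewrite ab ba -[_ *m _ *m c *m _]mulmxA -[c *m W *m _]mulmxA mxtrace_mulC.
by rewrite !mulmxA.
Qed.

Lemma tr_tauk_block X : \tr (tau *m X) = k%:R^-1 * \sum_a \tr (sigma *m block X a a).
Proof.
rewrite taukE -scalemxAl mxtraceZ fmorphV rmorph_nat; congr (_ * _).
rewrite tr_entry; under [RHS]eq_bigr => a _ do rewrite -block_ampl_mull tr_entry.
by rewrite pair_bigA /=; apply: eq_bigr => -[a u] _; rewrite entry_mkop.
Qed.

Lemma block_amp (Phi : op R T -> op R T) (X : op R K2) a b : linear Phi ->
  block (amp Phi X) a b = Phi (block X a b).
Proof. by move=> lPhi; apply: op_ext => u v; rewrite entry_mkop (entry_amp _ _ _ lPhi). Qed.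

(** Take rho' = rho = Z^q, sigma' = sigma = tau and the ampliated semigroup at time t. The
    interpolation bound, or for q = 1 its endpoint derivative, is an equality at t = 0, so
    differentiating there gives the sign. *)
Lemma dirichlet_ge0 L q (X : op R K2) : primitive_QMS L sigma -> 1 <= q -> posdef X ->
  0 <= dirichlet L sigma q X.
Proof.
move=> [[lL qL] [[[_ tr1] inv] _]] q1 pX; have ptau := posdef_tauk.
have q0 : 0 < q by rewrite (lt_le_trans ltr01).
have K0 : (0 < #|{: K2}|)%N.
  rewrite card_prod card_ord muln_gt0 k0 /= lt0n; apply/eqP => T0.
  have : \tr sigma = 0 by rewrite tr_entry big_pred0// => x; have := fintype0 x T0.
  by rewrite tr1 => /eqP; rewrite oner_eq0.
pose P t : op R K2 -> op R K2 := amp (qsg L t).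
have lP t : linear (P t) by apply: linear_amp.
have posP t : 0 <= t -> positive_map (P t) by move=> t0 Y pY; apply: (qL t t0).2.
have P1 t : 0 <= t -> P t 1%:M = 1%:M.
  by move=> t0; apply: amp1; [exact: linear_qsg|exact: (qL t t0).1].
(* Invariance of [sigma] ampliates: tested on matrix units, each diagonal block reduces to the
   invariance of [sigma]. *)
have Qtau t : 0 <= t -> dual_map (P t) tau = tau.
  move=> t0; apply/matrixP => i j; rewrite mxE tr_tauk_block.
  have -> : \sum_a \tr (sigma *m block (P t (delta_mx j i)) a a) =
      \sum_a \tr (sigma *m block (delta_mx j i) a a).
    apply: eq_bigr => a _; rewrite (block_amp _ _ _ (@linear_qsg _ _ L t)).
    exact: inv.
  by rewrite -tr_tauk_block tr_mul_delta.
have pZ := posdef_gam q^-1 pX; set Z := gamma_map q^-1 X in pZ.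
have prho : posdef (epow Z q) by apply: posdef_epow.
set rho := epow Z q in prho.
have tr0 := tr_posdef_gt0 K0 prho.
have M0 : 0 < complex.Re (\tr rho) by move: tr0; rewrite ltcE => /andP[].
have trE := ge0_complexE (ltW tr0).
set s := q^-1; set a := epow tau (s / 2).
(* With s = 1/q, rho^s is [Z], and the argument of [P] in the interpolation inequality is [X]
   itself. *)
have XE : epow tau (- (s / 2)) *m Z *m epow tau (- (s / 2)) = X.
  rewrite /Z /gamma_map -/s !mulmxA epowNl mul1mx -mulmxA epowN mulmx1//.
have [q1'|q1'] := eqVneq q 1; last first.
  have {}q1 : 1 < q by rewrite lt_neqAle eq_sym q1'.
  rewrite dirichletE// mulNr oppr_ge0 pmulr_rle0; last first.
    by rewrite divr_gt0// mulr_gt0// subr_gt0.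
  have trW Y : \tr (epow Z (q - 1) *m gamma_map s Y) = \tr ((a *m epow Z (q - 1) *m a) *m Y).
    transitivity (\tr ((epow Z (q - 1) *m a *m Y) *m a)); first by rewrite /gamma_map !mulmxA.
    by rewrite mxtrace_mulC !mulmxA.
  rewrite trW; apply: (amp_generator_le0 lL) => t t0; rewrite -!trW.
  have s01 : 0 <= s <= 1 by rewrite invr_ge0 (ltW q0)/= invf_le1// ltW.
  have := interpolation_le (lP t) (@linear_dual_map _ _ _ (P t)) (posP t t0)
    (positive_dual_map (lP t) (posP t t0)) (P1 t t0) (fun A B => dual_mapE A B (lP t))
    prho ptau prho ptau (Qtau t t0) M0 trE trE s01.
  rewrite {1 2}/rho !epow_epow mulfV ?gt_eqF// (epow1 pZ) XE -/a.
  have -> : q * (1 - s) = q - 1 by rewrite mulrBr mulr1 mulfV// gt_eqF.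
  have -> : epow Z (q - 1) *m gamma_map s X = rho.
    by rewrite -/Z -{2}(epow1 pZ) epowD subrK.
  by rewrite /gamma_map -/a !mulmxA.
move: (q1'); rewrite q1' => _; rewrite dirichletE1 mulNr oppr_ge0 pmulr_rle0 ?invr_gt0//.
have sE : s = 1 by rewrite /s q1' invr1.
have rhoE : rho = gamma_map 1 X by rewrite /rho q1' (epow1 pZ) /Z q1' invr1.
set W := elog (gamma_map 1 X) - elog tau.
have aE : a = epow tau (1 / 2) by rewrite /a sE.
have trW Y : \tr (gamma_map 1 Y *m W) = \tr ((a *m W *m a) *m Y).
  rewrite /gamma_map -aE -[a *m Y *m a]mulmxA -mulmxA mxtrace_mulC.
  transitivity (\tr (Y *m (a *m W *m a))); first by rewrite !mulmxA.
  by rewrite mxtrace_mulC.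
rewrite trW; apply: (amp_generator_le0 lL) => t t0; rewrite -!trW.
have := interpolation_derivative1 (lP t) (@linear_dual_map _ _ _ (P t)) (posP t t0)
    (positive_dual_map (lP t) (posP t t0)) (P1 t t0) (fun A B => dual_mapE A B (lP t))
    prho ptau (Qtau t t0) M0 trE.
have XE1 : epow tau (- 2^-1) *m rho *m epow tau (- 2^-1) = X.
  by rewrite -[X in RHS]XE -/s sE div1r rhoE /Z q1' invr1.
have gE Y : gamma_map 1 Y = epow tau 2^-1 *m Y *m epow tau 2^-1 by rewrite /gamma_map div1r.
rewrite XE1 mulmxBl 2!raddfB /= subr_ge0 rhoE => H.
rewrite (gE (amp (qsg L t) X)); exact: H.
Qed.

End Ampliation.

(** * Data processing and strong subadditivity *)

Section DataProcessing.
Variables (R : realType) (n : nat).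
Local Notation C := R[i].
Implicit Types E : 'M[C]_n -> 'M[C]_n.

(** The unital trace dual [P] is part of the data because the interpolation uses both maps; fixing
    one matrix size lets such maps compose. *)
Definition trace_preserving_positive E := exists P : 'M[C]_n -> 'M[C]_n,
  [/\ linear E, linear P, positive_map E, positive_map P &
      P 1%:M = 1%:M /\ forall A B, \tr (A *m P B) = \tr (E A *m B)].

Lemma tpp_id : trace_preserving_positive id.
Proof. by exists id; split. Qed.

Lemma tpp_comp E F : trace_preserving_positive E -> trace_preserving_positive F ->
  trace_preserving_positive (fun X => E (F X)).
Proof.
move=> [P [lE lP pE pP [P1 dP]]] [Q [lF lQ pF pQ [Q1 dQ]]].
exists (fun X => Q (P X)); split.
- by move=> a X Y; rewrite lF lE.
- by move=> a X Y; rewrite lP lQ.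
- by move=> X pX; apply/pE/pF.
- by move=> X pX; apply/pQ/pP.
by split=> [|A B]; rewrite ?P1// dQ dP.
Qed.

(** The sign of the derivative at z = 0 with Q = E, rho' = E(rho), sigma' = E(sigma); trace duality
    turns Tr[rho P(Y)] into Tr[E(rho) Y]. *)
Lemma data_processing E (rho sigma : 'M[C]_n) : (0 < n)%N ->
  trace_preserving_positive E -> posdef rho -> posdef sigma ->
  posdef (E rho) -> posdef (E sigma) ->
  complex.Re (\tr (E rho *m (elog (E rho) - elog (E sigma)))) <=
  complex.Re (\tr (rho *m (elog rho - elog sigma))).
Proof.
move=> n0 [P [lE lP pE pP [P1 dP]]] prho psigma pErho pEsigma.
have tr0 := tr_posdef_gt0 n0 prho.
have M0 : 0 < complex.Re (\tr rho) by move: tr0; rewrite ltcE => /andP[].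
have trE := ge0_complexE (ltW tr0).
have trE' : \tr (E rho) = (complex.Re (\tr rho))%:C.
  by rewrite -trE -[E rho]mulmx1 -dP P1 mulmx1.
have := interpolation_derivative0 lP lE pP pE P1 dP prho psigma pErho pEsigma
  erefl M0 trE trE'.
rewrite mulmxDr mxtraceD dP raddfD /=.
have -> : elog sigma - elog rho = - (elog rho - elog sigma) by rewrite opprB.
rewrite mulmxN raddfN /= raddfN /=.
by move: (complex.Re _) (complex.Re _) => a b; rewrite addrC subr_le0.
Qed.

End DataProcessing.

(** * Commuting conditional expectations built from matrix units *)

Section MatrixUnits.
Variables (R : realType) (n : nat).
Local Notation C := R[i].
Variables (I : eqType) (D : I -> finType) (e : forall i, D i -> D i -> 'M[C]_n).
Hypothesis e_adj : forall i a b, (e (i := i) a b)^t* = e b a.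
Hypothesis e_mul : forall i (a b c d : D i), e a b *m e c d = (b == c)%:R *: e a d.
Hypothesis e_sum : forall i, \sum_(a : D i) e a a = 1%:M.
Hypothesis e_comm : forall i j (a b : D i) (c d : D j), i != j ->
  e a b *m e c d = e c d *m e a b.
Hypothesis D_gt0 : forall i, (0 < #|D i|)%N.
Hypothesis n_gt0 : (0 < n)%N.

(* The normalised partial trace over the factor [i], as a twirl by matrix units. *)
Definition pexp (i : I) (X : 'M[C]_n) : 'M[C]_n :=
  (#|D i|%:R^-1 : C) *: \sum_(p : D i * D i) e p.1 p.2 *m X *m e p.2 p.1.

Definition commutes_with (i : I) (X : 'M[C]_n) :=
  forall a b : D i, e a b *m X = X *m e a b.

Let Dn0 i : (#|D i|%:R : C) != 0. Proof. by rewrite pnatr_eq0 -lt0n. Qed.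

Lemma pexp_fix i X : commutes_with i X -> pexp i X = X.
Proof.
move=> cX; rewrite /pexp.
have -> : \sum_(p : D i * D i) e p.1 p.2 *m X *m e p.2 p.1 = #|D i|%:R *: X.
  transitivity (\sum_(a : D i) \sum_(b : D i) X *m e a a).
    rewrite pair_bigA /=; apply: eq_bigr => -[a b] _ /=.
    by rewrite cX -mulmxA e_mul eqxx scale1r.
  under eq_bigr => a _ do rewrite sumr_const.
  by rewrite sumrMnl -mulmx_sumr e_sum mulmx1 scaler_nat.
by rewrite scalerA mulVf// scale1r.
Qed.

Lemma pexp_commutes i X : commutes_with i (pexp i X).
Proof.
move=> c d; rewrite /pexp -scalemxAr -scalemxAl; congr (_ *: _).
rewrite -!(pair_bigA _ (fun a b => e a b *m X *m e b a)) /=.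
(* The common value of both sides: only a = d survives on the left and only a = c on the right. *)
transitivity (\sum_(b : D i) e c b *m X *m e b d).
  rewrite mulmx_sumr (bigD1 d)//= [X in _ + X]big1 ?addr0 => [|a ad].
    rewrite mulmx_sumr; apply: eq_bigr => b _.
    by rewrite !mulmxA e_mul eqxx scale1r.
  rewrite mulmx_sumr big1// => b _.
  by rewrite !mulmxA e_mul eq_sym (negbTE ad) scale0r !mul0mx.
rewrite mulmx_suml [RHS](bigD1 c)//= [X in _ = _ + X]big1 ?addr0 => [|a ac].
  rewrite mulmx_suml; apply: eq_bigr => b _.
  by rewrite -[RHS]mulmxA e_mul eqxx scale1r.
rewrite mulmx_suml big1// => b _.
by rewrite -mulmxA e_mul (negbTE ac) scale0r mulmx0.
Qed.

Lemma pexp_commutes_with i j X : commutes_with j X -> commutes_with j (pexp i X).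
Proof.
have [->|ij] := eqVneq i j; first by move=> _; apply: pexp_commutes.
move=> cX c d; rewrite /pexp -scalemxAr -scalemxAl mulmx_sumr mulmx_suml.
congr (_ *: _); apply: eq_bigr => p _.
rewrite -[RHS]mulmxA (e_comm _ _ _ _ ij) !mulmxA -(e_comm _ _ _ _ ij).
by rewrite -[_ *m e c d *m X]mulmxA cX !mulmxA.
Qed.

Lemma pexp_comm i j X : pexp i (pexp j X) = pexp j (pexp i X).
Proof.
have [->//|ij] := eqVneq i j.
rewrite /pexp.
have E (a b : C) (p q : I) : a *: \sum_(u : D p * D p) e u.1 u.2 *m
     (b *: \sum_(v : D q * D q) e v.1 v.2 *m X *m e v.2 v.1) *m e u.2 u.1 =
   (a * b) *: \sum_(u : D p * D p) \sum_(v : D q * D q)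
     e u.1 u.2 *m (e v.1 v.2 *m X *m e v.2 v.1) *m e u.2 u.1.
  rewrite -scalerA; congr (_ *: _); rewrite [RHS]scaler_sumr; apply: eq_bigr => u _.
  by rewrite -scalemxAr -scalemxAl mulmx_sumr mulmx_suml.
rewrite !E mulrC exchange_big; congr (_ *: _); apply: eq_bigr => v _.
apply: eq_bigr => u _.
rewrite !mulmxA (e_comm _ _ _ _ ij) -!mulmxA; congr (_ *m (_ *m (_ *m _))).
by rewrite (e_comm _ _ _ _ ij).
Qed.

Lemma tr_pexp i A B : \tr (A *m pexp i B) = \tr (pexp i A *m B).
Proof.
rewrite /pexp -scalemxAr -scalemxAl !mxtraceZ; congr (_ * _).
rewrite mulmx_sumr mulmx_suml !raddf_sum /=.
rewrite -(pair_bigA _ (fun a b => \tr (A *m (e a b *m B *m e b a)))) exchange_big /=.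
rewrite pair_bigA /=; apply: eq_bigr => p _.
by rewrite mulmxA mxtrace_mulC !mulmxA.
Qed.

Lemma tpp_pexp i : trace_preserving_positive (pexp i).
Proof.
have lE : linear (pexp i).
  move=> a X Y; rewrite /pexp scalerA mulrC -scalerA -scalerDr; congr (_ *: _).
  rewrite scaler_sumr -big_split; apply: eq_bigr => p _.
  by rewrite mulmxDr mulmxDl -scalemxAr -scalemxAl.
have pE : positive_map (pexp i).
  move=> X pX; apply: quad_ge0_herm => v.
  rewrite /pexp -scalemxAr -scalemxAl mxE mulr_ge0 ?invr_ge0//.
  rewrite mulmx_sumr mulmx_suml summxE sumr_ge0// => p _.
  have := psd_conj (e p.2 p.1) pX; rewrite e_adj => -[_ /(_ v)].
  by [].
exists (pexp i); split; [exact: lE|exact: lE|exact: pE|exact: pE|].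
split=> [|A B]; last exact: tr_pexp.
by apply: pexp_fix => a b; rewrite mulmx1 mul1mx.
Qed.

Lemma posdef_pexp i X : posdef X -> posdef (pexp i X).
Proof.
move=> pX; have [P [_ _ pE _ _]] := tpp_pexp i.
split; first exact: (proj1 (pE _ (posdef_psd pX))).
move=> v v0; have [a ev] : exists a : D i, e a a *m v != 0.
  apply/existsP; rewrite -negb_forall; apply: contra v0 => /forallP h.
  rewrite -[v]mul1mx -(e_sum i) mulmx_suml big1// => a _.
  exact/eqP/h.
have q (p : D i * D i) : v^t* *m (e p.1 p.2 *m X *m e p.2 p.1) *m v =
    (e p.2 p.1 *m v)^t* *m X *m (e p.2 p.1 *m v).
  by rewrite trmxC_mul e_adj !mulmxA.
rewrite /pexp -scalemxAr -scalemxAl mxE mulr_gt0 ?invr_gt0 ?ltr0n//.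
rewrite mulmx_sumr mulmx_suml summxE (bigD1 (a, a))//= ltr_pwDl//.
  by rewrite (q (a, a)); apply: (quad_posdef pX).
by rewrite sumr_ge0// => p _; rewrite q; apply: (posdef_psd pX).2.
Qed.

Fixpoint pexps (s : seq I) (X : 'M[C]_n) : 'M[C]_n :=
  if s is i :: s' then pexp i (pexps s' X) else X.

Lemma tpp_pexps s : trace_preserving_positive (pexps s).
Proof.
by elim: s => [|i s IH]; [exact: tpp_id|exact: tpp_comp (tpp_pexp i) IH].
Qed.

Lemma posdef_pexps s X : posdef X -> posdef (pexps s X).
Proof. by move=> pX; elim: s => [//|i s IH]; exact: (posdef_pexp i IH). Qed.

Lemma pexps_pexp s i X : pexps s (pexp i X) = pexp i (pexps s X).
Proof. by elim: s => //= j s ->; rewrite pexp_comm. Qed.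

Lemma pexps_commutes s j X : j \in s -> commutes_with j (pexps s X).
Proof.
elim: s => // i s IH; rewrite in_cons => /orP[/eqP ->|/IH]; first exact: pexp_commutes.
exact: pexp_commutes_with.
Qed.

Lemma commutes_elog i X : posdef X -> commutes_with i X -> commutes_with i (elog X).
Proof.
move=> pX cX a b; apply/esym.
exact: (mfunC_intertwine _ (proj1 pX) (proj1 pX) (esym (cX a b))).
Qed.

Lemma tr_pexps_fix s X Y : (forall i, i \in s -> commutes_with i Y) ->
  \tr (pexps s X *m Y) = \tr (X *m Y).
Proof.
elim: s => //= i s IH cY.
rewrite mxtrace_mulC tr_pexp mxtrace_mulC.
rewrite pexp_fix; last by apply: cY; rewrite mem_head.
by apply: IH => j js; apply: cY; rewrite in_cons js orbT.
Qed.

(** Write E_s for [pexps s]. The step from [s] to [i :: s] adds D(E_s rho || E_i E_s rho), because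
    these two logarithms commute with the factors in [s], so that [rho] may be replaced by E_s rho
    under the trace. As E_i and E_s commute, this is the image of the pair rho, E_i rho under E_s,
    and data processing bounds it by D(rho || E_i rho). *)
Lemma entropy_chain (rho : 'M[C]_n) (s : seq I) : posdef rho ->
  complex.Re (\tr (rho *m (elog rho - elog (pexps s rho)))) <=
  \sum_(i <- s) complex.Re (\tr (rho *m (elog rho - elog (pexp i rho)))).
Proof.
move=> prho; elim: s => [|i s IH].
  by rewrite big_nil /= subrr mulmx0 mxtrace0.
rewrite big_cons.
have dp := data_processing n_gt0 (tpp_pexps s) prho (posdef_pexp i prho)
  (posdef_pexps s prho) (posdef_pexps s (posdef_pexp i prho)).
rewrite pexps_pexp in dp.
have fixY j : j \in s ->
    commutes_with j (elog (pexps s rho) - elog (pexp i (pexps s rho))).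
  move=> js a b; rewrite mulmxBr mulmxBl; congr (_ - _); apply: commutes_elog.
  - exact: posdef_pexps.
  - exact: pexps_commutes.
  - by apply: posdef_pexp; apply: posdef_pexps.
  by apply: pexp_commutes_with; apply: pexps_commutes.
have h : complex.Re (\tr (rho *m (elog (pexps s rho) - elog (pexp i (pexps s rho))))) <=
    complex.Re (\tr (rho *m (elog rho - elog (pexp i rho)))) :=
  eq_ind _ (fun z => complex.Re z <= _) dp _ (tr_pexps_fix rho fixY).
have E (A B F : 'M[C]_n) : complex.Re (\tr (rho *m (A - F))) =
   complex.Re (\tr (rho *m (B - F))) + complex.Re (\tr (rho *m (A - B))).
  by rewrite -raddfD /= -mxtraceD -mulmxDr [B - F + _]addrC subrKA.
rewrite [leLHS](E _ (elog (pexps s rho)) (elog (pexp i (pexps s rho)))).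
exact: lerD h IH.
Qed.

End MatrixUnits.

(** * Tensor products *)

Section Tensor.
Variables (R : realType) (n : nat) (T : 'I_n -> finType).
Local Notation C := R[i].
Local Notation K := (TensT T).
Local Notation tens := (@tens_state R n T).
Local Notation fam := (forall i, op R (T i)).

(** The factors have different index types, so the distributive law is applied to tagged values
    through [fprod]. *)
Lemma sum_dffun_prod (F : forall i, T i -> C) :
  \sum_(u : K) \prod_i F i (u i) = \prod_i \sum_(x : T i) F i x.
Proof.
rewrite (reindex (@dffun_of_fprod _ T)) /=; last exact/onW_bij/dffun_of_fprod_bij.
transitivity (\sum_(t : fprod T) \prod_(i in 'I_n) [ffun x => F i x] (t i)).
  by apply: eq_bigr => t _; apply: eq_bigr => i _; rewrite !ffunE.
rewrite big_fprod -(bigA_distr_big_dep _ (fun i j => untag 0 [ffun x => F i x] j)).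
apply: eq_bigr => i _; rewrite (big_tag F).
apply: eq_bigr => j _; rewrite /untag; case: eqP => // e.
by rewrite ffunE.
Qed.

Lemma tens_ext (A B : fam) : (forall i, A i = B i) -> tens A = tens B.
Proof.
by move=> h; apply: op_ext => u v; rewrite !entry_mkop; apply: eq_bigr => i _; rewrite h.
Qed.

Lemma tensM (A B : fam) : tens A *m tens B = tens (fun i => A i *m B i).
Proof.
apply: op_ext => u v; rewrite entryM !entry_mkop.
transitivity (\sum_(z : K) \prod_i (entry (A i) (u i) (z i) * entry (B i) (z i) (v i))).
  by apply: eq_bigr => z _; rewrite !entry_mkop big_split.
rewrite (sum_dffun_prod (fun i x => entry (A i) (u i) x * entry (B i) x (v i))).
by apply: eq_bigr => i _; rewrite entryM.
Qed.

Lemma prod_bool (b : 'I_n -> bool) : \prod_i (b i)%:R = [forall i, b i]%:R :> C.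
Proof.
case: forallP => [h|/forallP]; first by rewrite big1// => i _; rewrite h.
rewrite negb_forall => /existsP[i bi].
by rewrite (bigD1 i)//= (negbTE bi) mul0r.
Qed.

Lemma eq_dffunb (u v : K) : (u == v) = [forall i, u i == v i].
Proof.
apply/eqP/forallP => [-> i //|h]; apply/ffunP => i; exact/eqP/h.
Qed.

Lemma tens1 : tens (fun=> 1%:M) = 1%:M.
Proof.
apply: op_ext => u v; rewrite entry_mkop entry1 eq_dffunb -prod_bool.
by apply: eq_bigr => i _; rewrite entry1.
Qed.

Lemma tensT (A : fam) : (tens A)^t* = tens (fun i => (A i)^t*).
Proof.
apply: op_ext => u v; rewrite entry_trmxC !entry_mkop rmorph_prod.
by apply: eq_bigr => i _; rewrite entry_trmxC.
Qed.

Definition at_factor i (B : op R (T i)) : fam :=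
  @eqtype.dfwith _ (fun j => op R (T j)) (fun j => 1%:M) i B.
Definition emb i (B : op R (T i)) : op R K := tens (at_factor B).
Definition others i (A : fam) : fam := fun j => if j == i then 1%:M else A j.

Lemma entry_emb i (B : op R (T i)) u v :
  entry (emb B) u v = [forall j, (j != i) ==> (u j == v j)]%:R * entry B (u i) (v i).
Proof.
rewrite entry_mkop (bigD1 i)//= /at_factor dfwith_in mulrC; congr (_ * _).
rewrite -prod_bool [RHS](bigD1 i)//= eqxx mul1r; apply: eq_bigr => j ji.
have ij : i != j by rewrite eq_sym.
by rewrite (dfwith_out _ _ ij) entry1 ji.
Qed.

Lemma linear_emb i : linear (@emb i).
Proof.
move=> c X Y; apply: op_ext => u v; rewrite entryD entryZ !entry_emb entryD entryZ.
by rewrite mulrDr mulrCA.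
Qed.

Lemma embM i (A B : op R (T i)) : emb (A *m B) = emb A *m emb B.
Proof.
rewrite /emb tensM; apply: tens_ext => j; rewrite /at_factor.
have [<-|ij] := eqVneq i j; first by rewrite !dfwith_in.
by rewrite !dfwith_out// mulmx1.
Qed.

Lemma emb1 i : emb (1%:M : op R (T i)) = 1%:M.
Proof.
rewrite -tens1; apply: tens_ext => j; rewrite /at_factor.
have [<-|ij] := eqVneq i j; first by rewrite !dfwith_in.
by rewrite !dfwith_out.
Qed.

Lemma embT i (B : op R (T i)) : emb (B^t* : op R (T i)) = (emb B)^t*.
Proof.
rewrite /emb tensT; apply: tens_ext => j; rewrite /at_factor.
have [<-|ij] := eqVneq i j; first by rewrite !dfwith_in.
by rewrite !dfwith_out// trmxC1.
Qed.

Lemma emb_comm i j (A : op R (T i)) (B : op R (T j)) : i != j ->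
  emb A *m emb B = emb B *m emb A.
Proof.
move=> ij; rewrite /emb !tensM; apply: tens_ext => l; rewrite /at_factor.
have ji : j != i by rewrite eq_sym.
have [<-|il] := eqVneq i l; first by rewrite (dfwith_out _ B ji) mulmx1 mul1mx.
by rewrite (dfwith_out _ A il) mulmx1 mul1mx.
Qed.

Lemma others_comm i (A : fam) (B : op R (T i)) :
  emb B *m tens (others i A) = tens (others i A) *m emb B.
Proof.
rewrite /emb !tensM; apply: tens_ext => l; rewrite /at_factor /others.
have [->|li] := eqVneq l i; first by rewrite mulmx1 mul1mx.
have il : i != l by rewrite eq_sym.
by rewrite (dfwith_out _ _ il) mulmx1 mul1mx.
Qed.

Lemma tens_split i (A : fam) : tens A = tens (others i A) *m emb (A i).
Proof.
rewrite /emb tensM; apply: tens_ext => l; rewrite /at_factor /others.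
have [->|li] := eqVneq l i; first by rewrite dfwith_in mul1mx.
have il : i != l by rewrite eq_sym.
by rewrite (dfwith_out _ _ il) mulmx1.
Qed.

Lemma eunit_tens (u v : K) : eunit R u v = tens (fun i => eunit R (u i) (v i)).
Proof.
apply: op_ext => x y; rewrite entry_mkop entry_eunit !eq_dffunb.
transitivity ([forall i, (x i == u i) && (y i == v i)]%:R : C).
  congr (nat_of_bool _)%:R; apply/andP/forallP => [[/forallP h /forallP h'] i|h].
    by rewrite h h'.
  by split; apply/forallP => i; have /andP[] := h i.
by rewrite -prod_bool; apply: eq_bigr => i _; rewrite entry_eunit.
Qed.

(* An operator commuting with every one-factor operator commutes with
   everything: peel off the factors of a matrix unit one at a time. *)
Lemma commutes_factors m (phi : op R K -> 'M[C]_m) (Y : 'M[C]_m) :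
  (forall A B, phi (A *m B) = phi A *m phi B) -> phi 1%:M = 1%:M ->
  (forall i (B : op R (T i)), phi (emb B) *m Y = Y *m phi (emb B)) ->
  forall A : fam, phi (tens A) *m Y = Y *m phi (tens A).
Proof.
move=> phiM phi1 cY A.
pose fam_upto m' : fam := fun j => if (j < m')%N then A j else 1%:M.
have -> : tens A = tens (fam_upto n).
  by apply: tens_ext => i; rewrite /fam_upto ltn_ord.
suff H m' : (m' <= n)%N ->
    phi (tens (fam_upto m')) *m Y = Y *m phi (tens (fam_upto m')) by apply: H.
elim: m' => [_|m' IH mn].
  have -> : tens (fam_upto 0%N) = 1%:M by rewrite -tens1; apply: tens_ext.
  by rewrite phi1 mul1mx mulmx1.
pose i := Ordinal mn.
have -> : tens (fam_upto m'.+1) = tens (fam_upto m') *m emb (A i).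
  rewrite /emb tensM; apply: tens_ext => j; rewrite /at_factor /fam_upto ltnS leq_eqVlt.
  have [<-|ij] := eqVneq i j; first by rewrite dfwith_in eqxx /= ltnn mul1mx.
  rewrite dfwith_out// mulmx1; congr (if _ then _ else _).
  have -> // : (j == m' :> nat) = false.
  by apply: contraNF ij => /eqP ji; apply/eqP/val_inj.
by rewrite phiM -mulmxA cY mulmxA IH ?mulmxA// ltnW.
Qed.

Variable sigma : fam.
Hypothesis psigma : forall i, posdef (sigma i).

Lemma tens_diag (f : forall i, 'I_#|T i| -> C) :
  tens (fun i => diag_mx (\row_j f i j)) =
  diag_mx (\row_(j < #|{: K}|) \prod_i f i (enum_rank ((enum_val j : K) i))).
Proof.
apply: op_ext => u v; rewrite entry_mkop [RHS]mxE !mxE enum_rankK.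
rewrite (inj_eq enum_rank_inj) -mulr_natr eq_dffunb -prod_bool -big_split /=.
apply: eq_bigr => i _; rewrite /entry !mxE (inj_eq enum_rank_inj).
by rewrite -[in LHS]mulr_natr.
Qed.

Lemma ln_prod_sum (f : 'I_n -> R) : (forall i, 0 < f i) ->
  ln (\prod_i f i) = \sum_i ln (f i).
Proof.
move=> f0; suff [] : 0 < \prod_i f i /\ ln (\prod_i f i) = \sum_i ln (f i) by [].
elim/big_ind2 : _ => [|x x' y y' [x0 <-] [y0 <-]|i _]; first by rewrite ln1.
  by rewrite mulr_gt0// lnM.
by split.
Qed.

Lemma expR_ln_prod (f : 'I_n -> R) p : (forall i, 0 < f i) ->
  \prod_i expR (p * ln (f i)) = expR (p * ln (\prod_i f i)).
Proof. by move=> f0; rewrite ln_prod_sum// mulr_sumr expR_sum. Qed.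

(** The product of the unitaries diagonalising the [sigma i] diagonalises at once the product state,
    the product of powers and the sum of logarithms; uniqueness of the calculus then yields
    [epow_tens] and [elog_tens]. *)
Lemma tens_spectral : exists (V : op R K) (e : 'I_#|{: K}| -> R),
  [/\ V \is unitarymx, forall j, 0 < e j,
      tens sigma = V^t* *m diag_mx (\row_j (e j)%:C) *m V,
      forall p, tens (fun i => epow (sigma i) p) =
        V^t* *m diag_mx (\row_j (expR (p * ln (e j)))%:C) *m V &
      \sum_i emb (elog (sigma i)) = V^t* *m diag_mx (\row_j (ln (e j))%:C) *m V].
Proof.
pose U i := projT1 (cid (posdef_spectral (psigma i))).
pose d i := projT1 (cid (projT2 (cid (posdef_spectral (psigma i))))).
have P i : [/\ U i \is unitarymx, forall j, 0 < d i j,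
      forall g, mfunC g (sigma i) = (U i)^t* *m diag_mx (\row_j g (d i j)) *m U i &
      sigma i = (U i)^t* *m diag_mx (\row_j (d i j)%:C) *m U i] :=
  projT2 (cid (projT2 (cid (posdef_spectral (psigma i))))).
pose V := tens U; pose e (j : 'I_#|{: K}|) := \prod_i d i (enum_rank ((enum_val j : K) i)).
have d0 i j : 0 < d i j by have [_ ] := P i.
have uV : V \is unitarymx.
  apply/unitaryP; rewrite /V tensT tensM -tens1; apply: tens_ext => i.
  by have [/unitaryVmx] := P i.
have e0 j : 0 < e j by apply: prodr_gt0.
exists V, e; split=> //.
- transitivity (tens (fun i => (U i)^t* *m diag_mx (\row_j (d i j)%:C) *m U i)).
    by apply: tens_ext => i; have [] := P i.
  rewrite -tensM -tensM -tensT tens_diag -/V.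
  suff -> : \row_(j < #|{: K}|) \prod_i (d i (enum_rank ((enum_val j : K) i)))%:C =
    \row_j (e j)%:C by [].
  by apply/rowP => j; rewrite !mxE rmorph_prod.
- move=> p; transitivity (tens (fun i =>
      (U i)^t* *m diag_mx (\row_j (expR (p * ln (d i j)))%:C) *m U i)).
    by apply: tens_ext => i; have [_ _ h _] := P i; rewrite /epow h.
  rewrite -tensM -tensM -tensT tens_diag -/V.
  suff -> : \row_(j < #|{: K}|) \prod_i
      (expR (p * ln (d i (enum_rank ((enum_val j : K) i)))))%:C =
    \row_j (expR (p * ln (e j)))%:C by [].
  apply/rowP => j; rewrite !mxE -rmorph_prod; congr (_%:C).
  have := @expR_ln_prod (fun i => d i (enum_rank ((enum_val j : K) i))) p (fun i => d0 _ _).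
  by move=> ->.
have E i : emb (elog (sigma i)) =
    V^t* *m tens (at_factor (diag_mx (\row_j (ln (d i j))%:C))) *m V.
  rewrite /V tensT !tensM; apply: tens_ext => l; rewrite /at_factor.
  have [<-|il] := eqVneq i l.
    by rewrite !dfwith_in; have [_ _ h _] := P i; rewrite /elog h.
  rewrite !(dfwith_out _ _ il) mulmx1.
  by have [/unitaryVmx ->] := P l.
under eq_bigr => i _ do rewrite E.
rewrite -mulmx_suml -mulmx_sumr; suff -> : \sum_i tens (at_factor
    (diag_mx (\row_j (ln (d i j))%:C))) = diag_mx (\row_j (ln (e j))%:C) by [].
apply: op_ext => u v; rewrite entry_sum.
have -> : entry (diag_mx (\row_j (ln (e j))%:C) : op R K) u v =
    (u == v)%:R * \sum_i (ln (d i (enum_rank (u i))))%:C.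
  rewrite /entry !mxE (inj_eq enum_rank_inj) -[LHS]mulr_natl; congr (_ * _).
  rewrite -rmorph_sum; congr (_%:C); rewrite /e enum_rankK.
  exact: (@ln_prod_sum (fun i => d i (enum_rank (u i))) (fun i => d0 _ _)).
rewrite mulr_sumr; apply: eq_bigr => i _; rewrite entry_emb.
rewrite /entry !mxE (inj_eq enum_rank_inj) -[X in _ * X = _]mulr_natl mulrA -natrM mulnb.
congr ((nat_of_bool _)%:R * _); rewrite eq_dffunb; apply/andP/forallP => [[/forallP h h'] j|h].
  by have [->//|ji] := eqVneq j i; have := h j; rewrite ji.
by split=> //; apply/forallP => j; apply/implyP.
Qed.

Lemma posdef_tens : posdef (tens sigma).
Proof.
have [V [e [uV e0 -> _ _]]] := tens_spectral.
exact: posdef_diag_conj (unitarymx_unit uV) e0.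
Qed.

Lemma epow_tens p : epow (tens sigma) p = tens (fun i => epow (sigma i) p).
Proof.
by have [V [e [uV e0 h -> _]]] := tens_spectral; rewrite /epow (mfunC_unique _ uV h).
Qed.

Lemma elog_tens : elog (tens sigma) = \sum_i emb (elog (sigma i)).
Proof.
by have [V [e [uV e0 h _ ->]]] := tens_spectral; rewrite /elog (mfunC_unique _ uV h).
Qed.

End Tensor.

(** * Partial traces and reindexing *)

Section ScalarBlocks.
Variables (R : realType) (T : finType) (k : nat).
Local Notation C := R[i].
Local Notation K2 := ('I_k * T)%type.
Local Notation ampl := (@ampl R T k).

Lemma eunitM (a b c d : T) : eunit R a b *m eunit R c d = (b == c)%:R *: eunit R a d.
Proof.
rewrite /eunit mul_delta_mx_cond (inj_eq enum_rank_inj).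
by case: (b == c); rewrite ?mulr1n ?mulr0n ?scale1r ?scale0r.
Qed.

Lemma eunitT (a b : T) : (eunit R a b)^t* = eunit R b a.
Proof.
by apply: op_ext => x y; rewrite entry_trmxC !entry_eunit rmorph_nat andbC.
Qed.

Lemma sum_eunit : \sum_(a : T) eunit R a a = 1%:M.
Proof.
apply: op_ext => x y; rewrite entry_sum entry1 (bigD1 x)//= entry_eunit eqxx /=.
rewrite big1 ?addr0 => [|z zx]; first by rewrite eq_sym.
by rewrite entry_eunit eq_sym (negbTE zx).
Qed.

Lemma eunit_conj (B : op R T) x y : eunit R x y *m B *m eunit R y x = entry B y y *: eunit R x x.
Proof.
rewrite {1}[B]op_expand pair_bigA /= mulmx_sumr mulmx_suml (bigD1 (y, y))//=.
rewrite [X in _ + X]big1 ?addr0 => [|[u v] uv /=].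
  by rewrite -scalemxAr -scalemxAl !eunitM eqxx scale1r eunitM eqxx scale1r.
rewrite -scalemxAr -scalemxAl eunitM -scalemxAl eunitM.
have [yu|_] := eqVneq y u; last by rewrite scale0r scaler0.
have [vy|_] := eqVneq v y; last by rewrite scale0r !scaler0.
by move: uv; rewrite -yu vy eqxx.
Qed.

Lemma blockZ c (X : op R K2) a b : block (c *: X) a b = c *: block X a b.
Proof. by apply: op_ext => u v; rewrite entryZ !entry_mkop entryZ. Qed.

Lemma block_sum (I : Type) (r : seq I) (X : I -> op R K2) a b :
  block (\sum_(p <- r) X p) a b = \sum_(p <- r) block (X p) a b.
Proof.
apply: op_ext => u v; rewrite entry_mkop !entry_sum.
by apply: eq_bigr => p _; rewrite entry_mkop.
Qed.

Lemma block_ptrace (X : op R K2) a b : block (ptrace X) a b = \tr (block X a b) *: 1%:M.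
Proof.
apply: op_ext => u v; rewrite entryZ entry1 !entry_mkop /= mulrC; congr (_ * _).
by rewrite tr_entry; apply: eq_bigr => x _; rewrite entry_mkop.
Qed.

Lemma ptrace_units (X : op R K2) :
  ptrace X = \sum_(p : T * T) ampl (eunit R p.1 p.2) *m X *m ampl (eunit R p.2 p.1).
Proof.
apply: block_inj => a b; rewrite block_ptrace block_sum.
under eq_bigr => p _ do rewrite block_ampl_mulr block_ampl_mull eunit_conj.
rewrite -(pair_bigA _ (fun x y => entry (block X a b) y y *: eunit R x x)) /=.
rewrite -sum_eunit scaler_sumr; apply: eq_bigr => x _.
by rewrite tr_entry scaler_suml.
Qed.

(** Membership in B(C^k) tensored with the identity, phrased as a commutant because commutation is
    what can be checked for tensor products. *)
Definition scalar_blocks (Y : op R K2) := forall u v : T,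
  ampl (eunit R u v) *m Y = Y *m ampl (eunit R u v).

Lemma ptrace_scalar_blocks Y : scalar_blocks Y -> ptrace Y = #|T|%:R *: Y.
Proof.
move=> cY; rewrite ptrace_units.
transitivity (\sum_(x : T) \sum_(y : T) Y *m ampl (eunit R x x)).
  rewrite pair_bigA /=; apply: eq_bigr => -[x y] _ /=.
  by rewrite cY -mulmxA -amplM eunitM eqxx scale1r.
under eq_bigr => x _ do rewrite sumr_const.
rewrite sumrMnl -mulmx_sumr.
have -> : \sum_(x : T) ampl (eunit R x x) = 1%:M.
  rewrite -ampl1 -sum_eunit.
  have := linear_sumZ (index_enum T) (fun=> 1) (fun x => eunit R x x) (@linear_ampl R T k).
  by under eq_bigr do rewrite scale1r; under [RHS]eq_bigr do rewrite scale1r.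
by rewrite mulmx1 scaler_nat.
Qed.

Lemma scalar_blockE Y a b : (0 < #|T|)%N -> scalar_blocks Y ->
  block Y a b = (#|T|%:R^-1 * \tr (block Y a b)) *: 1%:M.
Proof.
move=> T0 /ptrace_scalar_blocks /(congr1 (fun Z => block Z a b)).
rewrite block_ptrace blockZ => h.
by rewrite -scalerA h scalerA mulVf ?scale1r// pnatr_eq0 -lt0n.
Qed.

(** Each block of [Y] is a number times the identity, and such numbers pass through [Phi] by
    linearity. *)
Lemma amp_mull (Phi : op R T -> op R T) (Y X : op R K2) : (0 < #|T|)%N -> linear Phi ->
  scalar_blocks Y -> amp Phi (Y *m X) = Y *m amp Phi X.
Proof.
move=> T0 lPhi cY; apply: block_inj => a b; rewrite (block_amp _ _ _ lPhi) !block_mul.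
have E Z c : block Y a c *m Z = (#|T|%:R^-1 * \tr (block Y a c)) *: Z.
  by rewrite {1}(scalar_blockE _ _ T0 cY) -scalemxAl mul1mx.
under eq_bigr => c _ do rewrite E.
rewrite (linear_sumZ _ _ _ lPhi); apply: eq_bigr => c _.
by rewrite E (block_amp _ _ _ lPhi).
Qed.

Lemma amp_mulr (Phi : op R T -> op R T) (Y X : op R K2) : (0 < #|T|)%N -> linear Phi ->
  scalar_blocks Y -> amp Phi (X *m Y) = amp Phi X *m Y.
Proof.
move=> T0 lPhi cY; apply: block_inj => a b; rewrite (block_amp _ _ _ lPhi) !block_mul.
have E Z c : Z *m block Y c b = (#|T|%:R^-1 * \tr (block Y c b)) *: Z.
  by rewrite {1}(scalar_blockE _ _ T0 cY) -scalemxAr mulmx1.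
under eq_bigr => c _ do rewrite E.
rewrite (linear_sumZ _ _ _ lPhi); apply: eq_bigr => c _.
by rewrite E (block_amp _ _ _ lPhi).
Qed.

Lemma scalar_blocks_ampl Y B : scalar_blocks Y -> ampl B *m Y = Y *m ampl B.
Proof.
move=> cY; rewrite (linear_op B (@linear_ampl R T k)) mulmx_suml mulmx_sumr.
apply: eq_bigr => u _; rewrite mulmx_suml mulmx_sumr; apply: eq_bigr => v _.
by rewrite -scalemxAl -scalemxAr cY.
Qed.

(* Stationarity: the generator is invisible to [sigma] tensored with anything. *)
Lemma tr_tauk_amp0 (sigma : op R T) (L : op R T -> op R T) (Y X : op R K2) :
  (0 < #|T|)%N -> linear L -> (forall Z, \tr (sigma *m L Z) = 0) -> scalar_blocks Y ->
  \tr (tauk sigma k *m amp L X *m Y) = 0.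
Proof.
move=> T0 lL inv cY; rewrite -mulmxA -(amp_mulr _ T0 lL cY) tr_tauk_block big1 ?mulr0//.
by move=> a _; rewrite (block_amp _ _ _ lL) inv.
Qed.

End ScalarBlocks.

(** * Relabelling of the basis *)

Section Reindexing.
Variables (R : realType) (S K : finType) (phi : S -> K).
Hypothesis bij : bijective phi.
Local Notation C := R[i].

Definition reop (X : op R K) : op R S := mkop (fun x y => entry X (phi x) (phi y)).

Lemma linear_reop : linear reop.
Proof. by move=> c X Y; apply: op_ext => x y; rewrite entryD entryZ !entry_mkop entryD entryZ. Qed.

Lemma reopM X Y : reop (X *m Y) = reop X *m reop Y.
Proof.
apply: op_ext => x y; rewrite entryM !entry_mkop entryM (reindex phi) /=.
  by apply: eq_bigr => z _; rewrite !entry_mkop.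
exact: onW_bij.
Qed.

Lemma reop1 : reop 1%:M = 1%:M.
Proof. by apply: op_ext => x y; rewrite entry_mkop !entry1 (inj_eq (bij_inj bij)). Qed.

Lemma reopT (X : op R K) : reop (X^t* : op R K) = (reop X)^t*.
Proof. by apply: op_ext => x y; rewrite entry_trmxC !entry_mkop entry_trmxC. Qed.

Lemma tr_reop X : \tr (reop X) = \tr X.
Proof.
rewrite !tr_entry [RHS](reindex phi) /=; last exact: onW_bij.
by apply: eq_bigr => x _; rewrite entry_mkop.
Qed.

Lemma posdef_reop X : posdef X -> posdef (reop X).
Proof. by move=> pX; apply: posdef_morph pX; [exact: reopM|exact: reop1|exact: reopT]. Qed.

Lemma mfunC_reop g X : posdef X -> mfunC g (reop X) = reop (mfunC g X).
Proof.
move=> pX; apply/esym/mfunC_morph; first exact: linear_reop; first exact: reopM.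
- exact: reop1.
- exact: (proj1 pX).
exact: (proj1 (posdef_reop pX)).
Qed.

End Reindexing.

(** * Singling out one tensor factor *)

Section Factor.
Variables (R : realType) (n : nat) (T : 'I_n -> finType) (k : nat) (t0 : TensT T) (i : 'I_n).
Local Notation C := R[i].
Local Notation K := ('I_k * TensT T)%type.

Definition set_coord (u : TensT T) (x : T i) : TensT T :=
  [ffun j => @eqtype.dfwith _ (fun j => T j) u i x j].

Lemma set_coord_in u x : set_coord u x i = x.
Proof. by rewrite ffunE dfwith_in. Qed.

Lemma set_coord_out u x j : j != i -> set_coord u x j = u j.
Proof. by move=> ji; rewrite ffunE dfwith_out// eq_sym. Qed.

Lemma set_coord_set u x y : set_coord (set_coord u x) y = set_coord u y.
Proof.
apply/ffunP => j; have [->|ji] := eqVneq j i; first by rewrite !set_coord_in.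
by rewrite !set_coord_out.
Qed.

Lemma set_coord_id u : set_coord u (u i) = u.
Proof.
by apply/ffunP => j; have [->|ji] := eqVneq j i; rewrite ?set_coord_in ?set_coord_out.
Qed.

(** Labels of the auxiliary space for factor [i]: the basis labels whose i-th coordinate is frozen
    at the base point [t0 i]. A subtype of the full label set avoids a product over the indices
    other than [i]. *)
Definition other_coords := {a : K | a.2 i == t0 i}.
Definition n_other_coords := #|{: other_coords}|.

Definition join_factor (p : 'I_n_other_coords * T i) : K :=
  ((val (enum_val p.1 : other_coords)).1, set_coord (val (enum_val p.1 : other_coords)).2 p.2).

Lemma join_factor_bij : bijective join_factor.
Proof.
pose a0 (a : K) : K := (a.1, set_coord a.2 (t0 i)).
have a0P a : (a0 a).2 i == t0 i by rewrite /= set_coord_in.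
pose g (a : K) : 'I_n_other_coords * T i := (enum_rank (exist _ (a0 a) (a0P a) : other_coords), a.2 i).
exists g => [[c x]|a]; rewrite /g /join_factor /=; last first.
  by rewrite enum_rankK /= set_coord_set set_coord_id; case: a.
congr (_, _); last by rewrite set_coord_in.
rewrite -[RHS]enum_valK; congr enum_rank; apply: val_inj; rewrite /= /a0 /= set_coord_set.
case: (enum_val c) => -[a u] /= /eqP <-.
by rewrite set_coord_id.
Qed.

Lemma n_other_coords_gt0 : (0 < k)%N -> (0 < n_other_coords)%N.
Proof.
move=> k0; apply/card_gt0P.
by exists (exist _ ((Ordinal k0, t0) : K) (eqxx (t0 i)) : other_coords).
Qed.

Local Notation r := (@reop R _ _ join_factor).

Lemma reop_emb (B : op R (T i)) : r (ampl k (emb B)) = ampl n_other_coords B.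
Proof.
apply: op_ext => -[c x] [d y]; rewrite [RHS]entry_mkop [LHS]entry_mkop [LHS]entry_mkop /= entry_emb !set_coord_in mulrA.
congr (_ * _); rewrite -natrM mulnb; congr (nat_of_bool _)%:R.
apply/andP/eqP => [[/eqP e1 /forallP e2]|->]; last first.
  split=> //; apply/forallP => j; apply/implyP => ji; by rewrite !set_coord_out.
apply: (can_inj (@enum_valK other_coords)); apply: val_inj.
case: (enum_val c) (enum_val d) e1 e2 => -[a u] /= hu [[b v] /= hv] <- e2.
congr (_, _); apply/ffunP => j; have [->|ji] := eqVneq j i.
  by rewrite (eqP hu) (eqP hv).
by have := e2 j; rewrite ji !set_coord_out// => /eqP.
Qed.

Lemma linear_embed (Phi : op R (T i) -> op R (T i)) : linear (embed Phi).
Proof.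
move=> c X Y; apply: op_ext => u v; rewrite entryD entryZ !entry_mkop.
rewrite mulr_sumr -big_split; apply: eq_bigr => x _.
rewrite mulr_sumr -big_split; apply: eq_bigr => y _ /=.
by case: ifP => _; rewrite ?mulr0 ?addr0// entryD entryZ mulrDl mulrA.
Qed.

Lemma sum_off (u : TensT T) (f : TensT T -> C) :
  \sum_(x : TensT T) (if [forall j, (j != i) ==> (x j == u j)] then f x else 0) =
  \sum_(w : T i) f (set_coord u w).
Proof.
rewrite -big_mkcond /= (reindex_onto (set_coord u) (fun x => x i)) /=.
  apply: eq_bigl => w; rewrite set_coord_in eqxx andbT; apply/forallP => j.
  by apply/implyP => ji; rewrite set_coord_out.
move=> x /forallP h; apply/ffunP => j; have [->|ji] := eqVneq j i; first by rewrite set_coord_in.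
by rewrite set_coord_out//; have := h j; rewrite ji eq_sym => /eqP.
Qed.

(** After relabelling, the i-th summand of the generator is the ampliation of the one-factor map,
    the situation of the hypothesis on that factor. *)
Lemma reop_amp_embed (Phi : op R (T i) -> op R (T i)) X :
  r (amp (embed Phi) X) = amp Phi (r X).
Proof.
apply: op_ext => -[c x] [d y]; rewrite entry_mkop (entry_amp _ _ _ (linear_embed Phi)).
rewrite !entry_mkop /join_factor /= !set_coord_in.
set u := (val (enum_val c)); set v := (val (enum_val d)).
(* [embed] constrains rows and columns jointly; separated into two nested conditions, each sum
   reduces to the i-th coordinate by [sum_off]. *)
transitivity (\sum_(z : TensT T) (if [forall j, (j != i) ==> (z j == set_coord u.2 x j)] then
  (\sum_(z' : TensT T) (if [forall j, (j != i) ==> (z' j == set_coord v.2 y j)] then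
     entry X (u.1, z) (v.1, z') * entry (Phi (eunit R (z i) (z' i))) x y else 0)) else 0)).
  apply: eq_bigr => z _; case: ifPn => [/forallP h|h].
    apply: eq_bigr => z' _; rewrite entry_mkop; congr (if _ then _ else _).
    apply: eq_forallb => j; have := h j; case: (j != i) => //= /eqP ->.
    by rewrite eqxx.
  rewrite big1// => z' _; rewrite ifN//; apply: contra h => /forallP h.
  by apply/forallP => j; have := h j; case: (j != i) => //= /andP[].
rewrite (sum_off _ (fun z => \sum_(z' : TensT T) (if [forall j, (j != i) ==> (z' j == set_coord v.2 y j)] then
     entry X (u.1, z) (v.1, z') * entry (Phi (eunit R (z i) (z' i))) x y else 0))).
apply: eq_bigr => w _; rewrite set_coord_set.
rewrite (sum_off _ (fun z' => entry X (u.1, set_coord u.2 w) (v.1, z') *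
   entry (Phi (eunit R ((set_coord u.2 w) i) (z' i))) x y)).
by apply: eq_bigr => w' _; rewrite set_coord_set !set_coord_in entry_mkop.
Qed.

End Factor.

(** * Tensorization *)

Lemma linear_sum (R : realType) m n p q (P : 'M[R[i]]_(m, n) -> 'M[R[i]]_(p, q))
    (I : finType) (X : I -> 'M[R[i]]_(m, n)) : linear P ->
  P (\sum_i X i) = \sum_i P (X i).
Proof.
move=> lP; have := linear_sumZ (index_enum I) (fun=> 1) X lP.
by under eq_bigr do rewrite scale1r; under [RHS]eq_bigr do rewrite scale1r.
Qed.

Lemma Re_tr_sum (R : realType) m (I : finType) (A : I -> 'M[R[i]]_m) :
  complex.Re (\tr (\sum_i A i)) = \sum_i complex.Re (\tr (A i)).
Proof.
elim/big_rec2: _ => [|i x B _ <-]; first by rewrite mxtrace0.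
by rewrite mxtraceD; case: (\tr (A i)) (\tr B) => a b [].
Qed.

Section Entropy.
Variables (R : realType) (T : finType) (sigma : op R T) (k : nat).
Hypotheses (psigma : posdef sigma) (k0 : (0 < k)%N).
Local Notation K2 := ('I_k * T)%type.

(** The dimension k cancels: -ln(1/k) from tau and -ln(k d) from the marginal leave -ln d. What
    remains is a relative entropy, an energy and a dimension constant, and the last two are additive
    over tensor factors. *)
Lemma entropy_split (rho A : op R K2) (d : nat) : posdef A -> (0 < d)%N ->
  ptrace rho = d%:R *: A ->
  complex.Re (\tr (rho *m (elog rho - elog (tauk sigma k) - elog (k%:R *: ptrace rho)))) =
  complex.Re (\tr (rho *m (elog rho - elog A))) -
  complex.Re (\tr (rho *m ampl k (elog sigma))) - ln d%:R * complex.Re (\tr rho).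
Proof.
move=> pA d0 ->; rewrite scalerA.
have kd : (0 : R) < k%:R * d%:R by rewrite mulr_gt0 ?ltr0n.
have -> : k%:R * d%:R = (k%:R * d%:R : R)%:C :> R[i] by rewrite rmorphM !rmorph_nat.
rewrite (elog_scale kd pA) (elog_tauk psigma k0).
set l := elog rho; set a := elog A; set b := ampl k _.
have -> : l - ((ln k%:R^-1)%:C%:M + b) - ((ln (k%:R * d%:R))%:C%:M + a) =
    (l - a) - b - (ln d%:R)%:C%:M.
  have -> : ln d%:R = ln k%:R^-1 + ln (k%:R * d%:R) :> R.
    rewrite -lnM ?posrE ?invr_gt0 ?ltr0n// mulrA mulVf ?mul1r// pnatr_eq0.
    by rewrite -lt0n.
  have Z (V : zmodType) (x y z u v : V) : x - (u + z) - (v + y) = x - y - z - (u + v).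
    rewrite !opprD !addrA [LHS]addrAC; congr (_ - _).
    by rewrite [x - u - z]addrAC [LHS]addrAC; congr (_ - _); rewrite addrAC.
  have -> (x y : R) : (x + y)%:C%:M = x%:C%:M + y%:C%:M :> op R K2.
    by rewrite rmorphD /= raddfD.
  exact: Z.
rewrite mulmxBr mulmxBr 2!raddfB /= 2!raddfB /=; congr (_ - _ - _).
rewrite mul_mx_scalar mxtraceZ; move: (\tr rho) => [x y] /=.
by rewrite mul0r subr0.
Qed.

End Entropy.

Lemma schatten_reop (R : realType) (S K : finType) (phi : S -> K) p (Z : op R K) :
  bijective phi -> posdef Z -> schatten p (reop phi Z) = schatten p Z.
Proof.
move=> bij pZ; have prZ := posdef_reop bij pZ.
rewrite /schatten (mabs_posdef prZ) (mabs_posdef pZ) (mpowE _ prZ) (mpowE _ pZ).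
by rewrite /epow (mfunC_reop bij _ pZ) (tr_reop bij).
Qed.

(** * Observables of the factors and additivity *)

Section TensorSystem.
Variables (R : realType) (n : nat) (T : 'I_n -> finType).
Variable sigma : forall i : 'I_n, op R (T i).
Hypotheses (psigma : forall i, posdef (sigma i)) (T_gt0 : forall i, (0 < #|T i|)%N).
Variable k : nat.
Hypothesis k0 : (0 < k)%N.
Local Notation C := R[i].
Local Notation K := ('I_k * TensT T)%type.
Local Notation st := (tens_state sigma).
Local Notation tau := (tauk st k).

Let t0 : TensT T := [ffun i => enum_val (Ordinal (T_gt0 i))].

Let N0 : (0 < #|{: TensT T}|)%N. Proof. by apply/card_gt0P; exists t0. Qed.

Let K0 : (0 < #|{: K}|)%N.
Proof. by apply/card_gt0P; exists (Ordinal k0, t0). Qed.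

Definition munit i (a b : T i) : 'M[C]_#|{: K}| := ampl k (emb (eunit R a b)).

Lemma munit_adj i (a b : T i) : (munit a b)^t* = munit b a.
Proof. by rewrite /munit -amplT -embT eunitT. Qed.

Lemma munitM i (a b c d : T i) : munit a b *m munit c d = (b == c)%:R *: munit a d.
Proof.
rewrite /munit -amplM -embM eunitM (linear_scale _ _ (@linear_emb R n T i)).
exact: linear_scale (@linear_ampl R _ k).
Qed.

Lemma munit_sum i : \sum_(a : T i) munit a a = 1%:M.
Proof.
rewrite /munit -(linear_sum _ (@linear_ampl R _ k)) -(linear_sum _ (@linear_emb R n T i)).
by rewrite sum_eunit emb1 ampl1.
Qed.

Lemma munit_comm i j (a b : T i) (c d : T j) : i != j ->
  munit a b *m munit c d = munit c d *m munit a b.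
Proof. by move=> ij; rewrite /munit -!amplM (emb_comm _ _ ij). Qed.

Local Notation pe := (@pexp R _ _ T munit).
Local Notation pes := (@pexps R _ _ T munit).

Lemma munit_commutes (Y : op R K) i : commutes_with munit i Y ->
  forall B : op R (T i), ampl k (emb B) *m Y = Y *m ampl k (emb B).
Proof.
move=> cY B; have lf : linear (fun B : op R (T i) => ampl k (emb B)).
  by move=> c A A'; rewrite (@linear_emb R n T i) (@linear_ampl R _ k).
rewrite (linear_op B lf) mulmx_suml mulmx_sumr.
apply: eq_bigr => u _; rewrite mulmx_suml mulmx_sumr; apply: eq_bigr => v _.
by rewrite -scalemxAl -scalemxAr; congr (_ *: _); apply: cY.
Qed.

Lemma ptrace_pexp i (X : op R K) : ptrace (pe i X) = ptrace X.
Proof.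
apply: block_inj => a b; rewrite !block_ptrace; congr (_ *: _).
rewrite /pexp blockZ mxtraceZ block_sum raddf_sum /=.
transitivity (#|T i|%:R^-1 * \sum_(x : T i) \sum_(y : T i)
   \tr (block X a b *m emb (eunit R y y))).
  congr (_ * _); rewrite [RHS]pair_bigA /=; apply: eq_bigr => -[x y] _ /=.
  rewrite block_ampl_mulr block_ampl_mull -mulmxA mxtrace_mulC -mulmxA -embM eunitM.
  by rewrite eqxx scale1r.
rewrite sumr_const -raddf_sum /= -mulmx_sumr -(linear_sum _ (@linear_emb R n T i)).
rewrite sum_eunit emb1 mulmx1 -[X in _ * X]mulr_natl mulrA mulVf ?mul1r// pnatr_eq0.
by rewrite -lt0n.
Qed.

(** Averaging over every factor leaves an operator that is trivial on the whole tensor product, and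
    on such operators the partial trace is multiplication by the dimension. *)
Lemma ptrace_pexps (rho : op R K) :
  ptrace rho = #|{: TensT T}|%:R *: pes (enum 'I_n) rho.
Proof.
have <- : ptrace (pes (enum 'I_n) rho) = ptrace rho.
  by elim: (enum _) => //= i s IH; rewrite ptrace_pexp.
apply: ptrace_scalar_blocks => u v; rewrite eunit_tens.
apply: (commutes_factors (@amplM R _ k) (@ampl1 R _ k)) => i B.
apply: munit_commutes; apply: pexps_commutes => //; last by rewrite mem_enum.
- exact: munitM.
- exact: munit_comm.
Qed.

Section Factor.
Variable i : 'I_n.
Local Notation phi := (@join_factor n T k t0 i).
Local Notation r := (reop phi).
Local Notation k' := (n_other_coords k t0 i).
Local Notation tau' := (tauk (sigma i) k').

Let bij : bijective phi := @join_factor_bij n T k t0 i.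
Let k'0 : (0 < k')%N := @n_other_coords_gt0 n T k t0 i k0.
Let kV : (0 : R) < k'%:R^-1. Proof. by rewrite invr_gt0 ltr0n. Qed.
Lemma reop_pexp (X : op R K) : ptrace (r X) = #|T i|%:R *: r (pe i X).
Proof.
rewrite /pexp (linear_scale _ _ (linear_reop phi)) scalerA mulfV ?pnatr_eq0 -?lt0n//.
rewrite scale1r (linear_sum _ (linear_reop phi)) ptrace_units; apply: eq_bigr => p _.
by rewrite !(reopM bij) !reop_emb.
Qed.

Lemma posdef_emb (B : op R (T i)) : posdef B -> posdef (emb B).
Proof. by move=> pB; apply: posdef_morph pB; [exact: embM|exact: emb1|exact: embT]. Qed.

Lemma mfunC_emb g (B : op R (T i)) : posdef B -> mfunC g (emb B) = emb (mfunC g B).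
Proof.
move=> pB; apply/esym/mfunC_morph; first exact: linear_emb; first exact: embM.
- exact: emb1.
- exact: (proj1 pB).
exact: (proj1 (posdef_emb pB)).
Qed.

(** The reference state of factor [i], pulled back to the full label set so that it can be
    multiplied with [tau] before relabelling. *)
Definition omega : op R K := (k'%:R^-1)%:C *: ampl k (emb (sigma i)).

Lemma posdef_omega : posdef omega.
Proof. exact: posdefZ kV (posdef_ampl k (posdef_emb (psigma i))). Qed.

Lemma reop_omega : r omega = tau'.
Proof. by rewrite taukE /omega (linear_scale _ _ (linear_reop phi)) reop_emb. Qed.

Lemma epow_tau' p : epow tau' p = r (epow omega p).
Proof. by rewrite -reop_omega /epow (mfunC_reop bij _ posdef_omega). Qed.

Lemma elog_tau' : elog tau' = r (elog omega).
Proof. by rewrite -reop_omega /elog (mfunC_reop bij _ posdef_omega). Qed.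

Lemma epow_omega p : epow omega p =
  (expR (p * ln k'%:R^-1))%:C *: ampl k (emb (epow (sigma i) p)).
Proof.
rewrite /omega (epow_scale _ kV (posdef_ampl k (posdef_emb (psigma i)))).
by rewrite /epow (mfunC_ampl k _ (posdef_emb (psigma i))) (mfunC_emb _ (psigma i)).
Qed.

Lemma elog_omega : elog omega = (ln k'%:R^-1)%:C%:M + ampl k (emb (elog (sigma i))).
Proof.
rewrite /omega (elog_scale kV (posdef_ampl k (posdef_emb (psigma i)))).
by rewrite /elog (mfunC_ampl k _ (posdef_emb (psigma i))) (mfunC_emb _ (psigma i)).
Qed.

Let pst : posdef st := posdef_tens psigma.
Let ptau : posdef tau := posdef_tauk pst k0.

Let other_powers s := tens_state (others i (fun j => epow (sigma j) s)).

Lemma epow_tau p : epow tau p =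
  (expR (p * ln k%:R^-1))%:C *: ampl k (other_powers p *m emb (epow (sigma i) p)).
Proof. by rewrite (epow_tauk pst k0) (epow_tens psigma) (tens_split i). Qed.

(** The ratio of the powers of [tau] and [omega]: the powers of sigma_i cancel, so it acts trivially
    on factor [i], and the order of the two powers does not matter. *)
Definition cofactor s : op R K := epow omega (- s) *m epow tau s.

Lemma cofactorE s : cofactor s =
  ((expR (- s * ln k'%:R^-1))%:C * (expR (s * ln k%:R^-1))%:C) *: ampl k (other_powers s).
Proof.
rewrite /cofactor epow_omega epow_tau -scalemxAl -scalemxAr scalerA -amplM.
by rewrite mulmxA others_comm -mulmxA -embM epowNl emb1 mulmx1.
Qed.

Lemma cofactorEr s : cofactor s = epow tau s *m epow omega (- s).
Proof.
rewrite cofactorE epow_omega epow_tau -scalemxAl -scalemxAr scalerA -amplM.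
by rewrite -mulmxA -embM epowN emb1 mulmx1 mulrC.
Qed.

Lemma scalar_blocks_reop (Y : op R K) :
  (forall B : op R (T i), ampl k (emb B) *m Y = Y *m ampl k (emb B)) ->
  scalar_blocks (r Y).
Proof. by move=> cY u v; rewrite -(reop_emb k t0) -!(reopM bij) cY. Qed.

Lemma cofactor_scalar s : scalar_blocks (r (cofactor s)).
Proof.
apply: scalar_blocks_reop => B; rewrite cofactorE -scalemxAr -scalemxAl -!amplM.
by rewrite others_comm.
Qed.

Variables (q : R) (X : op R K).
Hypothesis pX : posdef X.
Let s := q^-1 / 2.
Let Z := gamma_map st q^-1 X.
Let pZ : posdef Z := posdef_gam st q^-1 pX.

(** The observable of the factor, obtained by undoing Gamma^(1/q) with [tau'] instead of [tau]; by
    [local_obsE] it is [X] between two cofactors. *)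
Definition local_obs : op R ('I_k' * T i)%type := epow tau' (- s) *m r Z *m epow tau' (- s).

Lemma posdef_local_obs : posdef local_obs.
Proof.
rewrite /local_obs -{1}(trmxC_epow tau' (- s)).
exact: posdef_conj (posdef_reop bij pZ) (epow_unit _ _).
Qed.

Lemma gam_local_obs : gamma_map (sigma i) q^-1 local_obs = r Z.
Proof.
rewrite /gamma_map /local_obs -/s.
transitivity ((epow tau' s *m epow tau' (- s)) *m r Z *m (epow tau' (- s) *m epow tau' s)).
  by rewrite !mulmxA.
by rewrite epowN epowNl mul1mx mulmx1.
Qed.

Lemma local_obsE : local_obs = r (cofactor s) *m r X *m r (cofactor s).
Proof.
rewrite /local_obs epow_tau' -!(reopM bij) {2}cofactorEr /cofactor /Z /gamma_map -/s.
by rewrite !mulmxA.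
Qed.

(** The cofactors leave the ampliation because their blocks are scalar, and then join omega^s to
    restore tau^s on both sides. *)
Lemma gam_amp_local_obs (L : op R (T i) -> op R (T i)) : linear L ->
  gamma_map (sigma i) q^-1 (amp L local_obs) = r (gamma_map st q^-1 (amp (embed L) X)).
Proof.
move=> lL; rewrite local_obsE (amp_mulr _ (T_gt0 i) lL (cofactor_scalar s)).
rewrite (amp_mull _ (T_gt0 i) lL (cofactor_scalar s)) -reop_amp_embed.
rewrite /gamma_map -/s epow_tau' -!(reopM bij); congr (r _).
rewrite {2}cofactorEr /cofactor; set Y := amp _ X.
transitivity ((epow omega s *m epow omega (- s)) *m epow tau s *m Y *m epow tau s *m
   (epow omega (- s) *m epow omega s)); first by rewrite !mulmxA.
by rewrite epowN epowNl mul1mx mulmx1.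
Qed.

Let rho := epow Z q.

Lemma entp_local_obs : entp (sigma i) q local_obs = q^-1 *
  (complex.Re (\tr (rho *m (elog rho - elog (pe i rho)))) -
   complex.Re (\tr (rho *m ampl k (emb (elog (sigma i))))) -
   ln #|T i|%:R * complex.Re (\tr rho)).
Proof.
have prho : posdef rho := posdef_epow _ pZ.
have ppe : posdef (pe i rho) by apply: posdef_pexp prho; [exact: munit_adj|exact: munitM|exact: munit_sum|exact: T_gt0].
rewrite (entpE (psigma i) k'0 _ posdef_local_obs) gam_local_obs; congr (_ * _).
have rE : epow (r Z) q = r rho by rewrite /rho /epow (mfunC_reop bij _ pZ).
rewrite rE (entropy_split (psigma i) k'0 (posdef_reop bij ppe) (T_gt0 i) (reop_pexp rho)).
rewrite (tr_reop bij) -(reop_emb k t0) -(reopM bij) (tr_reop bij).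
have -> : elog (r rho) - elog (r (pe i rho)) = r (elog rho - elog (pe i rho)).
  rewrite /elog !(mfunC_reop bij)//; apply: op_ext => x y.
  by rewrite entryB !entry_mkop entryB.
by rewrite -(reopM bij) (tr_reop bij).
Qed.

Lemma normtau_local_obs : normtau (sigma i) q local_obs = normtau st q X.
Proof.
rewrite /normtau (Gam_gamma_map (psigma i) k'0) (Gam_gamma_map pst k0) gam_local_obs.
exact: schatten_reop.
Qed.

(** For q > 1 the form depends only on quantities already transported. For q = 1 the logarithms of
    the two reference states differ, and stationarity of sigma_i absorbs the difference. *)
Lemma dirichlet_local_obs L : linear L -> (forall Y, \tr (sigma i *m L Y) = 0) -> 1 <= q ->
  dirichlet L (sigma i) q local_obs = dirichlet (embed L) st q X.
Proof.
move=> lL inv; rewrite le_eqVlt => /orP[/eqP q1|q1]; last first.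
  rewrite (dirichletE (psigma i) k'0 _ q1 posdef_local_obs) (dirichletE pst k0 _ q1 pX).
  rewrite gam_local_obs (gam_amp_local_obs lL) -/Z.
  have -> : epow (r Z) (q - 1) = r (epow Z (q - 1)) by rewrite /epow (mfunC_reop bij _ pZ).
  by rewrite -(reopM bij) (tr_reop bij).
have q1V : 1 = q^-1 by rewrite -q1 invr1.
rewrite -q1 (dirichletE1 (psigma i) k'0) (dirichletE1 pst k0); congr (_ * complex.Re _).
rewrite q1V gam_local_obs (gam_amp_local_obs lL) -/Z elog_tau'.
have -> : elog (r Z) = r (elog Z) by rewrite /elog (mfunC_reop bij _ pZ).
(* The difference of the two logarithms contains no sigma_i: the terms for factor [i] cancel, so it
   commutes with everything on that factor. *)
pose H := elog tau - elog omega.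
have cH (B : op R (T i)) : ampl k (emb B) *m H = H *m ampl k (emb B).
  rewrite /H (elog_tauk pst k0) (elog_tens psigma) elog_omega.
  rewrite (linear_sum _ (@linear_ampl R _ k)) (bigD1 i)//=.
  set u := (_%:M); set v := (_%:M); set w := ampl k (emb (elog _)).
  have -> (S : op R K) : u + (w + S) - (v + w) = (u - v) + S.
    by rewrite [w + S]addrC addrA [v + w]addrC opprD addrA addrK addrAC.
  rewrite mulmxDr mulmxDl; congr (_ + _).
    by rewrite /u /v -raddfB /= scalar_mxC.
  rewrite mulmx_sumr mulmx_suml; apply: eq_bigr => j ji.
  by rewrite -!amplM (emb_comm _ _ ji).
set G := gamma_map st _ _.
(* Replacing one logarithm by the other costs only this term; as [r H] has scalar blocks,
   stationarity makes it vanish. *)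
suff h : \tr (r G *m r H) = 0.
  have -> : r (elog Z) - r (elog omega) = r (elog Z - elog tau) + r H.
    apply: op_ext => x y; rewrite entryB entryD !entry_mkop !entryB.
    by rewrite addrA subrK.
  by rewrite mulmxDr mxtraceD h addr0 -(reopM bij) (tr_reop bij).
have sH := scalar_blocks_reop cH.
rewrite /G -(gam_amp_local_obs lL) /gamma_map -/s.
set a := epow tau' s; set Y := amp L _.
have aH : a *m r H = r H *m a.
  by rewrite /a (epow_tauk (psigma i) k'0) -scalemxAl -scalemxAr scalar_blocks_ampl.
transitivity (\tr ((a *m Y) *m (a *m r H))); first by rewrite !mulmxA.
rewrite aH mulmxA mxtrace_mulC.
transitivity (\tr ((a *m a) *m Y *m r H)); first by rewrite !mulmxA.
have -> : a *m a = tau'.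
  rewrite /a epowD /s -q1V -mulrDl -mulr2n -[_ *+ 2]mulr_natl mulr1 mulfV ?pnatr_eq0//.
  by rewrite epow1//; apply: posdef_tauk.
exact: tr_tauk_amp0 (T_gt0 i) lL inv sH.
Qed.

End Factor.

Variables (q : R) (X : op R K).
Hypothesis pX : posdef X.
Let Z := gamma_map st q^-1 X.
Let rho := epow Z q.

Lemma entp_tensor : entp st q X = q^-1 *
  (complex.Re (\tr (rho *m (elog rho - elog (pes (enum 'I_n) rho)))) -
   \sum_i complex.Re (\tr (rho *m ampl k (emb (elog (sigma i))))) -
   (\sum_i ln #|T i|%:R) * complex.Re (\tr rho)).
Proof.
have pst := posdef_tens psigma.
have prho : posdef rho := posdef_epow _ (posdef_gam st q^-1 pX).
have ppe : posdef (pes (enum 'I_n) rho).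
  by apply: posdef_pexps prho; [exact: munit_adj|exact: munitM|exact: munit_sum|exact: T_gt0].
rewrite (entpE pst k0 _ pX) -/Z -/rho; congr (_ * _).
rewrite (entropy_split pst k0 ppe N0 (ptrace_pexps rho)); congr (_ - _ - _ * _).
  rewrite (elog_tens psigma) (linear_sum _ (@linear_ampl R _ k)) mulmx_sumr.
  exact: Re_tr_sum.
have d0 i : (0 : R) < #|T i|%:R by rewrite ltr0n.
rewrite -(ln_prod_sum d0).
rewrite -natr_prod; congr (ln _%:R).
by rewrite -(bij_eq_card (@dffun_of_fprod_bij _ T)) card_fprod.
Qed.

(** Energy and dimension terms on both sides coincide, so that only the relative entropies have to
    be compared, by [entropy_chain]. *)
Lemma entp_tensor_le : 0 < q -> entp st q X <= \sum_i entp (sigma i) q (local_obs i q X).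
Proof.
move=> q0; rewrite entp_tensor.
rewrite (eq_bigr _ (fun i _ => entp_local_obs i q pX)).
rewrite -mulr_sumr ler_pM2l ?invr_gt0// !sumrB -mulr_suml lerB// lerB//.
have prho : posdef rho := posdef_epow _ (posdef_gam st q^-1 pX).
have := entropy_chain munit_adj munitM munit_sum munit_comm T_gt0 K0 (enum 'I_n) prho.
by rewrite big_enum.
Qed.

Lemma dirichlet_tensor (L : forall i, op R (T i) -> op R (T i)) : 1 <= q ->
  dirichlet (sum_gen L) st q X = \sum_i dirichlet (embed (L i)) st q X.
Proof.
move=> q1; have pst := posdef_tens psigma.
have aE : amp (sum_gen L) X = \sum_i amp (embed (L i)) X.
  apply: op_ext => x y; rewrite entry_sum entry_mkop.
  under [RHS]eq_bigr => i _ do rewrite entry_mkop.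
  rewrite [RHS]exchange_big /=; apply: eq_bigr => u _.
  rewrite [RHS]exchange_big /=; apply: eq_bigr => v _.
  by rewrite -mulr_sumr /sum_gen entry_sum.
have gE t : gamma_map st t (amp (sum_gen L) X) = \sum_i gamma_map st t (amp (embed (L i)) X).
  by rewrite aE /gamma_map mulmx_sumr mulmx_suml.
move: q1; rewrite le_eqVlt => /orP[/eqP <-|q1].
  rewrite (dirichletE1 pst k0) gE mulmx_suml Re_tr_sum mulr_sumr.
  by apply: eq_bigr => i _; rewrite (dirichletE1 pst k0).
rewrite (dirichletE pst k0 _ q1 pX) gE mulmx_sumr Re_tr_sum mulr_sumr.
by apply: eq_bigr => i _; rewrite (dirichletE pst k0 _ q1 pX).
Qed.

End TensorSystem.

Theorem theorem8p5 (R : realType) (n : nat) (T : 'I_n -> finType)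
    (L : forall i : 'I_n, op R (T i) -> op R (T i))
    (sigma : forall i : 'I_n, op R (T i))
    (q : R) (cs ds : 'I_n -> R) (c d : R) :
  1 <= q ->
  (forall i, primitive_QMS (L i) (sigma i)) ->
  (forall i, LSI_CB (L i) (sigma i) q (cs i) (ds i)) ->
  (forall i, cs i <= c) -> (exists i, c = cs i) ->
  d = \sum_(i < n) ds i ->
  LSI_CB (sum_gen L) (tens_state sigma) q c d.
Proof.
move=> q1 prim lsi csc _ -> k X k0 pX.
have q0 : 0 < q by rewrite (lt_le_trans ltr01).
have ps i : posdef (sigma i) by have [_ [_ []]] := prim i.
have T0 i : (0 < #|T i|)%N.
  rewrite lt0n; apply/eqP => Ti; have [_ [[[_ tr1] _] _]] := prim i.
  have : \tr (sigma i) = 0 by rewrite tr_entry big_pred0// => x; have := fintype0 x Ti.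
  by rewrite tr1 => /eqP; rewrite oner_eq0.
apply: le_trans (entp_tensor_le ps T0 k0 pX q0) _.
rewrite (dirichlet_tensor ps k0 pX _ q1) mulr_sumr [2 * _]mulr_sumr !mulr_suml.
rewrite -big_split; apply: ler_sum => i _ /=.
have lL : linear (L i) by have [[]] := prim i.
have inv Y : \tr (sigma i *m L i Y) = 0.
  by apply: (invariant_generator lL) => t t0; have [_ [[_ h] _]] := prim i; apply: h.
have pO := posdef_local_obs sigma T0 i q pX.
have H := lsi i _ _ (n_other_coords_gt0 _ i k0) pO.
apply: (le_trans H).
rewrite (normtau_local_obs ps T0 k0 i q pX) (dirichlet_local_obs ps T0 k0 pX lL inv q1).
(* Raising c_i to c needs a nonnegative form, which is known for the ampliated one-factor generator;
   hence the rewriting back to [local_obs]. *)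
rewrite lerD2r ler_wpM2r ?csc//.
rewrite -(dirichlet_local_obs ps T0 k0 pX lL inv q1).
exact: (dirichlet_ge0 (ps i) (n_other_coords_gt0 _ i k0) (prim i) q1 pO).
Qed.
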